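(* Let $p\in\mathbb{C}[z]$ be a polynomial of degree $n\geq 3$ with only simple zeros and let $D_p=\{(x,y,z)\in\mathbb{C}^3: xy=p(z)\}$. Let $f:D_p\to\mathbb{C}$ be a holomorphic function and let $\theta$ be a vector field on $D_p$ which is a lift of a partial derivative on $\mathbb{C}^2$. Then $$\widetilde m(\theta(f),r)\leq 14\cdot\widetilde m(f,r)+K(n)\cdot\log(r)+L$$ for all sufficiently large $r$ outside a set of finite linear measure, where $K(n)$ is an affine polynomial (in $n$) and $L$ is a constant.
   Context: Let $\pi:D_p\to\mathbb{C}^2$, $\pi(x,y,z)=(x+y,z)$; it is a two-sheeted branched covering, ramified exactly where $x=y$. Let $S^3\subset\mathbb{C}^2$ be the unit sphere and $\sigma$ the rotation-invariant Borel probability measure on it. Put $\log^+ t=\max\{\log t,0\}$. For a meromorphic function $h$ on $D_p$, $$\widetilde m(h,r)=\int_{S^3}\ \sum_{q\in\pi^{-1}(r\zeta)}\log^+|h(q)|\ d\sigma(\zeta),\qquad r>0.$$ With coordinates $(a,b)$ on $\mathbb{C}^2$, the lifts under $\pi$ of the partial derivatives $\partial/\partial a$ and $\partial/\partial b$ are the meromorphic vector fields on $D_p$ $$\theta_1=\frac{x}{x-y}\frac{\partial}{\partial x}-\frac{y}{x-y}\frac{\partial}{\partial y},\qquad \theta_2=\frac{p'(z)}{y-x}\left(\frac{\partial}{\partial x}-\frac{\partial}{\partial y}\right)+\frac{\partial}{\partial z}.$$ ''Lift of a partial derivative on $\mathbb{C}^2$'' means $\theta\in\{\theta_1,\theta_2\}$.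 A set of finite linear measure is a subset of $(0,\infty)$ of finite Lebesgue measure. *)

(* Defs.v *)
From HB Require Import structures.
From mathcomp Require Import all_boot all_order all_algebra.
From mathcomp Require Import all_classical all_reals all_analysis.
From mathcomp Require Import complex.
Set Implicit Arguments.
Unset Strict Implicit.
Unset Printing Implicit Defensive.
Import Order.TTheory GRing.Theory Num.Theory.
Import numFieldNormedType.Exports.
Local Open Scope classical_set_scope.
Local Open Scope ring_scope.

(* [R[i]^o] is [R[i]] with its structure of normed module over itself, so that
   [differentiable] below means Frechet differentiable over the complex numbers.
   The sup norms that [C2] and [C3] carry as products are only used for their
   topology. *)
Definition C (R : realType) : normedModType R[i] := (R[i])^o.
Definition C2 (R : realType) : normedModType R[i] := (C R * C R)%type.
Definition C3 (R : realType) : normedModType R[i] := (C R * C R * C R)%type.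

Section surface.
Variable R : realType.
Implicit Types (p : {poly R[i]}) (q : C3 R) (f F : C3 R -> C R).
Implicit Types (theta : C3 R -> C3 R).

Definition cx q : R[i] := q.1.1.
Definition cy q : R[i] := q.1.2.
Definition cz q : R[i] := q.2.

Definition simple_zeros p : Prop := forall z : R[i], root p z -> mup z p = 1%N.

Definition Dp p : set (C3 R) := [set q | cx q * cy q = p.[cz q]].

Definition piD q : C2 R := (cx q + cy q, cz q).

(* Functions on [Dp p] are represented by functions on [C3 R], of which only
   the values on [Dp p] matter. *)
Definition local_extension p f q F : Prop :=
  (\forall w \near q, differentiable F w) /\
  (\forall w \near q, Dp p w -> F w = f w).

Definition holomorphic_on_Dp p f : Prop :=
  forall q, Dp p q -> exists F, local_extension p f q F.

(* On the ramification locus [cx q = cy q], where these fields may have a pole,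
   division by zero gives them junk values. *)
Definition theta1 q : C3 R :=
  (cx q / (cx q - cy q), - (cy q / (cx q - cy q)), 0).

Definition theta2 p q : C3 R :=
  (p^`().[cz q] / (cy q - cx q), - (p^`().[cz q] / (cy q - cx q)), 1).

Definition lift_of_partial p theta : Prop :=
  theta = theta1 \/ theta = theta2 p.

(* The derivative of [f] at [q] along [theta q].  When [f] is holomorphic on
   [Dp p] and [theta q] is tangent to [Dp p], it does not depend on the local
   extension [F].  Both lifts are tangent off the locus [cx q = cy q], whose
   image under [piD] meets every sphere centred at 0 in a null set, so that the
   values there do not affect [mtilde]. *)
Definition vf_apply p theta f q : C R :=
  get [set l | exists2 F, local_extension p f q F & l = 'd F q (theta q)].

End surface.

Section proximity.
Variable R : realType.

Definition S3 : set (C2 R) :=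
  [set w | Normc.normc (w.1 : R[i]) ^+ 2 + Normc.normc (w.2 : R[i]) ^+ 2 = 1].

Definition borelC2 := g_sigma_algebraType (@open (C2 R)).

Definition to_R4 (w : C2 R) : 'rV[R]_4 :=
  \row_i [:: complex.Re w.1; complex.Im w.1; complex.Re w.2; complex.Im w.2]`_i.

Definition of_R4 (v : 'rV[R]_4) : C2 R :=
  (Complex (v 0 0) (v 0 1), Complex (v 0 2) (v 0 3)).

Definition is_rotation (M : 'M[R]_4) : Prop := M *m M^T = 1%:M /\ \det M = 1.

Definition rotation_invariant_on_S3 (sigma : probability borelC2 R) : Prop :=
  sigma S3 = 1%E /\
  forall M, is_rotation M -> forall A : set borelC2, measurable A ->
    sigma ((fun w => of_R4 (to_R4 w *m M)) @^-1` A) = sigma A.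

(* [ln 0 = 0], hence [logp 0 = 0]. *)
Definition logp (t : R) : R := Num.max (ln t) 0.

Definition mtilde (sigma : probability borelC2 R) (p : {poly R[i]})
    (h : C3 R -> C R) (r : R) : \bar R :=
  (\int[sigma]_(zeta in S3)
    \sum_(q \in Dp p `&` (@piD R @^-1` [set (r%:C)%C *: (zeta : C2 R)]))
      (logp (Normc.normc (h q : R[i])))%:E)%E.

End proximity.

(* Main.v *)
Require Import Defs.
From HB Require Import structures.
From mathcomp Require Import all_boot all_order all_algebra.
From mathcomp Require Import all_classical all_reals all_analysis.
From mathcomp Require Import complex.
From mathcomp Require Import measurable_realfun.
From mathcomp Require Import ring lra.
Set Implicit Arguments.
Unset Strict Implicit.
Unset Printing Implicit Defensive.
Import Order.TTheory GRing.Theory Num.Theory.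
Import numFieldNormedType.Exports.
Local Open Scope classical_set_scope.
Local Open Scope ring_scope.

(** The functions [f] and [theta f] are studied through what they induce on the plane.  Over a point
[z] of [C2] lie the two points [pt w z] and [pt (- w) z], where [w] is a square root of the
discriminant [disc p z].  The sum and the product of the two values of [f] are single-valued, and so
is the difference multiplied by [w]; these three functions are continuous, and differentiable along
complex lines away from the zeros of [disc p].  Hence [height], the larger of [logp] of the sum and
[logp] of the product, is continuous and differs from the sum of [logp |f|] over the fibre by at most
a constant.  Its mean [hmean] over the sphere of radius [r] is at most [mtilde f r + ln 2].

Only one analytic inequality is used, a form of Jensen's: if [S] is holomorphic off the zeros of a
holomorphic function, then [logp |S 0|] is at most the average of [logp |S|] over enough roots of
unity on a circle, up to an arbitrarily small error ([circle_jensen]).  It comes from the maximum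
principle for the product of the rotated copies of [S], which comes from Goursat's lemma in
logarithmic polar coordinates.

Lines through [z] are taken in the two directions [z] and [perp z].  For fixed [l] the maps sending
[z] to [z + l z] and to [z + l perp z] are products of a dilation and a rotation, left
multiplications by quaternions.  Averaging Jensen's inequality over the sphere therefore turns
averages over circles in these lines into values of [hmean] at the radii [r |1 + l|] and
[r * sqrt (1 + |l| ^+ 2)].  This shows that [hmean] is nondecreasing ([hmean_mono]).  Applied to the
difference quotients of [f] on a sheet, it also bounds the derivatives of [f] in the directions [z]
and [perp z], and [theta] is a combination of the lifts of these with bounded coefficients: this
bounds [mtilde (theta f) r] by twice a sum of three values of [hmean] at radii up to [r (1 + s)],
plus [2 ln (1 / s)], a multiple of [ln r] and a constant ([mtilde_vf_le]).  The price of the ramification is the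
positive part of [- ln |disc p|], whose spherical mean grows like [n ln r] ([smean_ell_le]), again by
Jensen's inequality.

Finally [s] is chosen as [1 / (r * t)], where [t] is a constant plus [mtilde f r].  By Borel's growth
lemma ([borel_growth]) the value of [hmean] at [r (1 + s) = r + 1 / t] is at most [2 t] outside an
exceptional set, and [ln (1 / s) = ln r + ln t] with [ln t] at most [t].  The factor 14 is
[2 * (2 + 2 + 2) + 2]. *)

(** * Integrals over segments *)

Section interval_integral.
Variable R : realType.
Implicit Types (f g : R -> R) (a b c k e : R).

Definition itvint f a b : R := \int[lebesgue_measure]_(x in `[a, b]) f x.

Lemma continuous_itv_integrable f a b : continuous f ->
  lebesgue_measure.-integrable `[a, b] (EFin \o f).
Proof.
move=> cf; apply: continuous_compact_integrable; first exact: segment_compact.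
exact: continuous_subspaceT.
Qed.

Lemma itvint_chasles f a b c : continuous f -> a <= b -> b <= c ->
  itvint f a c = itvint f a b + itvint f b c.
Proof.
move=> cf ab bc; apply/eqP; rewrite addrC -subr_eq; apply/eqP.
rewrite /itvint Rintegral_itvB ?bnd_simp//; last exact: continuous_itv_integrable.
rewrite Rintegral_itv_obnd_cbnd//.
apply: integrableS (continuous_itv_integrable b c cf) => //.
exact: subset_itv_oc_cc.
Qed.

Lemma itvint_cst k a b : a <= b -> itvint (cst k) a b = k * (b - a).
Proof.
move=> ab; rewrite /itvint Rintegral_cst//= lebesgue_measure_itv/= lte_fin.
by case: ltP => // ba; rewrite (le_anti (introT andP (conj ab ba))) subrr.
Qed.

Lemma le_itvint f g a b : continuous f -> continuous g ->
  (forall x, a <= x <= b -> f x <= g x) -> itvint f a b <= itvint g a b.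
Proof.
by move=> cf cg fg; apply: le_Rintegral => //; exact: continuous_itv_integrable.
Qed.

Lemma itvintB_near f g a b k e : continuous f -> continuous g -> a <= b ->
  (forall x, a <= x <= b -> `|f x - g x - k| <= e) ->
  `|itvint f a b - itvint g a b - k * (b - a)| <= e * (b - a).
Proof.
move=> cf cg ab H.
have ck x : continuous (cst x : R -> R) by move=> ?; exact: cvg_cst.
have -> : itvint f a b - itvint g a b = itvint (fun x => f x - g x) a b.
  by rewrite /itvint RintegralB//; exact: continuous_itv_integrable.
have cfg : continuous (fun x => f x - g x).
  by move=> x; apply: cvgB; [exact: cf|exact: cg].
have h1 : itvint (fun x => f x - g x) a b <= itvint (cst (k + e)) a b.
  by apply: le_itvint => // x /H; rewrite ler_norml /=; lra.
have h2 : itvint (cst (k - e)) a b <= itvint (fun x => f x - g x) a b.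
  by apply: le_itvint => // x /H; rewrite ler_norml /=; lra.
move: h1 h2; rewrite !itvint_cst// ler_norml => h1 h2.
by apply/andP; split; lra.
Qed.

End interval_integral.

(** * Goursat's lemma for rectangles *)

Section goursat.
Variable R : realType.
Implicit Types (phi psi : R -> R -> R) (s t a b e d : R).

(** Linear approximation of the pair [(phi, psi)] at [(s, t)] by a map satisfying the Cauchy-Riemann
equations. *)
Definition conformal_at phi psi s t := exists al be, forall e, 0 < e ->
  exists2 d : R, 0 < d & forall s' t', `|s' - s| < d -> `|t' - t| < d ->
   `|phi s' t' - phi s t - (al * (s' - s) - be * (t' - t))|
      <= e * (`|s' - s| + `|t' - t|) /\
   `|psi s' t' - psi s t - (be * (s' - s) + al * (t' - t))|
      <= e * (`|s' - s| + `|t' - t|).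

Variables phi psi : R -> R -> R.
Hypothesis conf : forall s t, conformal_at phi psi s t.

Let lin_continuous (f : R -> R) x k d : 0 < d ->
  (forall y, `|y - x| < d -> `|f y - f x - k * (y - x)| <= `|y - x|) ->
  {for x, continuous f}.
Proof.
move=> d0 H; apply/cvgrPdist_lt => e e0.
have k1 : 0 < `|k| + 1 by rewrite ltr_wpDl.
near=> y.
have yd : `|y - x| < d by rewrite distrC; near: y; exact: cvgr_dist_lt.
have ye : `|y - x| < e / (`|k| + 1).
  by rewrite distrC; near: y; apply: cvgr_dist_lt => //; exact: divr_gt0.
rewrite ltr_pdivlMr// in ye; rewrite distrC.
have := H y yd; have := ler_normD (f y - f x - k * (y - x)) (k * (y - x)).
by rewrite subrK normrM; nra.
Unshelve. all: by end_near. Qed.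

Let cphi s : continuous (phi s).
Proof.
move=> t; have [al [be /(_ 1 ltr01)[d d0 H]]] := conf s t.
apply: (@lin_continuous _ _ (- be) d) => // y yd.
have := H s y; rewrite subrr normr0 => /(_ d0 yd)[+ _].
by rewrite mulr0 sub0r opprK add0r mul1r mulNr opprK.
Qed.

Let cpsi t : continuous (psi ^~ t).
Proof.
move=> s; have [al [be /(_ 1 ltr01)[d d0 H]]] := conf s t.
apply: (@lin_continuous _ _ be d) => // y yd.
have := H y t; rewrite subrr normr0 => /(_ yd d0)[_].
by rewrite mulr0 !addr0 mul1r.
Qed.

(** The imaginary part of the integral of [phi + i psi] along the boundary of the rectangle with corner
[s + i t] and sides [a] and [b]. *)
Definition rectint s a t b : R :=
  (itvint (phi (s + a)) t (t + b) - itvint (phi s) t (t + b)) -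
  (itvint (psi ^~ (t + b)) s (s + a) - itvint (psi ^~ t) s (s + a)).

(** A linear map satisfying the Cauchy-Riemann equations has boundary integral 0, so only the error of
the linear approximation contributes. *)
Lemma rectint_small s t e : 0 < e -> exists2 d : R, 0 < d &
  forall s0 a t0 b, 0 <= a < d -> 0 <= b < d -> s0 <= s <= s0 + a ->
    t0 <= t <= t0 + b -> `|rectint s0 a t0 b| <= e * (a + b) ^+ 2.
Proof.
move=> e0; have [al [be H]] := conf s t.
have /H[d d0 {}H] : 0 < e / 2 by lra.
exists d => // s0 a t0 b /andP[a0 ad] /andP[b0 bd] /andP[s1 s2] /andP[t1 t2].
have h1 : `|itvint (phi (s0 + a)) t0 (t0 + b) - itvint (phi s0) t0 (t0 + b)
      - al * a * (t0 + b - t0)| <= e * (a + b) * (t0 + b - t0).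
  apply: itvintB_near => //; first lra.
  move=> x /andP[x1 x2].
  have xt : `|x - t| <= b by rewrite ler_norml; lra.
  have sa1 : `|s0 + a - s| <= a by rewrite ler_norml; lra.
  have sa2 : `|s0 - s| <= a by rewrite ler_norml; lra.
  have [K1 _] := H (s0 + a) x (le_lt_trans sa1 ad) (le_lt_trans xt bd).
  have [K2 _] := H s0 x (le_lt_trans sa2 ad) (le_lt_trans xt bd).
  have K1' := le_trans K1 (ler_wpM2l (ltW (divr_gt0 e0 (ltr0n _ 2))) (lerD sa1 xt)).
  have K2' := le_trans K2 (ler_wpM2l (ltW (divr_gt0 e0 (ltr0n _ 2))) (lerD sa2 xt)).
  move: K1' K2'; rewrite !ler_norml; lra.
have h2 : `|itvint (psi ^~ (t0 + b)) s0 (s0 + a) - itvint (psi ^~ t0) s0 (s0 + a)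
      - al * b * (s0 + a - s0)| <= e * (a + b) * (s0 + a - s0).
  apply: itvintB_near => //; first lra.
  move=> x /andP[x1 x2].
  have xt : `|x - s| <= a by rewrite ler_norml; lra.
  have sa1 : `|t0 + b - t| <= b by rewrite ler_norml; lra.
  have sa2 : `|t0 - t| <= b by rewrite ler_norml; lra.
  have [_ K1] := H x (t0 + b) (le_lt_trans xt ad) (le_lt_trans sa1 bd).
  have [_ K2] := H x t0 (le_lt_trans xt ad) (le_lt_trans sa2 bd).
  have K1' := le_trans K1 (ler_wpM2l (ltW (divr_gt0 e0 (ltr0n _ 2))) (lerD xt sa1)).
  have K2' := le_trans K2 (ler_wpM2l (ltW (divr_gt0 e0 (ltr0n _ 2))) (lerD xt sa2)).
  move: K1' K2'; rewrite !ler_norml; lra.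
rewrite /rectint; move: h1 h2; rewrite !ler_norml => /andP[h11 h12] /andP[h21 h22].
by apply/andP; split; nra.
Qed.

Lemma rectint_quarter s a t b : 0 <= a -> 0 <= b ->
  rectint s a t b = rectint s (a/2) t (b/2) + rectint (s + a/2) (a/2) t (b/2)
   + rectint s (a/2) (t + b/2) (b/2) + rectint (s + a/2) (a/2) (t + b/2) (b/2).
Proof.
move=> a0 b0.
have ha : s + a / 2 + a / 2 = s + a by lra.
have hb : t + b / 2 + b / 2 = t + b by lra.
rewrite /rectint !ha !hb.
have e1 f : continuous f -> itvint f s (s + a)
   = itvint f s (s + a/2) + itvint f (s + a / 2) (s + a).
  by move=> cf; apply: itvint_chasles => //; lra.
have e2 f : continuous f -> itvint f t (t + b)
   = itvint f t (t + b/2) + itvint f (t + b / 2) (t + b).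
  by move=> cf; apply: itvint_chasles => //; lra.
rewrite !(e1 (psi^~ _)) // !(e2 (phi _)) //; ring.
Qed.

Lemma rectint_pigeonhole s a t b : 0 <= a -> 0 <= b ->
  exists s' t', [/\ s <= s' <= s + a/2, t <= t' <= t + b/2 &
    `|rectint s a t b| <= 4 * `|rectint s' (a/2) t' (b/2)|].
Proof.
move=> a0 b0; have := rectint_quarter s t a0 b0.
set x1 := rectint s (a/2) t _; set x2 := rectint (s + _) _ t _.
set x3 := rectint s _ (t + _) _; set x4 := rectint (s + _) _ (t + _) _.
move=> ->.
have xle : `|x1 + x2 + x3 + x4| <= `|x1| + `|x2| + `|x3| + `|x4|.
  by rewrite (le_trans (ler_normD _ _))// lerD2r (le_trans (ler_normD _ _))//
    lerD2r ler_normD.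
set x : R := `|x1 + x2 + x3 + x4| in xle *.
have [h1|h1] := leP x (4 * `|x1|); first by exists s, t; split => //; lra.
have [h2|h2] := leP x (4 * `|x2|); first by exists (s + a/2), t; split => //; lra.
have [h3|h3] := leP x (4 * `|x3|); first by exists s, (t+b/2); split => //; lra.
exists (s + a/2), (t+b/2); split => //; lra.
Qed.

Let nested (u h : nat -> R) : (forall n, 0 <= h n) ->
  (forall n, u n <= u n.+1 /\ u n.+1 + h n.+1 <= u n + h n) ->
  exists x, forall n, u n <= x <= u n + h n.
Proof.
move=> h0 H.
have mono m n : (m <= n)%N -> u m <= u n /\ u n + h n <= u m + h m.
  elim: n => [|n IH]; first by rewrite leqn0 => /eqP ->.
  rewrite leq_eqVlt => /predU1P[->//|]; rewrite ltnS => /IH[i1 i2].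
  by have [h1 h2] := H n; split; lra.
have cross m n : u m <= u n + h n.
  have [mn|/ltnW nm] := leqP m n.
    by have [] := mono _ _ mn; have := h0 n; lra.
  by have [] := mono _ _ nm; have := h0 m; lra.
have ub n : ubound (range u) (u n + h n) by move=> _ [m _ <-]; exact: cross.
have hs : has_sup (range u).
  by split; [exists (u 0%N), 0%N|exists (u 0%N + h 0%N); exact: ub].
exists (sup (range u)) => n; apply/andP; split.
  by apply: sup_upper_bound => //; exists n.
by apply: ge_sup; [exact: hs.1|exact: ub].
Qed.

(** Goursat's argument: a rectangle with nonzero boundary integral would contain nested rectangles,
each carrying at least a quarter of the previous integral, shrinking to a point where linear
approximation makes the integral negligible against the area. *)
Lemma rectint_eq0 s a t b : 0 <= a -> 0 <= b -> rectint s a t b = 0.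
Proof.
move=> a0 b0.
pose A n : R := a / 2 ^+ n; pose B n : R := b / 2 ^+ n.
have A0 n : 0 <= A n by rewrite divr_ge0// exprn_ge0.
have B0 n : 0 <= B n by rewrite divr_ge0// exprn_ge0.
have AS n : A n.+1 = A n / 2 by rewrite /A exprS invfM mulrCA mulrC.
have BS n : B n.+1 = B n / 2 by rewrite /B exprS invfM mulrCA mulrC.
have /choice[F HF] (np : nat * (R * R)) : exists q : R * R,
    [/\ np.2.1 <= q.1 <= np.2.1 + A np.1 / 2,
        np.2.2 <= q.2 <= np.2.2 + B np.1 / 2 &
    `|rectint np.2.1 (A np.1) np.2.2 (B np.1)|
      <= 4 * `|rectint q.1 (A np.1 / 2) q.2 (B np.1 / 2)|].
  have [s' [t' [h1 h2 h3]]] := rectint_pigeonhole np.2.1 np.2.2 (A0 np.1) (B0 np.1).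
  by exists (s', t').
pose u := fix u n := if n is m.+1 then F (m, u m) else (s, t).
have uS n := HF (n, u n); rewrite /= in uS.
have [x Hx] : exists x, forall n, (u n).1 <= x <= (u n).1 + A n.
  apply: nested => // n; rewrite AS.
  by have [/andP[h1 h2] _ _] := uS n; split => //; move: h2; rewrite -/u /=; lra.
have [y Hy] : exists y, forall n, (u n).2 <= y <= (u n).2 + B n.
  apply: nested => // n; rewrite BS.
  by have [_ /andP[h1 h2] _] := uS n; split => //; move: h2; rewrite -/u /=; lra.
have grow n : `|rectint s a t b| <= 4 ^+ n * `|rectint (u n).1 (A n) (u n).2 (B n)|.
  elim: n => [|n IH]; first by rewrite /A /B !expr0 mul1r !divr1.
  apply: (le_trans IH); rewrite exprSr -mulrA ler_wpM2l ?exprn_ge0//.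
  by rewrite AS BS; have [] := uS n.
suff bnd e : 0 < e -> `|rectint s a t b| <= e * (a + b) ^+ 2.
  apply/eqP; rewrite -normr_le0; apply/ler_addgt0Pr => e e0; rewrite add0r.
  have q0 : 0 < (a + b) ^+ 2 + 1 by rewrite ltr_wpDl// sqr_ge0.
  apply: le_trans (bnd _ (divr_gt0 e0 q0)) _.
  rewrite mulrAC ler_pdivrMr// ler_wpM2l ?(ltW e0)//; lra.
move=> e0; have [d d0 Hd] := rectint_small x y e0.
have small c : 0 <= c -> exists n, forall m, (n <= m)%N -> c / 2 ^+ m < d.
  move=> c0; exists (Num.truncn (c / d)).+1 => m nm.
  rewrite ltr_pdivrMr ?exprn_gt0// mulrC -ltr_pdivrMr//.
  apply: (lt_le_trans (truncnS_gt _)).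
  rewrite -natrX ler_nat; apply: (leq_trans nm).
  exact: ltnW (ltn_expl _ _).
have [n1 H1] := small a a0; have [n2 H2] := small b b0.
pose n := maxn n1 n2.
have An : A n < d by apply: H1; exact: leq_maxl.
have Bn : B n < d by apply: H2; exact: leq_maxr.
apply: (le_trans (grow n)).
have := Hd (u n).1 (A n) (u n).2 (B n); rewrite A0 B0 An Bn Hx Hy => /(_ isT isT isT isT).
move=> /(ler_wpM2l (exprn_ge0 n (ler0n R 4))) /le_trans; apply.
have -> : A n + B n = (a + b) / 2 ^+ n by rewrite /A /B -mulrDl.
have -> : (4:R) ^+ n = 2 ^+ n ^+ 2.
  by rewrite -exprM mulnC exprM; congr (_ ^+ n); ring.
by rewrite expr_div_n mulrCA [X in _ * X]mulrC divfK// sqrf_eq0 expf_eq0 pnatr_eq0 andbF.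
Qed.

End goursat.

(** * The real-valued modulus and complex continuity *)

Section complex_modulus.
Variable R : realType.
Notation nc := (@Normc.normc R).
Local Notation K := (C R).
Implicit Types z w : K.

Lemma normc_ge0 (z : R[i]) : 0 <= nc z.
Proof. by case: z => a b /=; rewrite sqrtr_ge0. Qed.

Lemma normrCE (z : R[i]) : `|z| = (nc z)%:C%C.
Proof. by rewrite normc_def; case: z. Qed.

Lemma normc_eq0 (z : R[i]) : (nc z == 0) = (z == 0).
Proof.
by apply/eqP/eqP => [/Normc.eq0_normc//|->]; rewrite Normc.normc0.
Qed.

Lemma normc_gt0 (z : R[i]) : (0 < nc z) = (z != 0).
Proof. by rewrite lt0r normc_ge0 andbT normc_eq0. Qed.

Lemma normcD_le (z w : K) : nc (z + w) <= nc z + nc w.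
Proof. exact: le_normcD. Qed.

Lemma normcNE (z : R[i]) : nc (- z) = nc z.
Proof. exact: normcN. Qed.

Lemma normcB_le (z w : K) : nc (z - w) <= nc z + nc w.
Proof. by rewrite -(normcNE w); exact: normcD_le. Qed.

Lemma normcBC (z w : K) : nc (z - w) = nc (w - z).
Proof. by rewrite -normcNE opprB. Qed.

Lemma normcB_ge (z w : K) : nc z - nc w <= nc (z - w).
Proof. by rewrite lerBlDr -[in leLHS](subrK w z) normcD_le. Qed.

Lemma normcX (z : R[i]) n : nc (z ^+ n) = nc z ^+ n.
Proof.
elim: n => [|n IH]; first by rewrite !expr0 Normc.normc1.
by rewrite !exprS Normc.normcM IH.
Qed.

Lemma normc_real (x : R) : nc x%:C%C = `|x|.
Proof. by rewrite /= expr0n addr0 sqrtr_sqr. Qed.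

Lemma normc_nat n : nc n%:R = n%:R.
Proof. by rewrite -(rmorph_nat (real_complex R)) normc_real ger0_norm ?ler0n. Qed.

Lemma normcJE (z : R[i]) : nc (z^*)%C = nc z.
Proof. by case: z => a b /=; rewrite sqrrN. Qed.

Lemma normc_sqr (z : R[i]) : nc z ^+ 2 = complex.Re z ^+ 2 + complex.Im z ^+ 2.
Proof. by case: z => a b /=; rewrite sqr_sqrtr// addr_ge0// sqr_ge0. Qed.

Lemma normc_Re (z : R[i]) : `|complex.Re z| <= nc z.
Proof.
case: z => a b /=; rewrite -sqrtr_sqr ler_wsqrtr// lerDl; exact: sqr_ge0.
Qed.

Lemma normc_Im (z : R[i]) : `|complex.Im z| <= nc z.
Proof.
case: z => a b /=; rewrite -sqrtr_sqr ler_wsqrtr// lerDr; exact: sqr_ge0.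
Qed.

Lemma normc_le_ReIm (z : R[i]) : nc z <= `|complex.Re z| + `|complex.Im z|.
Proof.
rewrite [in leLHS](complexE z); apply: (le_trans (normcD_le _ _)).
by rewrite Normc.normcM !normc_real /= expr0n expr1n add0r sqrtr1 mul1r.
Qed.

Lemma normc_prod (I : Type) (r : seq I) (P : pred I) (F : I -> R[i]) :
  nc (\prod_(i <- r | P i) F i) = \prod_(i <- r | P i) nc (F i).
Proof. by elim/big_rec2: _ => [|i y x _ <-]; rewrite ?Normc.normc1 ?Normc.normcM. Qed.

Lemma normc_sum (I : Type) (r : seq I) (P : pred I) (F : I -> R[i]) :
  nc (\sum_(i <- r | P i) F i) <= \sum_(i <- r | P i) nc (F i).
Proof.
elim/big_rec2: _ => [|i y x _ xy]; first by rewrite Normc.normc0.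
by apply: (le_trans (normcD_le _ _)); rewrite lerD2l.
Qed.

(** The next two lemmas convert the topology of [C R], which is defined by the [R[i]]-valued norm,
into statements on the real-valued modulus. *)
Lemma nearCP z (P : set K) :
  (\forall w \near z, P w) <-> exists2 d : R, 0 < d & forall w, nc (w - z) < d -> P w.
Proof.
split.
  move=> /nbhs_ballP[e /= e0 H].
  have er : e = (complex.Re e)%:C%C by rewrite RRe_real// ger0_real// ltW.
  exists (complex.Re e); first by move: e0; rewrite er ltcR.
  move=> w wd; apply: H; rewrite -ball_normE /= distrC normrCE er.
  by rewrite ltcR.
move=> [d d0 H]; apply/nbhs_ballP; exists (d%:C)%C; first by rewrite /= ltcR.
move=> w; rewrite -ball_normE /= distrC normrCE ltcR; exact: H.
Qed.

Lemma cvgCP (T : Type) (F : set_system T) (FF : Filter F) (f : T -> K) (l : K) :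
  (f @ F --> l) <-> forall e : R, 0 < e -> \forall w \near F, nc (f w - l) < e.
Proof.
split.
  move=> H e e0; have : \forall w \near l, nc (w - l) < e by apply/nearCP; exists e.
  exact: H.
move=> H A /nearCP[d d0 HA]; have := H d d0; apply: filterS => w; exact: HA.
Qed.

Section algebra.
Variables (T : topologicalType) (x : T).
Implicit Types f g : T -> K.

Lemma ccont_cst (c : K) : {for x, continuous (fun _ : T => c)}.
Proof. exact: cvg_cst. Qed.

Lemma ccontD f g : {for x, continuous f} -> {for x, continuous g} ->
  {for x, continuous (fun t => f t + g t : K)}.
Proof. by move=> cf cg; exact: (cvgD cf cg). Qed.

Lemma ccontN f : {for x, continuous f} -> {for x, continuous (fun t => - f t : K)}.
Proof. by move=> cf; exact: (cvgN cf). Qed.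

Lemma ccontB f g : {for x, continuous f} -> {for x, continuous g} ->
  {for x, continuous (fun t => f t - g t : K)}.
Proof. by move=> cf cg; exact: (cvgB cf cg). Qed.

Lemma ccontM f g : {for x, continuous f} -> {for x, continuous g} ->
  {for x, continuous (fun t => f t * g t : K)}.
Proof. by move=> cf cg; exact: (@cvgM R[i] _ _ _ f g _ _ cf cg). Qed.

Lemma ccontV f : f x != 0 -> {for x, continuous f} ->
  {for x, continuous (fun t => (f t)^-1 : K)}.
Proof. by move=> f0 cf; exact: (@cvgV R[i] _ _ _ _ _ f0 cf). Qed.

Lemma ccontX f n : {for x, continuous f} -> {for x, continuous (fun t => f t ^+ n : K)}.
Proof.
move=> cf; elim: n => [|n IH].
  rewrite (_ : (fun t => f t ^+ 0 : K) = (fun _ : T => 1 : K)).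
    exact: (@ccont_cst 1).
  by apply/funext => t; rewrite expr0.
rewrite (_ : (fun t => f t ^+ n.+1 : K) = (fun t => f t * f t ^+ n : K)).
  exact: (ccontM cf IH).
by apply/funext => t; rewrite exprS.
Qed.

Lemma ccont_prod (I : Type) (r : seq I) (F : I -> T -> K) :
  (forall i, {for x, continuous (F i)}) ->
  {for x, continuous (fun t => \prod_(i <- r) F i t : K)}.
Proof.
move=> cF; elim: r => [|i r IH].
  rewrite (_ : (fun t => _) = (fun _ : T => 1 : K)); first exact: (@ccont_cst 1).
  by apply/funext => t; rewrite big_nil.
rewrite (_ : (fun t => _) = (fun t => F i t * \prod_(i <- r) F i t : K)).
  exact: (ccontM (cF i) IH).
by apply/funext => t; rewrite big_cons.
Qed.

Lemma ccontJ f : {for x, continuous f} -> {for x, continuous (fun t => (f t)^*%C : K)}.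
Proof.
move=> /cvgCP cf; apply/cvgCP => e /cf; apply: filterS => t.
by rewrite -raddfB normcJE.
Qed.

Lemma ccont_normc f : {for x, continuous f} -> {for x, continuous (fun t => nc (f t) : R)}.
Proof.
move=> /cvgCP cf; apply/cvgrPdist_lt => e /cf; apply: filterS => t; apply: le_lt_trans.
have := normcB_ge (f t) (f x); have := normcB_ge (f x) (f t).
by rewrite normcBC ler_norml; lra.
Qed.

Lemma ccont_Re f : {for x, continuous f} -> {for x, continuous (fun t => complex.Re (f t) : R)}.
Proof.
move=> /cvgCP cf; apply/cvgrPdist_lt => e /cf; apply: filterS => t; apply: le_lt_trans.
by rewrite normcBC -raddfB normc_Re.
Qed.

End algebra.

Lemma ccont_id z : {for z, continuous (fun w : K => w)}.
Proof. exact: cvg_id. Qed.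

Lemma ccont_horner (T : topologicalType) (x : T) (p : {poly R[i]}) (f : T -> K) :
  {for x, continuous f} -> {for x, continuous (fun t => p.[f t] : K)}.
Proof.
move=> cf; elim/poly_ind: p => [|p c IH].
  rewrite (_ : (fun t => _) = (fun _ : T => 0 : K)); first exact: (@ccont_cst _ _ 0).
  by apply/funext => t; rewrite horner0.
rewrite (_ : (fun t => _) = (fun t => p.[f t] * f t + c : K)).
  exact: (ccontD (ccontM IH cf) (@ccont_cst _ _ c)).
by apply/funext => t; rewrite hornerMXaddC.
Qed.

End complex_modulus.

(** * Complex derivatives *)

Section complex_derivative.
Variable R : realType.
Notation nc := (@Normc.normc R).
Local Notation K := (C R).
Implicit Types (f g : K -> K) (z l m : K).

(** Caratheodory's form of complex differentiability: product and composition rules become algebra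
and continuity. *)
Definition cder g z l := exists phi : K -> K,
  [/\ {for z, continuous phi}, phi z = l & forall w, g w = g z + phi w * (w - z)].

Lemma cder_continuous g z l : cder g z l -> {for z, continuous g}.
Proof.
move=> [phi [cphi _ E]]; rewrite (_ : g = (fun w => g z + phi w * (w - z))).
  have cB := ccontB (@ccont_id R z) (@ccont_cst R _ z z).
  exact: (ccontD (@ccont_cst R _ z (g z)) (ccontM cphi cB)).
by apply/funext => w; exact: E.
Qed.

Lemma cder_cst (c : K) z : cder (fun _ => c) z 0.
Proof.
exists (fun _ => 0); split; [exact: (@ccont_cst R _ z 0)|by []|].
by move=> w; rewrite mul0r addr0.
Qed.

Lemma cder_id z : cder id z 1.
Proof.
exists (fun _ => 1); split; [exact: (@ccont_cst R _ z 1)|by []|].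
by move=> w; rewrite mul1r addrC subrK.
Qed.

Lemma cderD f g z l m : cder f z l -> cder g z m -> cder (fun w => f w + g w) z (l + m).
Proof.
move=> [p [cp <- Ef]] [q [cq <- Eg]]; exists (fun w => p w + q w).
split; [exact: (ccontD cp cq)|by []|].
by move=> w; rewrite Ef Eg; ring.
Qed.

Lemma cderM f g z l m : cder f z l -> cder g z m ->
  cder (fun w => f w * g w) z (l * g z + f z * m).
Proof.
move=> df [q [cq <- Eg]]; have cf := cder_continuous df.
move: df => [p [cp <- Ef]]; exists (fun w => p w * g z + f w * q w).
split; [|by []|].
  exact: (ccontD (ccontM cp (@ccont_cst R _ z (g z))) (ccontM cf cq)).
by move=> w; rewrite Eg mulrDr [in f w * g z]Ef; ring.
Qed.

Lemma cderZ (c : K) g z m : cder g z m -> cder (fun w => c * g w) z (c * m).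
Proof. by move=> dg; have := cderM (cder_cst c z) dg; rewrite mul0r add0r. Qed.

Lemma cderN g z m : cder g z m -> cder (fun w => - g w) z (- m).
Proof.
move=> /(cderZ (-1)); rewrite mulN1r; congr (cder _ _ _).
by apply/funext => w; rewrite mulN1r.
Qed.

Lemma cderB f g z l m : cder f z l -> cder g z m -> cder (fun w => f w - g w) z (l - m).
Proof. by move=> df /cderN; exact: cderD. Qed.

Lemma cder_comp f g z l m : cder f z l -> cder g (f z) m ->
  cder (fun w => g (f w)) z (m * l).
Proof.
move=> df [q [cq <- Eg]]; have cf := cder_continuous df.
move: df => [p [cp <- Ef]]; exists (fun w => q (f w) * p w).
split; [|by []|].
  exact: (ccontM (@continuous_comp _ _ _ f q z cf cq) cp).
by move=> w; rewrite Eg [in f w - _]Ef; ring.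
Qed.

Lemma cderX g z m n : cder g z m -> cder (fun w => g w ^+ n) z (n%:R * g z ^+ n.-1 * m).
Proof.
move=> dg; elim: n => [|n IH].
  rewrite !mul0r; rewrite (_ : (fun w => _) = fun _ => 1); first exact: cder_cst.
  by apply/funext => w; rewrite expr0.
have := cderM dg IH; congr (cder _ _ _).
  by apply/funext => w; rewrite exprS.
rewrite /=; case: n {IH} => [|n]; first by rewrite expr0; ring.
by rewrite /= exprS -[in RHS]addn1 natrD; ring.
Qed.

Lemma cder_prod (I : Type) (r : seq I) (F : I -> K -> K) z :
  (forall i, exists l, cder (F i) z l) ->
  exists l, cder (fun w => \prod_(i <- r) F i w) z l.
Proof.
move=> H; elim: r => [|i r [l IH]].
  exists 0; rewrite (_ : (fun w => _) = fun _ => 1); first exact: cder_cst.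
  by apply/funext => w; rewrite big_nil.
have [m dm] := H i; have := cderM dm IH.
set l' := (X in cder _ _ X) => dl; exists l'; move: dl; congr (cder _ _ _).
by apply/funext => w; rewrite big_cons.
Qed.

Lemma cder_horner (p : {poly R[i]}) g z m : cder g z m ->
  cder (fun w => p.[g w]) z (p^`().[g z] * m).
Proof.
move=> dg; elim/poly_ind: p => [|p c IH].
  rewrite linear0 horner0 mul0r; rewrite (_ : (fun w => _) = fun _ => 0).
    exact: cder_cst.
  by apply/funext => w; rewrite horner0.
have := cderD (cderM IH dg) (cder_cst c z); congr (cder _ _ _).
  by apply/funext => w; rewrite hornerMXaddC.
by rewrite derivD derivC derivM derivX !hornerE; ring.
Qed.

(** A zero of [g] absorbs the lack of differentiability of [f]. *)
Lemma cder_mul_zero f g z m : {for z, continuous f} -> cder g z m -> g z = 0 ->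
  exists l, cder (fun w => f w * g w) z l.
Proof.
move=> cf [q [cq _ Eg]] gz; exists (f z * q z), (fun w => f w * q w).
split; [|by []|].
  exact: (ccontM cf cq).
by move=> w; rewrite Eg gz mulr0 !add0r mulrA.
Qed.

Lemma cder_approx g z l (e : R) : cder g z l -> 0 < e -> exists2 d : R, 0 < d &
  forall w, nc (w - z) < d -> nc (g w - g z - l * (w - z)) <= e * nc (w - z).
Proof.
move=> [p [/cvgCP cp <- E]] e0; have /nearCP[d d0 H] := cp _ e0.
exists d => // w /H /ltW h.
rewrite E (_ : _ - _ = (p w - p z) * (w - z)); last by ring.
by rewrite Normc.normcM ler_wpM2r ?normc_ge0.
Qed.

End complex_derivative.

(** * Logarithmic polar coordinates *)

Section logpolar.
Variable R : realType.
Notation nc := (@Normc.normc R).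
Local Notation K := (C R).
Implicit Types (s t h k e d : R).

Definition cis t : K := Complex (cos t) (sin t).
Definition polar s t : K := (expR s)%:C%C * cis t.

Lemma normc_cis t : nc (cis t) = 1.
Proof. by rewrite /= cos2Dsin2 sqrtr1. Qed.

Lemma cisD t s : cis (t + s) = cis t * cis s.
Proof.
rewrite /cis cosD sinD; apply/eqP; rewrite eq_complex /=; apply/andP; split => //.
by rewrite addrC.
Qed.

Lemma cisD2pi t : cis (t + pi *+ 2) = cis t.
Proof. by rewrite /cis cosD2pi sinD2pi. Qed.

Lemma cis0 : cis 0 = 1.
Proof. by rewrite /cis cos0 sin0. Qed.

Lemma cisN t : cis (- t) = (cis t)^*%C.
Proof. by rewrite /cis cosN sinN. Qed.

Lemma continuous_cis t : {for t, continuous cis}.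
Proof.
apply/cvgCP => e e0.
have /cvgrPdist_lt/(_ (e/2)) c1 := @continuous_cos R t.
have /cvgrPdist_lt/(_ (e/2)) c2 := @continuous_sin R t.
near=> u.
have h1 : `|cos t - cos u| < e / 2 by near: u; apply: c1; lra.
have h2 : `|sin t - sin u| < e / 2 by near: u; apply: c2; lra.
apply: (le_lt_trans (normc_le_ReIm _)); rewrite !raddfB /= distrC [in X in _ + X]distrC.
lra.
Unshelve. all: by end_near. Qed.

Lemma normc_polar s t : nc (polar s t) = expR s.
Proof. by rewrite Normc.normcM normc_cis mulr1 normc_real ger0_norm// expR_ge0. Qed.

Lemma polar_neq0 s t : polar s t != 0.
Proof. by rewrite -normc_gt0 normc_polar expR_gt0. Qed.

Lemma polarD s t h k : polar (s + h) (t + k) = polar s t * polar h k.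
Proof. by rewrite /polar cisD expRD rmorphM/=; ring. Qed.

Let real_approx (f : R -> R) (x l e : R) : is_derive x (1 : R) f l -> 0 < e ->
  exists2 d : R, 0 < d & forall h, `|h| < d -> `|f (x + h) - f x - l * h| <= e * `|h|.
Proof.
move=> [df <-] e0; have /cvgrPdist_le/(_ _ e0) := df; rewrite /derive.
set L := lim _ => /nbhs_ballP[d /= d0 H]; exists d => // h hd.
have [->|h0] := eqVneq h 0; first by rewrite addr0 subrr mulr0 subrr !normr0 mulr0.
have := H h; rewrite -ball_normE /= sub0r normrN => /(_ hd h0).
rewrite (_ : h%:A = h :> R) => [H'|]; last by rewrite /GRing.scale /= mulr1.
rewrite -(@ler_pM2l _ `|h|^-1) ?invr_gt0 ?normr_gt0//.
rewrite mulrCA mulVf ?normr_eq0// mulr1 -normfV -normrM; apply: le_trans H'.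
rewrite -normrN (addrC x h) opprB mulrBr mulrCA mulVf// mulr1 le_eqVlt; apply/orP; left.
by apply/eqP; congr (`|_|).
Qed.

(** [polar] is the complex exponential function, whose derivative at 0 is 1. *)
Let polar_near1 e : 0 < e -> exists2 d : R, 0 < d & forall h k, `|h| < d -> `|k| < d ->
  nc (polar h k - 1 - Complex h k) <= e * (`|h| + `|k|).
Proof.
move=> e0; wlog e1 : e e0 / e <= 1.
  move=> H; have [e1|e1] := leP e 1; first exact: H.
  have [d d0 Hd] := H 1 ltr01 (lexx _); exists d => // h k hd kd.
  by apply: (le_trans (Hd _ _ hd kd)); rewrite ler_wpM2r// ?addr_ge0// ltW.
have e8 : 0 < e / 16 by lra.
have [d1 d10 H1] := real_approx (is_derive_expR 0) e8.
have [d2 d20 H2] := real_approx (is_derive_cos 0) e8.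
have [d3 d30 H3] := real_approx (is_derive_sin 0) e8.
pose d := Num.min (Num.min d1 d2) (Num.min d3 (e / 16)).
exists d; first by rewrite /d !lt_min d10 d20 d30.
move=> h k; rewrite /d !lt_min => /andP[/andP[hd1 hd2] /andP[hd3 hd4]].
move=> /andP[/andP[kd1 kd2] /andP[kd3 kd4]].
have := H1 h hd1; rewrite add0r expR0 mul1r => h1.
have := H2 k kd2; rewrite add0r cos0 sin0 oppr0 mul0r subr0 => h2.
have := H3 k kd3; rewrite add0r cos0 sin0 mul1r subr0 => h3.
have hh := normr_ge0 h; have kk := normr_ge0 k.
have E2 : expR h <= 2.
  by have : `|expR h - 1| <= 1; [have := ler_normD (expR h - 1 - h) h; rewrite subrK; nra
    |rewrite ler_norml; lra].
have E0 := expR_ge0 h.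
have Eh : `|expR h - 1| <= 2 * `|h|.
  by have := ler_normD (expR h - 1 - h) h; rewrite subrK; nra.
apply: (le_trans (normc_le_ReIm _)); rewrite !raddfB /=.
have -> : expR h * cos k - 0 * sin k - 1 - h = expR h * (cos k - 1) + (expR h - 1 - h) by ring.
have -> : expR h * sin k + 0 * cos k - 0 - k = expR h * (sin k - k) + (expR h - 1) * k by ring.
have b1 := ler_normD (expR h * (cos k - 1)) (expR h - 1 - h).
have b2 := ler_normD (expR h * (sin k - k)) ((expR h - 1) * k).
rewrite !normrM (ger0_norm E0) in b1 b2.
have c1 : expR h * `|cos k - 1| <= e / 8 * `|k|.
  by apply: (le_trans (ler_pM _ _ E2 h2)) => //; lra.
have c2 : expR h * `|sin k - k| <= e / 8 * `|k|.
  by apply: (le_trans (ler_pM _ _ E2 h3)) => //; lra.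
have c3 : `|expR h - 1| * `|k| <= e / 8 * `|h|.
  apply: (le_trans (ler_wpM2r _ Eh)) => //; nra.
nra.
Qed.

(** In logarithmic polar coordinates a holomorphic function still satisfies the Cauchy-Riemann
equations. *)
Lemma polar_conformal (g : K -> K) s t l : cder g (polar s t) l ->
  conformal_at (fun s t => complex.Re (g (polar s t)))
    (fun s t => complex.Im (g (polar s t))) s t.
Proof.
move=> dg; set z := polar s t; set L := l * z.
exists (complex.Re L), (complex.Im L) => e e0.
have z0 : 0 < nc z by rewrite normc_gt0 polar_neq0.
have nl0 : 0 <= nc L by exact: normc_ge0.
pose e1 := e / (6 * nc z).
have e10 : 0 < e1 by rewrite divr_gt0// mulr_gt0.
have [d1 d10 H1] := cder_approx dg e10.
have [e2 [e20 e21 e22]] : exists e2 : R, [/\ 0 < e2, e2 <= 1 & e2 * nc L <= e / 2].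
  have q0 : 0 < 2 * (nc L + 1) by rewrite mulr_gt0// ltr_wpDl.
  exists (Num.min 1 (e / (2 * (nc L + 1)))); split; first by rewrite lt_min ltr01 divr_gt0.
    by rewrite ge_min lexx.
  apply: (@le_trans _ _ (e / (2 * (nc L + 1)) * nc L)).
    by rewrite ler_wpM2r// ge_min lexx orbT.
  by rewrite mulrAC ler_pdivrMr//; nra.
have [d2 d20 H2] := polar_near1 e20.
pose d := Num.min d2 (d1 / (6 * nc z)).
have d0 : 0 < d by rewrite lt_min d20/= divr_gt0// mulr_gt0.
exists d => // s' t'.
rewrite !lt_min => /andP[sd2 sd1] /andP[td2 td1].
set h := s' - s; set k := t' - t; rewrite -/h in sd1 sd2; rewrite -/k in td1 td2.
have E : polar s' t' = z * polar h k.
  by rewrite -polarD; congr polar; rewrite addrC subrK.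
have near1 := H2 _ _ sd2 td2.
have hk : nc (Complex h k) <= `|h| + `|k|.
  exact: (normc_le_ReIm (Complex h k)).
have hh := normr_ge0 h; have kk := normr_ge0 k.
have dz : nc (polar s' t' - z) <= 2 * nc z * (`|h| + `|k|).
  rewrite E (_ : _ - z = z * (polar h k - 1)); last by ring.
  rewrite Normc.normcM -mulrA mulrCA ler_wpM2l ?normc_ge0//.
  rewrite -[X in nc X](subrK (Complex h k : K)).
  apply: (le_trans (normcD_le _ _)); apply: (le_trans (lerD near1 hk)).
  by have := ler_wpM2r (addr_ge0 hh kk) e21; rewrite mul1r; lra.
have dzd : nc (polar s' t' - z) < d1.
  have z6 : 0 < 6 * nc z by exact: mulr_gt0.
  move: sd1 td1; rewrite !ltr_pdivlMr// => sd1 td1.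
  apply: (le_lt_trans dz); set n := nc z in sd1 td1 *; lra.
have main : nc (g (polar s' t') - g z - L * Complex h k) <= e * (`|h| + `|k|).
  rewrite (_ : _ - _ = (g (polar s' t') - g z - l * (polar s' t' - z))
     + L * (polar h k - 1 - Complex h k)); last by rewrite E /L; ring.
  apply: (le_trans (normcD_le _ _)).
  have b1 : nc (g (polar s' t') - g z - l * (polar s' t' - z)) <= e / 3 * (`|h| + `|k|).
    apply: (le_trans (H1 _ dzd)); apply: (le_trans (ler_wpM2l (ltW e10) dz)).
    rewrite /e1 le_eqVlt; apply/orP; left; apply/eqP; field.
    by rewrite gt_eqF.
  have b2 : nc (L * (polar h k - 1 - Complex h k)) <= e / 2 * (`|h| + `|k|).
    rewrite Normc.normcM; apply: (le_trans (ler_wpM2l nl0 near1)).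
    rewrite mulrA ler_wpM2r ?addr_ge0// mulrC//.
  by nra.
have ReE (a b c : R[i]) : complex.Re (a - b - c * Complex h k) =
    complex.Re a - complex.Re b - (complex.Re c * h - complex.Im c * k).
  by case: a b c => [? ?] [? ?] [? ?].
have ImE (a b c : R[i]) : complex.Im (a - b - c * Complex h k) =
    complex.Im a - complex.Im b - (complex.Im c * h + complex.Re c * k).
  by case: a b c => [? ?] [? ?] [? ?] /=; rewrite [X in _ - X]addrC.
by rewrite -ReE -ImE; split; [apply: le_trans (normc_Re _) main|apply: le_trans (normc_Im _) main].
Qed.

End logpolar.

(** * The maximum principle for centres of circles *)

Section maximum_principle.
Variable R : realType.
Notation nc := (@Normc.normc R).
Local Notation K := (C R).
Implicit Types (s t r e M B : R) (F S Q : K -> K) (z : K).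

Let twopi : R := pi *+ 2.
Let twopi_gt0 : 0 < twopi.
Proof. by rewrite /twopi mulrn_wgt0// pi_gt0. Qed.

(** The mean of [F] over a circle does not depend on the radius, by Goursat's lemma on the strips
of the logarithmic plane, and tends to [F 0] as the radius tends to 0. *)
Lemma center_le_circle F r M : 0 < r -> {for 0, continuous F} ->
  (forall z, z != 0 -> exists l, cder F z l) ->
  (forall t, 0 <= t <= pi *+ 2 -> nc (F (r%:C%C * cis t)) <= M) -> nc (F 0) <= M.
Proof.
move=> r0 cF dF FM.
have [F0|F0] := eqVneq (F 0) 0.
  rewrite F0 Normc.normc0; apply: le_trans (FM 0 _); first exact: normc_ge0.
  by rewrite lexx ltW.
(* A rotation makes the value at the centre real, so that real parts suffice. *)
pose c : K := (nc (F 0))%:C%C / F 0; pose G : K -> K := fun w => c * F w.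
have nF0 : nc (F 0) != 0 by rewrite normc_eq0.
have nc1 : nc c = 1.
  by rewrite Normc.normcM Normc.normcV normc_real ger0_norm ?normc_ge0// divff.
have G0 : G 0 = (nc (F 0))%:C%C by rewrite /G /c mulfVK.
have dG s t : exists l, cder G (polar s t) l.
  by have [l dl] := dF _ (polar_neq0 s t); exists (c * l); exact: cderZ.
pose phi s t := complex.Re (G (polar s t)); pose psi s t := complex.Im (G (polar s t)).
have conf s t : conformal_at phi psi s t.
  by have [l dl] := dG s t; exact: polar_conformal dl.
have cphi s : continuous (phi s).
  move=> t; have [l dl] := dG s t; apply: (ccont_Re (f := fun t => G (polar s t))).
  apply: (@continuous_comp _ _ _ (fun t => polar s t : K) G); last exact: cder_continuous dl.
  exact: (ccontM (@ccont_cst R _ t ((expR s)%:C%C)) (@continuous_cis R t)).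
apply/ler_addgt0Pr => e e0.
have /cvgCP/(_ e e0)/nearCP[d d0 Hd] := cF.
pose s1 := ln r; pose s0 := Num.min (ln d - 1) s1.
have s01 : s0 <= s1 by rewrite /s0 ge_min lexx orbT.
have s0d : expR s0 < d.
  rewrite -[ltRHS](@lnK R d)// ltr_expR.
  by apply: (@le_lt_trans _ _ (ln d - 1)); [rewrite /s0 ge_min lexx|lra].
have : rectint phi psi s0 (s1 - s0) 0 twopi = 0.
  by apply: rectint_eq0 => //; [lra|exact: ltW].
have per : psi ^~ (0 + twopi) = psi ^~ 0.
  by apply/funext => s; rewrite /psi /polar cisD2pi.
have E1 : s0 + (s1 - s0) = s1 by rewrite addrC subrK.
rewrite /rectint per add0r E1 [X in _ - X]subrr subr0 => /eqP; rewrite subr_eq0 => /eqP main.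
have up : itvint (phi s1) 0 twopi <= M * twopi.
  have := @itvint_cst R M 0 twopi (ltW twopi_gt0); rewrite subr0 => <-.
  apply: le_itvint; [exact: cphi|by move=> ?; exact: cvg_cst|].
  move=> t tI; apply: (le_trans (ler_norm _)); apply: (le_trans (normc_Re _)).
  rewrite Normc.normcM nc1 mul1r /polar (_ : expR s1 = r); first exact: FM.
  by rewrite /s1 lnK.
have low : (nc (F 0) - e) * twopi <= itvint (phi s0) 0 twopi.
  have := @itvint_cst R (nc (F 0) - e) 0 twopi (ltW twopi_gt0); rewrite subr0 => <-.
  apply: le_itvint; [by move=> ?; exact: cvg_cst|exact: cphi|].
  move=> t _ /=.
  have : nc (G (polar s0 t) - G 0) < e.
    rewrite -mulrBr Normc.normcM nc1 mul1r; apply: Hd.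
    by rewrite subr0 normc_polar.
  move=> h; have := le_lt_trans (normc_Re _) h.
  have ReB (x y : R[i]) : complex.Re (x - y) = complex.Re x - complex.Re y.
    by case: x y => [? ?] [? ?].
  have ReR (x : R) : complex.Re (x%:C%C) = x by [].
  by rewrite ReB G0 ReR => /ltW; rewrite ler_norml lerBrDl => /andP[].
rewrite -lerBlDr -(ler_pM2r twopi_gt0); apply: (le_trans low); by rewrite -main.
Qed.

(** Zeros of an auxiliary holomorphic function [Q] may be exceptional for [S]: the products
[S ^+ k * Q] are differentiable there, and the influence of [Q] disappears as [k] grows. *)
Lemma center_le_circle_off_zeros S Q r M B : 0 < r -> 0 <= M ->
  continuous S -> (forall z, exists l, cder Q z l) -> Q 0 != 0 ->
  (forall z, z != 0 -> Q z != 0 -> exists l, cder S z l) ->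
  (forall t, 0 <= t <= pi *+ 2 -> nc (Q (r%:C%C * cis t)) <= B) ->
  (forall t, 0 <= t <= pi *+ 2 -> nc (S (r%:C%C * cis t)) <= M) -> nc (S 0) <= M.
Proof.
move=> r0 M0 cS dQ Q0 dS QB SM; rewrite leNgt; apply/negP => MS.
have key k : nc (S 0) ^+ k * nc (Q 0) <= M ^+ k * B.
  rewrite -normcX -Normc.normcM.
  apply: (@center_le_circle (fun z => S z ^+ k * Q z) r) => //.
  - have [l dl] := dQ 0.
    exact: (ccontM (ccontX (cS 0)) (cder_continuous dl)).
  - move=> z z0; have [l dl] := dQ z; have [Qz|Qz] := eqVneq (Q z) 0.
      exact: (cder_mul_zero (ccontX (cS z)) dl Qz).
    have [m dm] := dS z z0 Qz; exact: ex_intro (cderM (@cderX _ _ _ _ k dm) dl).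
  - move=> t tI; rewrite Normc.normcM normcX ler_pM ?exprn_ge0 ?normc_ge0//.
      by rewrite lerXn2r ?nnegrE ?normc_ge0// SM.
    exact: QB.
have nQ : 0 < nc (Q 0) by rewrite normc_gt0.
pose N := (nc (S 0) + M) / 2.
have N0 : 0 < N by rewrite /N; lra.
have B0 : 0 <= B.
  by apply: le_trans (QB 0 _); [exact: normc_ge0|rewrite lexx ltW].
have key2 k : nc (S 0) ^+ k * nc (Q 0) <= N ^+ k * B.
  apply: (le_trans (key k)); rewrite ler_wpM2r// lerXn2r ?nnegrE//; [lra|].
  by rewrite /N; lra.
pose x := nc (S 0) / N - 1.
have x0 : 0 < x by rewrite subr_gt0 ltr_pdivlMr// mul1r /N; lra.
have bern k : 1 + k%:R * x <= (1 + x) ^+ k.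
  elim: k => [|k IH]; first by rewrite mul0r addr0 expr0.
  rewrite exprS -natr1; have k0 : 0 <= k%:R :> R by [].
  have x1 : 0 <= 1 + x by lra.
  by have := ler_wpM2l x1 IH; apply: le_trans; nra.
have key3 k : (1 + k%:R * x) * nc (Q 0) <= B.
  apply: le_trans (ler_wpM2r (ltW nQ) (bern k)) _.
  rewrite (addrC 1) /x subrK expr_div_n mulrAC ler_pdivrMr ?exprn_gt0// [leRHS]mulrC.
  exact: key2.
pose k := (Num.truncn (B / (x * nc (Q 0)))).+1.
have := key3 k; apply/negP; rewrite -ltNge.
have : B / (x * nc (Q 0)) < k%:R by exact: truncnS_gt.
rewrite ltr_pdivrMr ?mulr_gt0// => h; nra.
Qed.

End maximum_principle.

(** * The positive part of the logarithm *)

Section logplus.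
Variable R : realType.
Implicit Types (s t x y : R).

Lemma logp_ge0 t : 0 <= logp t.
Proof. by rewrite /logp le_max lexx orbT. Qed.

Lemma le_expR_logp t : t <= expR (logp t).
Proof.
have [t0|t0] := leP t 0; first exact: le_trans t0 (expR_ge0 _).
by rewrite -[leLHS](@lnK R t)// ler_expR /logp le_max lexx.
Qed.

Lemma logp_le_of_expR t y : 0 <= y -> t <= expR y -> logp t <= y.
Proof.
move=> y0 ty; rewrite /logp ge_max y0 andbT.
have [t0|t0] := leP t 0; first by rewrite ln0.
by rewrite -ler_expR lnK.
Qed.

Lemma logp_le1 t : t <= 1 -> logp t = 0.
Proof.
move=> t1; apply/eqP; rewrite eq_le logp_ge0 andbT.
by apply: logp_le_of_expR => //; rewrite expR0.
Qed.

Lemma logp_ge1 t : 1 <= t -> logp t = ln t.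
Proof. by move=> t1; rewrite /logp; apply/max_idPl; rewrite ln_ge0. Qed.

Lemma logp0 : logp 0 = 0 :> R. Proof. exact: logp_le1. Qed.

Lemma le_logp s t : s <= t -> logp s <= logp t.
Proof.
by move=> st; apply: logp_le_of_expR (logp_ge0 _) (le_trans st (le_expR_logp _)).
Qed.

Lemma logpM_le s t : 0 <= s -> 0 <= t -> logp (s * t) <= logp s + logp t.
Proof.
move=> s0 t0; apply: logp_le_of_expR; first by rewrite addr_ge0 ?logp_ge0.
by rewrite expRD ler_pM ?le_expR_logp.
Qed.

Lemma expR_ln2 : expR (ln 2) = 2 :> R.
Proof. by rewrite lnK// posrE. Qed.

Lemma ln2_ge0 : 0 <= ln 2 :> R.
Proof. by rewrite ln_ge0// ler1n. Qed.

Lemma expRD2_le x y : 0 <= x -> 0 <= y -> expR x + expR y <= expR (x + y + ln 2).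
Proof.
move=> x0 y0; rewrite 2!expRD expR_ln2.
have := @expR_ge1Dx R x; have := @expR_ge1Dx R y; nra.
Qed.

Lemma logpD_le s t : 0 <= s -> 0 <= t -> logp (s + t) <= logp s + logp t + ln 2.
Proof.
move=> s0 t0; apply: logp_le_of_expR; first by rewrite !addr_ge0 ?logp_ge0 ?ln2_ge0.
apply: le_trans (expRD2_le _ _); rewrite ?logp_ge0//.
by rewrite lerD ?le_expR_logp.
Qed.

Lemma logpE t : logp t = ln (Num.max t 1).
Proof.
case: (leP t 1) => t1.
  by rewrite logp_le1// ln1.
by rewrite logp_ge1// ltW.
Qed.

Lemma continuous_logp : continuous (@logp R).
Proof.
move=> t; rewrite (_ : @logp R = @ln R \o (fun s => Num.max s 1)); last first.
  by apply/funext => s; exact: logpE.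
apply: continuous_comp; last first.
  by apply: continuous_ln; rewrite lt_max ltr01 orbT.
exact: (@continuous_max R R id (cst 1) t (@cvg_id _ _) (@cvg_cst _ _ _ _ _)).
Qed.

End logplus.

(** * Jensen's inequality with averages over roots of unity *)

Section jensen.
Variable R : realType.
Notation nc := (@Normc.normc R).
Local Notation K := (C R).
Implicit Types (s t r e d x y B : R) (S Q : K -> K) (z : K).

(** Uniform continuity with only one of the two points confined to the segment: the averages below
compare points inside a period with points that may lie beyond its end. *)
Lemma continuous_itv_unif (v : R -> R) a b e : continuous v -> 0 < e ->
  exists2 d : R, 0 < d & forall x y, a <= x <= b -> `|x - y| < d -> `|v x - v y| < e.
Proof.
move=> cv e0.
have /compact_near_coveringP H := @segment_compact R a b.
pose P (d x : R) := forall y, `|x - y| < d -> `|v x - v y| < e.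
have : \forall d \near 0^'+, forall x, `[a, b]%classic x -> P d x.
  apply: H => x _.
  have /cvgrPdist_lt/(_ (e / 2)) := cv x; rewrite divr_gt0// => /(_ isT).
  move=> /nbhs_ballP[d /= d0 Hd].
  exists (ball x (d / 2), [set d' | d' < d / 2]).
    split => /=; first by apply: nbhsx_ballx; rewrite divr_gt0.
    by apply: nbhs_right_lt; rewrite divr_gt0.
  move=> [x' d'] [/= Hx Hd'] y xy.
  have h1 : `|v x - v x'| < e / 2.
    apply: Hd; apply: le_ball Hx; lra.
  have h2 : `|v x - v y| < e / 2.
    apply: Hd; rewrite -ball_normE /=; rewrite -ball_normE /= in Hx.
    have := ler_normD (x - x') (x' - y); rewrite addrA subrK; lra.
  have := ler_normD (v x' - v x) (v x - v y); rewrite addrA subrK.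
  by rewrite [in X in _ <= X + _]distrC; lra.
move=> Hn; have [d [d0 Hd]] : exists d, 0 < d /\ forall x, `[a, b]%classic x -> P d x.
  near (0 : R)^'+ => d; exists d; split; first by near: d; exact: nbhs_right_gt.
  by near: d.
by exists d => // x y xab; apply: Hd; rewrite /= in_itv.
Unshelve. all: by end_near. Qed.

Definition angle N j : R := j%:R * (pi *+ 2 / N.+1%:R).

Definition circle_avg N (v : R -> R) : R :=
  N.+1%:R^-1 * \sum_(j < N.+1) v (angle N j).

Lemma circle_avg_ge0 N v : (forall t, 0 <= v t) -> 0 <= circle_avg N v.
Proof. by move=> v0; rewrite mulr_ge0 ?invr_ge0// sumr_ge0. Qed.

Lemma le_circle_avg N v w : (forall t, v t <= w t) -> circle_avg N v <= circle_avg N w.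
Proof. by move=> vw; rewrite ler_wpM2l ?invr_ge0// ler_sum. Qed.

Lemma circle_avgDr N v k : circle_avg N (fun t => v t + k) = circle_avg N v + k.
Proof.
rewrite /circle_avg big_split /= mulrDr sumr_const card_ord -[k *+ _]mulr_natl mulKf//.
Qed.

Let avg_shift N (v : R -> R) t : (forall s, v (s + pi *+ 2) = v s) ->
  \sum_(j < N.+1) v (t + pi *+ 2 / N.+1%:R + angle N j) = \sum_(j < N.+1) v (t + angle N j).
Proof.
move=> per; pose h : R := pi *+ 2 / N.+1%:R.
have E j : t + h + angle N j = t + angle N j.+1.
  by rewrite /angle -/h -[j.+1%:R]natr1; ring.
rewrite (eq_bigr (fun j : 'I_N.+1 => v (t + angle N j.+1))) => [|j _]; last by rewrite E.
rewrite big_ord_recr [in RHS]big_ord_recl /= addrC; congr (_ + _).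
rewrite (_ : angle N N.+1 = pi *+ 2); last by rewrite /angle mulrC divfK.
by rewrite per /angle mul0r addr0.
Qed.

(** Shifting by a multiple of the step permutes the sample points of a periodic function, so any shift
may be reduced below one step. *)
Let avg_osc N (v : R -> R) e d t : 0 < d -> (forall s, v (s + pi *+ 2) = v s) ->
  (forall x y, 0 <= x <= pi *+ 2 -> `|x - y| < d -> `|v x - v y| < e) ->
  pi *+ 2 / N.+1%:R < d -> 0 <= t ->
  \sum_(j < N.+1) v (t + angle N j) <= \sum_(j < N.+1) (v (angle N j) + e).
Proof.
move=> d0 per H hd t0; pose h : R := pi *+ 2 / N.+1%:R.
have h0 : 0 < h by rewrite divr_gt0// mulrn_wgt0// pi_gt0.
pose m := Num.truncn (t / h).
have /andP[m1 m2] : m%:R <= t / h < m.+1%:R by rewrite truncn_itv// divr_ge0// ltW.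
rewrite ler_pdivlMr// in m1; rewrite ltr_pdivrMr// -[m.+1%:R]natr1 mulrDl mul1r in m2.
have [u [u0 uh ->]] : exists u, [/\ 0 <= u, u < h & t = u + m%:R * h].
  by exists (t - m%:R * h); split; lra.
have -> : \sum_(j < N.+1) v (u + m%:R * h + angle N j) = \sum_(j < N.+1) v (u + angle N j).
  elim: m {m1 m2} => [|m IH]; first by rewrite mul0r addr0.
  rewrite -IH -[in RHS]avg_shift//; apply: eq_bigr => j _; congr v.
  by rewrite -[m.+1%:R]natr1 -/h; ring.
apply: ler_sum => j _.
have h2 : N.+1%:R * h = pi *+ 2 by rewrite mulrC divfK.
have : `|v (angle N j) - v (u + angle N j)| < e.
  apply: H; last by rewrite opprD addrCA subrr addr0 normrN ger0_norm// (lt_trans uh).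
  rewrite /angle -/h -h2 mulr_ge0 ?(ltW h0)//= ler_wpM2r ?(ltW h0)// ler_nat.
  exact: ltnW.
rewrite ltr_norml; lra.
Qed.

(** Jensen's inequality, with the integral over the circle replaced by averages over roots of unity:
[|S 0|] to the power [N.+1] is the value at 0 of the product of the rotated functions
[z |-> S (z * w)], [w] running over the roots of unity, whose modulus on the circle is controlled
through the uniform continuity of [logp |S|] there. *)
Lemma circle_jensen S Q r B e : 0 < r -> 0 < e ->
  continuous S -> (forall z, exists l, cder Q z l) -> Q 0 != 0 ->
  (forall z, z != 0 -> Q z != 0 -> exists l, cder S z l) ->
  (forall t, nc (Q (r%:C%C * cis t)) <= B) ->
  exists N0, forall N, (N0 <= N)%N ->
    logp (nc (S 0)) <= circle_avg N (fun t => logp (nc (S (r%:C%C * cis t)))) + e.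
Proof.
move=> r0 e0 cS dQ Q0 dS QB.
pose v t := logp (nc (S (r%:C%C * cis t))).
have cv : continuous v.
  move=> t; apply: (@continuous_comp _ _ _ (fun t => nc (S (r%:C%C * cis t))) (@logp R)).
    apply: (@ccont_normc _ _ t (fun t => S (r%:C%C * cis t))).
    apply: (@continuous_comp _ _ _ (fun t => r%:C%C * cis t : K) S); last exact: cS.
    exact: (ccontM (@ccont_cst R _ t (r%:C%C)) (@continuous_cis R t)).
  exact: continuous_logp.
have per s : v (s + pi *+ 2) = v s by rewrite /v cisD2pi.
have [d d0 Hd] := @continuous_itv_unif v 0 (pi *+ 2) e cv e0.
exists (Num.truncn (pi *+ 2 / d)) => N NN.
have Nd : pi *+ 2 / N.+1%:R < d.
  rewrite ltr_pdivrMr// mulrC -ltr_pdivrMr//.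
  by apply: (lt_le_trans (truncnS_gt _)); rewrite ler_nat ltnS.
pose A := circle_avg N v + e.
have A0 : 0 <= A.
  by rewrite addr_ge0 ?(ltW e0)//; apply: circle_avg_ge0 => t; exact: logp_ge0.
apply: logp_le_of_expR => //; rewrite -/A.
pose cs j : K := cis (angle N j).
have dlin (j : nat) z : cder (fun w => w * cs j) z (1 * cs j + z * 0).
  exact: cderM (cder_id z) (cder_cst (cs j) z).
have clin (j : nat) z : {for z, continuous (fun w : K => w * cs j : K)}.
  exact: cder_continuous (dlin j z).
pose PS z : K := \prod_(j < N.+1) S (z * cs j).
pose PQ z : K := \prod_(j < N.+1) Q (z * cs j).
have cPS : continuous PS.
  move=> z; apply: ccont_prod => j.
  exact: (@continuous_comp _ _ _ (fun w : K => w * cs j : K) S z (clin j z) (cS _)).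
have dPQ z : exists l, cder PQ z l.
  apply: cder_prod => j; have [l dl] := dQ (z * cs j).
  exact: ex_intro (cder_comp (dlin j z) dl).
have PQ0 : PQ 0 != 0 by apply/prodf_neq0 => j _; rewrite mul0r.
have dPS z : z != 0 -> PQ z != 0 -> exists l, cder PS z l.
  move=> z0 Qz; apply: cder_prod => j.
  have Qj : Q (z * cs j) != 0 by move/prodf_neq0: Qz; apply.
  have zj : z * cs j != 0 by rewrite mulf_neq0// -normc_gt0 normc_cis.
  have [l dl] := dS _ zj Qj.
  exact: ex_intro (cder_comp (dlin j z) dl).
have PQB t : 0 <= t <= pi *+ 2 -> nc (PQ (r%:C%C * cis t)) <= B ^+ N.+1.
  move=> _; rewrite normc_prod -[N.+1 in leRHS]card_ord -prodr_const.
  apply: ler_prod => j _; rewrite normc_ge0 /= -mulrA -cisD; exact: QB.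
have PSB t : 0 <= t <= pi *+ 2 -> nc (PS (r%:C%C * cis t)) <= expR (N.+1%:R * A).
  move=> /andP[t0 _]; rewrite normc_prod.
  apply: (@le_trans _ _ (\prod_(j < N.+1) expR (v (t + angle N j)))).
    apply: ler_prod => j _; rewrite normc_ge0 /= -mulrA -cisD; exact: le_expR_logp.
  rewrite -expR_sum ler_expR; apply: (le_trans (avg_osc d0 per Hd Nd t0)).
  rewrite big_split /= sumr_const card_ord /A mulrDr -[e *+ _]mulr_natl.
  by rewrite /circle_avg mulVKf ?pnatr_eq0.
have main : nc (PS 0) <= expR (N.+1%:R * A).
  exact: (center_le_circle_off_zeros r0 (expR_ge0 _) cPS dPQ PQ0 dPS PQB PSB).
rewrite /PS in main.
rewrite (eq_bigr (fun _ => S 0)) in main; last by move=> j _; rewrite mul0r.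
move: main; rewrite prodr_const card_ord normcX expRM_natl.
by rewrite ler_pXn2r// nnegrE ?normc_ge0 ?expR_ge0.
Qed.

End jensen.

(** * Monotone and limiting bounds on integrals *)

Section lower_integral.
Context d (T : measurableType d) (R : realType).
Variables (mu : {measure set T -> \bar R}) (D : set T).
Implicit Types f g : T -> \bar R.
Local Open Scope ereal_scope.

(** The integral of a nonnegative function is a supremum over the simple functions below it, hence
monotone even for functions that are not measurable. *)
Lemma ge0_le_integral_nonmeas f g : (forall x, D x -> 0 <= f x) ->
  (forall x, D x -> f x <= g x) -> \int[mu]_(x in D) f x <= \int[mu]_(x in D) g x.
Proof.
move=> f0 fg; have g0 x : D x -> 0 <= g x by move=> Dx; exact: le_trans (f0 x Dx) (fg x Dx).
rewrite !ge0_integralE//; apply: ge_ereal_sup => _ [h hf <-].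
apply: ereal_sup_ubound; exists h => // x; apply: (le_trans (hf x)).
by rewrite /patch; case: ifPn => //; rewrite inE; exact: fg.
Qed.

Lemma limn_einfE (u : (\bar R)^nat) : limn_einf u = ereal_sup (range (einfs u)).
Proof. by rewrite limn_einf_lim; apply/cvg_lim => //; exact: cvg_einfs_sup. Qed.

(** Fatou's lemma, in the form in which it replaces all limits under the integral sign. *)
Lemma integral_le_of_eventually_le g (h : nat -> T -> R) (c : \bar R) :
  measurable D -> (forall n, measurable_fun D (h n)) ->
  (forall n x, D x -> (0 <= h n x)%R) -> (forall x, D x -> 0 <= g x) ->
  (forall x, D x -> exists n0, forall n, (n0 <= n)%N -> g x <= (h n x)%:E) ->
  (forall n, \int[mu]_(x in D) (h n x)%:E <= c) -> \int[mu]_(x in D) g x <= c.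
Proof.
move=> mD mh h0 g0 gh hc.
apply: (@le_trans _ _ (\int[mu]_(x in D) limn_einf (fun n => (h n x)%:E))).
  apply: ge0_le_integral_nonmeas => // x Dx; rewrite limn_einfE.
  have [n0 H] := gh x Dx; apply: (@le_trans _ _ (einfs (fun n => (h n x)%:E) n0)).
    by apply: le_ereal_inf_tmp => _ [n /= nn <-]; exact: H.
  by apply: ereal_sup_ubound; exists n0.
apply: (@le_trans _ _ (limn_einf (fun n => \int[mu]_(x in D) (h n x)%:E))).
  apply: (@fatou _ _ _ mu D mD (fun n x => (h n x)%:E)).
    by move=> n; exact/measurable_EFinP.
  by move=> n x Dx; rewrite lee_fin h0.
rewrite limn_einfE; apply: ge_ereal_sup => _ [n _ <-].
apply: le_trans (hc n); apply: ereal_inf_lbound; by exists n => /=.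
Qed.

End lower_integral.

(** * Rotations of the three-sphere by quaternions *)

Section sphere.
Variable R : realType.
Notation nc := (@Normc.normc R).
Local Notation K := (C R).
Local Notation T2 := (C2 R).
Implicit Types (w z : T2) (al mu : K).

Lemma continuous_borel_measurable (g : T2 -> R) : continuous g ->
  measurable_fun (setT : set (borelC2 R)) (g : borelC2 R -> R).
Proof.
move=> /continuousP cg; apply: (measurability _ (RGenOpens.measurableE R)).
move=> _ [_ [a [b ->] <-]]; rewrite setTI.
by apply: sub_sigma_algebra; exact/cg/interval_open.
Qed.

Lemma continuous_borel_measurable_map (g : T2 -> T2) : continuous g ->
  measurable_fun (setT : set (borelC2 R)) (g : borelC2 R -> borelC2 R).
Proof.
move=> /continuousP cg; apply: (@measurability _ _ (borelC2 R) (borelC2 R) setT g (@open T2) erefl).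
move=> _ [U oU <-]; rewrite setTI.
by apply: sub_sigma_algebra; exact: cg.
Qed.

Lemma continuous_fst2 w : {for w, continuous (fun w : T2 => w.1 : K)}.
Proof. exact: cvg_fst. Qed.

Lemma continuous_snd2 w : {for w, continuous (fun w : T2 => w.2 : K)}.
Proof. exact: cvg_snd. Qed.

Lemma continuous_pair2 (T : topologicalType) (x : T) (f g : T -> K) :
  {for x, continuous f} -> {for x, continuous g} ->
  {for x, continuous (fun t => (f t, g t) : T2)}.
Proof. by move=> cf cg; exact: (cvg_pair cf cg). Qed.

Definition sqnorm2 w : R := nc w.1 ^+ 2 + nc w.2 ^+ 2.

Lemma S3E w : S3 w <-> sqnorm2 w = 1. Proof. by []. Qed.

Lemma continuous_sqnorm2 : continuous sqnorm2.
Proof.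
move=> w; have c1 := ccont_normc (@continuous_fst2 w).
have c2 := ccont_normc (@continuous_snd2 w).
exact: (cvgD (cvgM c1 c1) (cvgM c2 c2)).
Qed.

Lemma measurable_S3 : measurable (@S3 R : set (borelC2 R)).
Proof.
have := continuous_borel_measurable continuous_sqnorm2.
by move=> /(_ measurableT [set 1] (measurable_set1 1)); rewrite setTI.
Qed.

(** Left multiplication by the quaternion [al + mu j], where [j] sends [(a, b)] to minus the
conjugate of [b] and the conjugate of [a]. *)
Definition quat al mu w : T2 :=
  (al * w.1 - mu * (w.2)^*%C, al * w.2 + mu * (w.1)^*%C).

Definition twist al w : T2 := (al * w.1, w.2).

Lemma continuous_quat al mu : continuous (quat al mu).
Proof.
move=> w; have c1 := @continuous_fst2 w; have c2 := @continuous_snd2 w.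
have ca := @ccont_cst R _ w al; have cm := @ccont_cst R _ w mu.
exact: (continuous_pair2 (ccontB (ccontM ca c1) (ccontM cm (ccontJ c2)))
  (ccontD (ccontM ca c2) (ccontM cm (ccontJ c1)))).
Qed.

Lemma continuous_twist al : continuous (twist al).
Proof.
move=> w; have c1 := @continuous_fst2 w; have c2 := @continuous_snd2 w.
exact: (continuous_pair2 (ccontM (@ccont_cst R _ w al) c1) c2).
Qed.

Lemma sqnorm2_quat al mu w : sqnorm2 (quat al mu w) = (nc al ^+ 2 + nc mu ^+ 2) * sqnorm2 w.
Proof.
rewrite /sqnorm2 /quat !normc_sqr; case: w => [[x1 y1] [x2 y2]]; case: al => a b; case: mu => c d /=.
ring.
Qed.

Lemma sqnorm2_twist al w : nc al = 1 -> sqnorm2 (twist al w) = sqnorm2 w.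
Proof. by move=> al1; rewrite /sqnorm2 /twist /= Normc.normcM al1 mul1r. Qed.

Definition mx4 (s : seq (seq R)) : 'M[R]_4 := \matrix_(i, j) (nth [::] s i)`_j.

(** Laplace expansion along the first two rows. *)
Lemma det_mx4 a11 a12 a13 a14 a21 a22 a23 a24 a31 a32 a33 a34 a41 a42 a43 a44 :
  \det (mx4 [:: [:: a11; a12; a13; a14]; [:: a21; a22; a23; a24];
               [:: a31; a32; a33; a34]; [:: a41; a42; a43; a44]]) =
  (a11 * a22 - a12 * a21) * (a33 * a44 - a34 * a43)
  - (a11 * a23 - a13 * a21) * (a32 * a44 - a34 * a42)
  + (a11 * a24 - a14 * a21) * (a32 * a43 - a33 * a42)
  + (a12 * a23 - a13 * a22) * (a31 * a44 - a34 * a41)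
  - (a12 * a24 - a14 * a22) * (a31 * a43 - a33 * a41)
  + (a13 * a24 - a14 * a23) * (a31 * a42 - a32 * a41).
Proof.
rewrite !(expand_det_row _ ord0) !big_ord_recl !big_ord0 /cofactor.
rewrite !(expand_det_row _ ord0) !big_ord_recl !big_ord0 /cofactor.
rewrite !(expand_det_row _ ord0) !big_ord_recl !big_ord0 /cofactor.
by rewrite !det_mx11 !mxE /= /bump /=; ring.
Qed.

Lemma quat_rotation al mu : nc al ^+ 2 + nc mu ^+ 2 = 1 ->
  exists M, is_rotation M /\ forall w, quat al mu w = of_R4 (to_R4 w *m M).
Proof.
rewrite !normc_sqr; case: al => a b; case: mu => c d /= N1.
exists (mx4 [:: [:: a; b; c; d]; [:: - b; a; d; - c]; [:: - c; - d; a; b]; [:: - d; c; - b; a]]).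
split; last first.
  move=> [[x1 y1] [x2 y2]]; rewrite /quat /of_R4 !mxE !big_ord_recl !big_ord0 !mxE /=.
  by congr (_, _); apply/eqP; rewrite eq_complex /=; apply/andP; split; apply/eqP; ring.
split.
  apply/matrixP => i j; rewrite !mxE !big_ord_recl !big_ord0 !mxE.
  case: i => [[|[|[|[|//]]]] ?]; case: j => [[|[|[|[|//]]]] ?] /=; rewrite ?mulr1n ?mulr0n -?N1; ring.
rewrite det_mx4; transitivity ((a ^+ 2 + b ^+ 2 + (c ^+ 2 + d ^+ 2)) ^+ 2); first by ring.
by rewrite N1 expr1n.
Qed.

Lemma twist_rotation al : nc al = 1 ->
  exists M, is_rotation M /\ forall w, twist al w = of_R4 (to_R4 w *m M).
Proof.
move=> al1; have /esym := normc_sqr al; rewrite al1 expr1n; case: al {al1} => a b /= N1.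
exists (mx4 [:: [:: a; b; 0; 0]; [:: - b; a; 0; 0]; [:: 0; 0; 1; 0]; [:: 0; 0; 0; 1]]).
split; last first.
  move=> [[x1 y1] [x2 y2]]; rewrite /twist /of_R4 !mxE !big_ord_recl !big_ord0 !mxE /=.
  by congr (_, _); apply/eqP; rewrite eq_complex /=; apply/andP; split; apply/eqP; ring.
split.
  apply/matrixP => i j; rewrite !mxE !big_ord_recl !big_ord0 !mxE.
  case: i => [[|[|[|[|//]]]] ?]; case: j => [[|[|[|[|//]]]] ?] /=; rewrite ?mulr1n ?mulr0n;
    (ring || by rewrite -[RHS]N1; ring).
by rewrite det_mx4 -[RHS]N1; ring.
Qed.

End sphere.

(** * Spherical means *)

Section continuous_sums.
Variables (R : realType) (T : topologicalType).

Lemma continuous_sum_fun (I : Type) (r : seq I) (F : I -> T -> R) :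
  (forall i, continuous (F i)) -> continuous (fun z => \sum_(i <- r) F i z).
Proof.
move=> cF z; elim: r => [|i r IH].
  rewrite (_ : (fun z => _) = fun=> 0); first exact: cvg_cst.
  by apply/funext => t; rewrite big_nil.
rewrite (_ : (fun z => _) = (fun z => F i z + \sum_(i <- r) F i z)).
  exact: (cvgD (cF i z) IH).
by apply/funext => t; rewrite big_cons.
Qed.

Lemma continuous_circle_avg N (V : R -> T -> R) : (forall t, continuous (V t)) ->
  continuous (fun z => circle_avg N (V^~ z)).
Proof.
move=> cV z; have c0 : {for z, continuous (fun _ : T => N.+1%:R^-1 : R)} by exact: cvg_cst.
have c1 := @continuous_sum_fun _ (index_enum 'I_N.+1) (fun j : 'I_N.+1 => V (angle R N j))
  (fun j => cV _) z.
exact: (cvgM c0 c1).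
Qed.

End continuous_sums.

Section spherical_mean.
Variable R : realType.
Notation nc := (@Normc.normc R).
Local Notation K := (C R).
Local Notation T2 := (C2 R).
Variables (sigma : probability (borelC2 R) R) (hsigma : rotation_invariant_on_S3 sigma).
Implicit Types (v : T2 -> R) (z w : T2) (al mu : K) (r : R).

Definition smean v : \bar R := (\int[sigma]_(z in @S3 R) (v z)%:E)%E.

Let sigma_S3 : sigma (@S3 R) = 1%E. Proof. exact: hsigma.1. Qed.
Let mS3 := @measurable_S3 R.

Lemma measurable_EFin_continuous v (D : set (borelC2 R)) : measurable D -> continuous v ->
  measurable_fun D (fun z : borelC2 R => (v z)%:E).
Proof.
move=> mD cv; apply/measurable_EFinP.
exact: measurable_funS (continuous_borel_measurable cv).
Qed.

Lemma smean_cst k : smean (fun _ => k) = k%:E.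
Proof.
transitivity (k%:E * sigma (@S3 R))%E; last by rewrite sigma_S3 mule1.
exact: integral_cst.
Qed.

Lemma smean_ge0 v : (forall z, 0 <= v z) -> (0 <= smean v)%E.
Proof. by move=> v0; apply: integral_ge0 => z _; rewrite lee_fin. Qed.

Lemma le_smean v v' : (forall z, 0 <= v z) -> (forall z, S3 z -> v z <= v' z) ->
  (smean v <= smean v')%E.
Proof.
move=> v0 vv'; apply: ge0_le_integral_nonmeas => z zS; rewrite lee_fin//.
exact: vv'.
Qed.

Lemma eq_smean v v' : (forall z, S3 z -> v z = v' z) -> smean v = smean v'.
Proof. by move=> vv'; apply: eq_integral => z; rewrite inE => zS; rewrite vv'. Qed.

Lemma smeanD v v' : continuous v -> continuous v' -> (forall z, 0 <= v z) ->
  (forall z, 0 <= v' z) -> smean (fun z => v z + v' z) = (smean v + smean v')%E.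
Proof.
move=> cv cv' v0 v'0; rewrite /smean -ge0_integralD//.
- by move=> z _; rewrite lee_fin.
- exact: measurable_EFin_continuous.
- by move=> z _; rewrite lee_fin.
- exact: measurable_EFin_continuous.
Qed.

Lemma smeanZ v k : continuous v -> (forall z, 0 <= v z) -> 0 <= k ->
  smean (fun z => k * v z) = (k%:E * smean v)%E.
Proof.
move=> cv v0 k0; rewrite /smean -ge0_integralZl//.
- exact: measurable_EFin_continuous.
- by move=> z _; rewrite lee_fin.
Qed.

Lemma smean_sum (n : nat) (V : 'I_n -> T2 -> R) : (forall i, continuous (V i)) ->
  (forall i z, 0 <= V i z) ->
  smean (fun z => \sum_(i < n) V i z) = (\sum_(i < n) smean (V i))%E.
Proof.
move=> cV V0; rewrite /smean -ge0_integral_sum//.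
- by apply: eq_integral => z _; rewrite sumEFin.
- by move=> i; exact: measurable_EFin_continuous.
- by move=> i z _; rewrite lee_fin.
Qed.

Lemma smean_rotation (g : T2 -> T2) v M : is_rotation M ->
  (forall w, g w = of_R4 (to_R4 w *m M)) -> continuous g ->
  (forall w, sqnorm2 (g w) = sqnorm2 w) -> continuous v -> (forall z, 0 <= v z) ->
  smean (fun z => v (g z)) = smean v.
Proof.
move=> rM gM cg gS cv v0.
have mg := continuous_borel_measurable_map cg.
have gpre : g @^-1` (@S3 R) = @S3 R.
  by apply/seteqP; split => z /=; rewrite !S3E gS.
rewrite /smean -[X in (\int[_]_(_ in X) _)%E]gpre.
have := @ge0_integral_pushforward _ _ (borelC2 R) (borelC2 R) R g mg sigma (@S3 R) (fun z => (v z)%:E) mS3.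
move=> /(_ (measurable_EFin_continuous mS3 cv)) <-; last by move=> z _; rewrite lee_fin.
apply: eq_measure_integral => A mA _; rewrite /pushforward /=.
rewrite -[RHS](hsigma.2 _ rM _ mA); congr (sigma _).
by apply/seteqP; split => z /=; rewrite gM.
Qed.

Lemma smean_quat_unit al mu v : nc al ^+ 2 + nc mu ^+ 2 = 1 ->
  continuous v -> (forall z, 0 <= v z) -> smean (fun z => v (quat al mu z)) = smean v.
Proof.
move=> H cv v0; have [M [rM gM]] := quat_rotation H.
apply: (smean_rotation rM gM) => //; first exact: continuous_quat.
by move=> w; rewrite sqnorm2_quat H mul1r.
Qed.

Lemma smean_twist al v : nc al = 1 -> continuous v -> (forall z, 0 <= v z) ->
  smean (fun z => v (twist al z)) = smean v.
Proof.
move=> H cv v0; have [M [rM gM]] := twist_rotation H.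
apply: (smean_rotation rM gM) => //; first exact: continuous_twist.
by move=> w; rewrite sqnorm2_twist.
Qed.

Definition scl r : T2 -> T2 := quat r%:C%C 0.

Lemma sclE r z : scl r z = (r%:C%C * z.1, r%:C%C * z.2).
Proof. by rewrite /scl /quat !mul0r subr0 addr0. Qed.

Lemma scl_scaler r z : (r%:C)%C *: z = scl r z.
Proof. by rewrite sclE; case: z. Qed.

Definition radial_mean v r := smean (fun z => v (scl r z)).

Lemma continuous_scl r : continuous (scl r).
Proof. exact: continuous_quat. Qed.

Lemma continuous_comp2 v (g : T2 -> T2) : continuous v -> continuous g ->
  continuous (fun z => v (g z)).
Proof. by move=> cv cg z; exact: (continuous_comp (cg z) (cv (g z))). Qed.

(** A quaternion is the product of its modulus and of a rotation. *)
Lemma smean_quat al mu r v : 0 < r -> nc al ^+ 2 + nc mu ^+ 2 = r ^+ 2 ->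
  continuous v -> (forall z, 0 <= v z) ->
  smean (fun z => v (quat al mu z)) = radial_mean v r.
Proof.
move=> r0 H cv v0; have rC0 : r%:C%C != 0 :> R[i] by rewrite -normc_gt0 normc_real normr_gt0 gt_eqF.
pose al' : K := al / r%:C%C; pose mu' : K := mu / r%:C%C.
have H' : nc al' ^+ 2 + nc mu' ^+ 2 = 1.
  rewrite /al' /mu' !Normc.normcM !Normc.normcV !normc_real (gtr0_norm r0).
  by rewrite !expr_div_n -mulrDl H divff// expf_eq0 gt_eqF.
have E z : quat al mu z = scl r (quat al' mu' z).
  by rewrite sclE /quat /= /al' /mu'; congr (_, _); field.
rewrite (eq_smean (v' := fun z => v (scl r (quat al' mu' z)))); last by move=> z _; rewrite E.
apply: (@smean_quat_unit al' mu' (fun z => v (scl r z))) => //.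
exact: (@continuous_comp2 v (scl r) cv (@continuous_scl r)).
Qed.

Lemma smean_circle_avg N (V : R -> T2 -> R) (c : \bar R) : (forall t, continuous (V t)) ->
  (forall t z, 0 <= V t z) -> (forall t, (smean (V t) <= c)%E) ->
  (smean (fun z => circle_avg N (V^~ z)) <= c)%E.
Proof.
move=> cV V0 Vc; rewrite /circle_avg smeanZ ?invr_ge0//; first last.
- by move=> z; apply: sumr_ge0.
- by apply: continuous_sum_fun => j; exact: cV.
rewrite smean_sum//.
apply: (@le_trans _ _ ((N.+1%:R^-1)%:E * \sum_(j < N.+1) c)%E).
  by rewrite lee_pmul2l ?lte_fin ?invr_gt0//; apply: lee_sum.
have := Vc 0; have := smean_ge0 (V0 0).
case: c {Vc} => [c| |]; last by rewrite leeNy_eq => /[swap] /eqP ->.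
  move=> _ _; rewrite sumEFin sumr_const card_ord -EFinM lee_fin.
  by rewrite -[c *+ _]mulr_natl mulKf// pnatr_eq0.
by move=> _ _; rewrite leey.
Qed.

End spherical_mean.

(** * Growth of polynomials *)

Section polynomial_bounds.
Variable R : realType.
Notation nc := (@Normc.normc R).
Implicit Types (p : {poly R[i]}) (x : R[i]) (M : R).

Definition coef_sum p : R := \sum_(i < size p) nc p`_i.

Lemma coef_sum_ge0 p : 0 <= coef_sum p.
Proof. by apply: sumr_ge0 => i _; exact: normc_ge0. Qed.

Lemma normc_horner_le p x M n : 1 <= M -> nc x <= M -> (size p <= n.+1)%N ->
  nc p.[x] <= coef_sum p * M ^+ n.
Proof.
move=> M1 xM sp; rewrite horner_coef mulr_suml; apply: (le_trans (normc_sum _ _ _)).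
apply: ler_sum => i _; rewrite Normc.normcM normcX ler_wpM2l ?normc_ge0//.
apply: (@le_trans _ _ (M ^+ i)).
  by rewrite lerXn2r ?nnegrE ?normc_ge0// (le_trans (normc_ge0 x)).
by rewrite ler_weXn2l// -ltnS (leq_trans (ltn_ord i)).
Qed.

Lemma normc_horner_large p n : size p = n.+2 ->
  exists2 M, 1 <= M & forall x, M <= nc x -> 1 <= nc p.[x].
Proof.
move=> sp; pose s : R := \sum_(i < n.+1) nc p`_i; pose c := nc p`_n.+1.
have s0 : 0 <= s by apply: sumr_ge0 => i _; exact: normc_ge0.
have c0 : 0 < c.
  by rewrite normc_gt0 -[n.+1]/(n.+2.-1) -sp -lead_coefE lead_coef_eq0 -size_poly_gt0 sp.
exists (Num.max 1 ((1 + s) / c)); first by rewrite le_max lexx.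
move=> x; rewrite ge_max => /andP[x1 xM]; rewrite ler_pdivrMr// in xM.
rewrite horner_coef sp big_ord_recr /=.
have low : nc (\sum_(i < n.+1) p`_i * x ^+ i) <= s * nc x ^+ n.
  rewrite mulr_suml; apply: (le_trans (normc_sum _ _ _)).
  apply: ler_sum => i _; rewrite Normc.normcM normcX ler_wpM2l ?normc_ge0//.
  by rewrite ler_weXn2l// -ltnS.
have top : nc (p`_n.+1 * x ^+ n.+1) = c * nc x * nc x ^+ n.
  by rewrite Normc.normcM normcX exprS mulrA.
have Xn : 1 <= nc x ^+ n by exact: exprn_ege1.
set u := \sum_(_ < _) _ in low *; set w := p`_n.+1 * _ in top *.
have := normcB_ge w (- u); rewrite opprK normcNE addrC => /(le_trans _); apply.
rewrite top; nra.
Qed.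

End polynomial_bounds.

(** * The discriminant and its logarithm *)

Section discriminant.
Variable R : realType.
Notation nc := (@Normc.normc R).
Local Notation K := (C R).
Local Notation T2 := (C2 R).
Implicit Types (p : {poly R[i]}) (z w : T2) (M k e r : R).

Definition disc p z : K := (z.1 : K) ^+ 2 - (4 : K) * (p.[z.2] : K).

Lemma continuous_disc p : continuous (disc p).
Proof.
move=> z; have c1 := @continuous_fst2 R z; have c2 := @continuous_snd2 R z.
have c3 := ccontM (@ccont_cst R _ z (4 : K)) (ccont_horner (p := p) c2).
have c4 := ccontX (n := 2) c1.
exact: (ccontB c4 c3).
Qed.

Lemma normc_disc_le p z M n : 1 <= M -> nc z.1 <= M -> nc z.2 <= M ->
  (1 < n)%N -> (size p <= n.+1)%N -> nc (disc p z) <= (1 + 4 * coef_sum p) * M ^+ n.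
Proof.
move=> M1 z1 z2 n2 sp; apply: (le_trans (normcB_le _ _)).
rewrite [leRHS](_ : _ = M ^+ n + 4 * (coef_sum p * M ^+ n)); last by ring.
rewrite lerD//.
  rewrite normcX; apply: (@le_trans _ _ (M ^+ 2)).
    by rewrite lerXn2r ?nnegrE ?normc_ge0// (le_trans _ M1).
  by rewrite ler_weXn2l.
rewrite Normc.normcM normc_nat ler_wpM2l//; exact: normc_horner_le.
Qed.

Lemma S3_le z : S3 z -> nc z.1 <= 1 /\ nc z.2 <= 1.
Proof.
rewrite /S3 /= => z1; have a0 := sqr_ge0 (nc z.1); have b0 := sqr_ge0 (nc z.2).
by split; rewrite -(@ler_pXn2r _ 2) ?nnegrE ?normc_ge0// expr1n -z1; lra.
Qed.

(** The positive part of [- ln |disc p z|] truncated at level [k], written as a difference of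
continuous functions to which Jensen's inequality applies. *)
Definition ell p k z : R := k + logp (nc (disc p z)) - logp (nc (disc p z) * expR k).

Lemma logp_mul_expR (t k : R) : 0 <= t -> 0 <= k -> logp (t * expR k) <= logp t + k.
Proof.
move=> t0 k0; apply: le_trans (logpM_le t0 (expR_ge0 _)) _; rewrite lerD2l.
exact: logp_le_of_expR.
Qed.

Lemma ell_ge0 p k z : 0 <= k -> 0 <= ell p k z.
Proof.
by move=> k0; rewrite /ell subr_ge0 addrC; apply: logp_mul_expR => //; exact: normc_ge0.
Qed.

Lemma ell_disc0 p k z : disc p z = 0 -> ell p k z = k.
Proof. by move=> z0; rewrite /ell z0 Normc.normc0 mul0r logp0 addr0 subr0. Qed.

(** The truncation level will grow with the number of points in the averages over circles.  Away from
the branch curve it eventually makes no difference. *)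
Lemma ell_stable p z : disc p z != 0 -> exists l, [/\ 0 <= l,
  (nc (disc p z))^-1 <= expR l & exists k0, forall k, k0 <= k -> ell p k z = l].
Proof.
move=> z0; have d0 : 0 < nc (disc p z) by rewrite normc_gt0.
exists (logp (nc (disc p z)) - ln (nc (disc p z))); split.
- by rewrite subr_ge0 /logp le_max lexx.
- rewrite expRD expRN lnK//; have := expR_ge1Dx (logp (nc (disc p z))).
  have := logp_ge0 (nc (disc p z)) => h1 h2.
  by rewrite ler_peMl ?invr_ge0 ?(ltW d0)//; lra.
exists (- ln (nc (disc p z))) => k kk.
have k1 : 1 <= nc (disc p z) * expR k.
  by rewrite -[X in X * _](@lnK R)// -expRD -expR0 ler_expR; lra.
rewrite /ell (logp_ge1 k1) lnM ?posrE ?expR_gt0// expRK; ring.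
Qed.

Lemma continuous_logp_normc (T : topologicalType) (f : T -> K) (k : R) :
  continuous f -> continuous (fun x => logp (nc (f x) * k)).
Proof.
move=> cf x; have c1 := ccont_normc (cf x).
have ck : {for x, continuous (fun _ : T => k)} by exact: cvg_cst.
exact: (continuous_comp (cvgM c1 ck) (@continuous_logp R _)).
Qed.

Lemma continuous_ell p k : continuous (ell p k).
Proof.
move=> z; have c0 : {for z, continuous (fun _ : T2 => k)} by exact: cvg_cst.
have c1 := @continuous_logp_normc _ (disc p) 1 (@continuous_disc p).
have c2 := @continuous_logp_normc _ (disc p) (expR k) (@continuous_disc p).
rewrite (_ : ell p k = (fun z => k + logp (nc (disc p z) * 1) - logp (nc (disc p z) * expR k))).
  exact: (cvgB (cvgD c0 (c1 z)) (c2 z)).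
by apply/funext => t; rewrite /ell mulr1.
Qed.

(** The quadratic polynomial [a l^2 - b] and its reversal [b^* l^2 - a^*] have the same modulus on
the unit circle; Jensen's inequality is applied to the one with the larger centre. *)
Lemma quadratic_jensen (a b : K) k e : 0 <= k -> 0 < e -> 1 <= nc a \/ 1 <= nc b ->
  exists N0, forall N, (N0 <= N)%N ->
    k <= circle_avg N (fun t => logp (nc (a * cis t ^+ 2 - b) * expR k)) + e.
Proof.
move=> k0 e0 ab.
have H (c d : K) : 1 <= nc c ->
    exists N0, forall N, (N0 <= N)%N ->
      k <= circle_avg N (fun t => logp (nc (c - d * cis t ^+ 2) * expR k)) + e.
  move=> c1; pose S (w : K) : K := (c - d * w ^+ 2) * (expR k)%:C%C.
  have cS : continuous S.
    move=> w; have cc x := @ccont_cst R _ w x.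
    exact: (ccontM (ccontB (cc c) (ccontM (cc d) (ccontX (n := 2) (@ccont_id R w)))) (cc _)).
  have dS (w : K) : exists l, cder S w l.
    have H1 := cderZ d (@cderX R _ _ _ 2 (cder_id w)).
    exact: ex_intro (cderM (cderB (cder_cst c w) H1) (cder_cst ((expR k)%:C%C : K) w)).
  have nS (w : K) : nc (S w) = nc (c - d * w ^+ 2) * expR k.
    by rewrite Normc.normcM normc_real ger0_norm// expR_ge0.
  have one1 : nc (1 : K) <= 1 by rewrite Normc.normc1.
  have [N0 HN] := @circle_jensen R S (fun=> 1) 1 1 e ltr01 e0 cS
    (fun z : K => ex_intro _ _ (cder_cst (1 : K) z)) (oner_neq0 _) (fun (z : K) _ _ => dS z)
    (fun _ => one1).
  exists N0 => N /HN; rewrite nS expr0n mulr0 subr0 => h.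
  have kk : k <= logp (nc c * expR k).
    rewrite logp_ge1; last by rewrite -[1]mulr1 ler_pM// -expR0 ler_expR.
    rewrite lnM ?posrE ?expR_gt0// ?(lt_le_trans ltr01 c1)// expRK lerDr ln_ge0//.
  apply: (le_trans kk); apply: (le_trans h); rewrite lerD2r; apply: le_circle_avg => t.
  by rewrite nS mul1r.
case: ab => [a1|b1]; last first.
  have [N0 HN] := H b a b1; exists N0 => N /HN /le_trans; apply.
  by rewrite lerD2r; apply: le_circle_avg => t; rewrite normcBC.
have aJ : 1 <= nc (a^*%C) by rewrite normcJE.
have [N0 HN] := H (a^*%C) (b^*%C) aJ; exists N0 => N /HN /le_trans; apply.
rewrite lerD2r; apply: le_circle_avg => t.
have cJ : (cis t)^*%C * cis t = 1 :> K.
  by rewrite -cisN -cisD addNr cis0.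
rewrite (_ : nc (a^*%C - b^*%C * cis t ^+ 2) = nc (a * cis t ^+ 2 - b)) //.
transitivity (nc ((a * cis t ^+ 2 - b)^*%C) * nc (cis t) ^+ 2); last first.
  by rewrite normc_cis expr1n mulr1 normcJE.
rewrite -normcX -Normc.normcM.
congr nc; rewrite rmorphB rmorphM rmorphXn mulrBl -mulrA -exprMn.
by rewrite cJ expr1n mulr1.
Qed.

End discriminant.

(** * Spherical means of the discriminant *)

Section branch_estimate.
Variable R : realType.
Notation nc := (@Normc.normc R).
Local Notation K := (C R).
Local Notation T2 := (C2 R).
Variables (sigma : probability (borelC2 R) R) (hsigma : rotation_invariant_on_S3 sigma).
Variables (p : {poly R[i]}) (n : nat).
Hypotheses (sp : size p = n.+1) (n_gt1 : (1 < n)%N).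
Implicit Types (z : T2) (r k e t : R).

Notation smean := (smean sigma).

Lemma S3_scl r z : S3 z -> 0 <= r ->
  nc (scl r z).1 <= r /\ nc (scl r z).2 <= r.
Proof.
move=> /S3_le[z1 z2] r0; rewrite sclE /= !Normc.normcM !normc_real ger0_norm//.
by split; rewrite ler_piMr.
Qed.

Lemma sqnorm2_scl r z : sqnorm2 (scl r z) = r ^+ 2 * sqnorm2 z.
Proof.
by rewrite sqnorm2_quat Normc.normc0 expr0n addr0 normc_real real_normK// num_real.
Qed.

Let le_smean_eps (c : R) (v : \bar R) : (forall e, 0 < e -> (c%:E <= v + e%:E)%E) -> (c%:E <= v)%E.
Proof.
move=> H; case: v H => [v| |] H; last by have := H 1 ltr01.
  by rewrite lee_fin; apply/ler_addgt0Pr => e /H; rewrite -EFinD lee_fin.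
by rewrite leey.
Qed.

(** For large [r] either [a ^+ 2] or [4 * p.[b]] has modulus at least 1 on the sphere of radius [r],
so the mean of [log |disc|] over the rotations of [a] is nonnegative: this bounds the negative part
of [log |disc|] by its positive part, truncated at level [k]. *)
Lemma smean_ell_le : exists r1 B, 1 <= r1 /\ 0 <= B /\ forall r k, r1 <= r -> 0 <= k ->
  (smean (fun z => ell p k (scl r z)) <= (n%:R * ln r + B)%:E)%E.
Proof.
have [m nE] : exists m, n = m.+1 by case: n n_gt1 => // m _; exists m.
have [M M1 HM] : exists2 M, 1 <= M & forall x, M <= nc x -> 1 <= nc p.[x].
  by apply: (@normc_horner_large R p m); rewrite sp nE.
have c0 := coef_sum_ge0 p; pose c : R := 1 + 4 * coef_sum p.
have c1 : 1 <= c by rewrite /c; lra.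
exists (M + 1), (ln c); split; first lra; split; first by rewrite ln_ge0.
move=> r k rM k0; have r1 : 1 <= r by lra.
have r0 : 0 < r by lra.
pose V z := logp (nc (disc p (scl r z)) * expR k).
have cscl := @continuous_scl R r.
have cV : continuous V.
  apply: (@continuous_logp_normc R T2 (fun z => disc p (scl r z))) => z.
  exact: (continuous_comp (cscl z) (@continuous_disc R p _)).
have V0 z : 0 <= V z by exact: logp_ge0.
have cE : continuous (fun z => ell p k (scl r z)).
  exact: (@continuous_comp2 R (ell p k) (scl r) (@continuous_ell R p k) cscl).
have E0 z : 0 <= ell p k (scl r z) by exact: ell_ge0.
have jens : (k%:E <= smean V)%E.
  apply: le_smean_eps => e e0.
  rewrite -[leLHS](smean_cst hsigma).
  pose W t z := V (twist (cis t) z).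
  have cW t : continuous (W t).
    exact: (@continuous_comp2 R V (twist (cis t)) cV (@continuous_twist R (cis t))).
  have cA N := @continuous_circle_avg R T2 N W cW.
  have ce : continuous (fun _ : T2 => e) by move=> z; exact: cvg_cst.
  apply: (@integral_le_of_eventually_le _ (borelC2 R) R sigma (@S3 R) _
    (fun N z => circle_avg N (W^~ z) + e)).
  - exact: measurable_S3.
  - move=> N.
    have cc : continuous (fun z => circle_avg N (W^~ z) + e).
      by move=> z; exact: (cvgD (cA N z) (ce z)).
    exact: (@measurable_funS _ _ (borelC2 R) _ setT _ _ measurableT (@subsetT _ _)
      (continuous_borel_measurable cc)).
  - move=> N z _; apply: addr_ge0; last exact: ltW.
    by apply: circle_avg_ge0 => t; exact: V0.
  - by move=> z _; rewrite lee_fin.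
  - move=> z zS; set w := scl r z.
    have wr : nc w.1 ^+ 2 + nc w.2 ^+ 2 = r ^+ 2.
      by have := sqnorm2_scl r z; rewrite (S3E z).1// mulr1.
    have big : 1 <= nc (w.1 ^+ 2 : K) \/ 1 <= nc (4 * p.[w.2] : K).
      have [b1|b1] := leP M (nc w.2); [right|left].
        by rewrite Normc.normcM normc_nat; have := HM _ b1; lra.
      by rewrite normcX; have := normc_ge0 w.2; nra.
    have [N0 HN] := quadratic_jensen k0 e0 big.
    exists N0 => N /HN h; rewrite lee_fin; apply: (le_trans h).
    rewrite lerD2r; apply: le_circle_avg => t; rewrite /W /V /disc.
    rewrite (_ : nc _ = nc ((scl r (twist (cis t) z)).1 ^+ 2 -
      4 * p.[(scl r (twist (cis t) z)).2] : K)) //.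
    congr nc; rewrite /w !sclE /twist /=; ring.
  - move=> N; rewrite -/(smean (fun z => circle_avg N (W^~ z) + e)).
    rewrite smeanD//; [|by move=> z; apply: circle_avg_ge0 => t; exact: V0|by move=> z; exact: ltW].
    rewrite (smean_cst hsigma) leeD2r//.
    apply: smean_circle_avg => [t|t z|t]; [exact: cW|exact: V0|].
    by rewrite (_ : smean (W t) = smean V)//; apply: (smean_twist hsigma) => //; exact: normc_cis.
have up : (smean (fun z => ell p k (scl r z)) + smean V <= (k + (n%:R * ln r + ln c))%:E)%E.
  rewrite -smeanD// -[leRHS](smean_cst hsigma); apply: le_smean.
    by move=> z; rewrite addr_ge0.
  move=> z zS; rewrite /ell /V subrK lerD2l; have [z1 z2] := S3_scl zS (ltW r0).
  have sp' : (size p <= n.+1)%N by rewrite sp.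
  have B := normc_disc_le r1 z1 z2 n_gt1 sp'.
  apply: logp_le_of_expR.
    by rewrite addr_ge0 ?ln_ge0// mulr_ge0// ln_ge0.
  by rewrite expRD expRM_natl !lnK ?posrE ?(lt_le_trans ltr01 c1)// mulrC.
have := le_trans (leeD2l _ jens) up.
rewrite addeC EFinD leeD2lE//.
Qed.

Lemma measurable_branch r : measurable (@S3 R `&` [set z | disc p (scl r z) = 0] : set (borelC2 R)).
Proof.
apply: measurableI; first exact: measurable_S3.
have c1 : continuous (fun z => nc (disc p (scl r z))).
  move=> z; apply: (@ccont_normc _ _ _ (fun z => disc p (scl r z))).
  exact: (continuous_comp (@continuous_scl R r z) (@continuous_disc R p _)).
have := continuous_borel_measurable c1 measurableT (measurable_set1 0).
rewrite setTI; congr (measurable _); apply/seteqP; split => z /=.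
  by move=> /eqP; rewrite normc_eq0 => /eqP.
by move=> ->; rewrite Normc.normc0.
Qed.

(** [ell p k] equals [k] on the branch curve and its means are bounded independently of [k]. *)
Lemma branch_null : exists2 r1, 1 <= r1 & forall r, r1 <= r ->
  sigma (@S3 R `&` [set z | disc p (scl r z) = 0]) = 0%E.
Proof.
have [r1 [B [r11 [B0 HB]]]] := smean_ell_le; exists r1 => // r rr.
have mZ := measurable_branch r; set Z := _ `&` _ in mZ *.
have lnr : 0 <= ln r by rewrite ln_ge0//; lra.
have bnd k : 0 <= k -> (k%:E * sigma Z <= (n%:R * ln r + B)%:E)%E.
  move=> k0; apply: le_trans (HB r k rr k0).
  rewrite -integral_cst//.
  apply: (@le_trans _ _ (\int[sigma]_(z in Z) (ell p k (scl r z))%:E)%E).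
    by apply: ge0_le_integral_nonmeas => z; rewrite lee_fin// => -[_ z0]; rewrite ell_disc0.
  apply: ge0_subset_integral => //.
  - exact: measurable_S3.
  - apply: measurable_EFin_continuous; first exact: measurable_S3.
    exact: (@continuous_comp2 R (ell p k) (scl r) (@continuous_ell R p k) (@continuous_scl R r)).
  - by move=> z _; rewrite lee_fin ell_ge0.
  - by move=> z [].
have sfin : sigma Z \is a fin_num by exact: fin_num_measure.
have E : sigma Z = (fine (sigma Z))%:E by rewrite fineK.
have s0 : 0 <= fine (sigma Z) by rewrite fine_ge0.
rewrite E; congr EFin; apply/eqP; rewrite eq_le s0 andbT leNgt; apply/negP => sp0.
have bb : 0 <= n%:R * ln r + B by rewrite addr_ge0// mulr_ge0.
have k0 : 0 <= (n%:R * ln r + B + 1) / fine (sigma Z) by rewrite divr_ge0//; lra.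
have := bnd _ k0; rewrite E -EFinM lee_fin divfK ?gt_eqF//; lra.
Qed.

End branch_estimate.

(** * Derivatives from local data *)

Section local_derivatives.
Variable R : realType.
Notation nc := (@Normc.normc R).
Local Notation K := (C R).
Local Notation T3 := (C3 R).
Implicit Types (f g : K -> K) (z l m : K).

Lemma cder_of_near g h z l : cder g z l -> h z = g z -> (\forall w \near z, h w = g w) ->
  cder h z l.
Proof.
move=> [phi [cphi phil E]] hgz hg.
exists (fun w : K => (if w == z then l else (h w - h z) / (w - z)) : K); split.
- apply/(@cvgCP R K (nbhs z) (nbhs_filter z)) => e e0; have /cvgCP/(_ e e0) := cphi; rewrite phil eqxx.
  move=> H; apply: filterS (filterI H hg) => w [Hw hgw].
  case: ifPn => [_|wz]; first by rewrite subrr Normc.normc0.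
  have wz0 : w - z != 0 by rewrite subr_eq0.
  by rewrite hgw hgz E addrAC subrr add0r mulfK.
- by rewrite eqxx.
- move=> w; case: ifPn => [/eqP ->|wz]; first by rewrite subrr mulr0 addr0.
  by rewrite divfK ?subr_eq0// addrC subrK.
Qed.

(** The converse of [cder_approx]: the difference quotient is the required continuous factor. *)
Lemma cder_of_approx g z l :
  (forall e : R, 0 < e -> \forall w \near z, nc (g w - g z - l * (w - z)) <= e * nc (w - z)) ->
  cder g z l.
Proof.
move=> H; exists (fun w : K => (if w == z then l else (g w - g z) / (w - z)) : K); split.
- apply/(@cvgCP R K (nbhs z) (nbhs_filter z)) => e e0; rewrite eqxx.
  have e2 : 0 < e / 2 by rewrite divr_gt0.
  apply: filterS (H _ e2) => w h; case: ifPn => [_|wz]; first by rewrite subrr Normc.normc0.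
  have wz0 : w - z != 0 by rewrite subr_eq0.
  have nw : 0 < nc (w - z) by rewrite normc_gt0.
  rewrite (_ : _ - l = (g w - g z - l * (w - z)) / (w - z)); last by field.
  rewrite Normc.normcM Normc.normcV ltr_pdivrMr//; apply: (le_lt_trans h).
  by rewrite ltr_pM2r//; lra.
- by rewrite eqxx.
- move=> w; case: ifPn => [/eqP ->|wz]; first by rewrite subrr mulr0 addr0.
  by rewrite divfK ?subr_eq0// addrC subrK.
Qed.

Lemma cderV g z m : cder g z m -> g z != 0 -> exists l, cder (fun w => (g w)^-1) z l.
Proof.
move=> dg gz; have cg := cder_continuous dg; have [q [cq _ Eg]] := dg.
exists (- (q z / (g z * g z))).
pose h w : K := (g z)^-1 - q w / (g w * g z) * (w - z).
have gn : \forall w \near z, g w != 0.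
  have /cvgCP/(_ (nc (g z))) := cg; rewrite normc_gt0 => /(_ gz); apply: filterS => w.
  by apply: contraTneq => ->; rewrite sub0r normcNE ltxx.
have dh : cder h z (- (q z / (g z * g z))).
  exists (fun w => - (q w / (g w * g z))); split.
  - have c1 := ccontM cg (@ccont_cst R _ z (g z)).
    have gz2 : g z * g z != 0 by exact: mulf_neq0.
    have c2 := @ccontV R _ z (fun w => g w * g z : K) gz2 c1.
    have c3 := ccontN (ccontM cq c2).
    exact: c3.
  - by [].
  - by move=> w; rewrite /h; ring.
apply: (cder_of_near dh); first by rewrite /h subrr mulr0 subr0.
apply: filterS gn => w gw; rewrite /h.
have E : q w * (w - z) = g w - g z by rewrite Eg addrAC subrr add0r.
have -> : q w / (g w * g z) * (w - z) = q w * (w - z) / (g w * g z) by ring.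
by rewrite E; field; rewrite gw gz.
Qed.

(** The chain rule for a Frechet differentiable function along a differentiable curve. *)
Lemma cder_frechet (F : T3 -> K) (X Y Z : K -> K) z x' y' z' :
  cder X z x' -> cder Y z y' -> cder Z z z' ->
  differentiable F ((X z, Y z, Z z) : T3) ->
  cder (fun w => F ((X w, Y w, Z w) : T3)) z ('d F ((X z, Y z, Z z) : T3) ((x', y', z') : T3)).
Proof.
move=> [px [cx Ex EX]] [py [cy Ey EY]] [pz [cz Ez EZ]].
set q0 : T3 := (X z, Y z, Z z) => dF.
pose V w : T3 := (px w, py w, pz w).
have cV : {for z, continuous V} by exact: (cvg_pair (cvg_pair cx cy) cz).
have Vz : V z = (x', y', z') by rewrite /V Ex Ey Ez.
have EV w : ((X w, Y w, Z w) : T3) = (w - z) *: V w + q0.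
  have E (a b c : K) : a + b * c = c *: b + a by rewrite addrC; congr (_ + _); exact: mulrC.
  rewrite /V /q0; congr (_, _, _); [rewrite [LHS]EX|rewrite [LHS]EY|rewrite [LHS]EZ]; exact: E.
have [cdF _] := (diff_locallyxP q0 F).1 dF.
have o_ (eps : R[i]) : 0 < eps -> \forall h \near (0 : T3),
    `|F (h + q0) - F q0 - 'd F q0 h| <= eps * `|h|.
  move=> eps0; have /eqaddoP/(_ eps eps0) := diff_locally dF.
  apply: filterS => h; rewrite [X in `|X|](_ : _ = F (h + q0) - F q0 - 'd F q0 h) //.
  by rewrite /= opprD addrA.
apply: cder_of_approx => e e0.
pose m : R[i] := `|V z| + 1; have m0 : 0 < m by rewrite ltr_wpDl.
have e2 : (0 : R[i]) < (e / 2)%:C%C by rewrite ltcR divr_gt0.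
have Vm : \forall w \near z, `|V w| < m.
  have cV' : V w @[w --> z] --> V z by exact: cV.
  by apply: (cvgr_norm_lt (V z) cV' m); rewrite /m ltrDl.
pose H (w : K) : T3 := (w - z) *: V w.
have cH : H w @[w --> z] --> (0 : T3).
  have c0 := ccontB (@ccont_id R z) (@ccont_cst R _ z z).
  have -> : (0 : T3) = (z - z) *: V z by rewrite subrr scale0r.
  exact: (cvgZ c0 cV).
have near_o : \forall w \near z, `|F (H w + q0) - F q0 - 'd F q0 (H w)| <=
    (e / 2)%:C%C / m * `|H w|.
  exact: (cH _ (o_ _ (divr_gt0 e2 m0))).
have near_d : \forall w \near z, nc ('d F q0 (V w) - 'd F q0 (V z)) < e / 2.
  have cd : {for z, continuous (fun w : K => 'd F q0 (V w) : K)}.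
    exact: (continuous_comp cV (cdF _)).
  by have /(@cvgCP R K (nbhs z) (nbhs_filter z))/(_ (e / 2)) := cd; apply; rewrite divr_gt0.
apply: filterS (filterI near_d (filterI Vm near_o)) => w [hd [hV ho]].
rewrite EV -Vz -/(H w).
rewrite (_ : _ - _ = (F (H w + q0) - F q0 - 'd F q0 (H w))
   + ('d F q0 (V w) - 'd F q0 (V z)) * (w - z)); last first.
  have -> : 'd F q0 (H w) = (w - z) * 'd F q0 (V w) :> K by exact: linearZ.
  by ring.
apply: (le_trans (normcD_le _ _)).
have b1 : nc (F (H w + q0) - F q0 - 'd F q0 (H w)) <= e / 2 * nc (w - z).
  set A := F (H w + q0) - F q0 - 'd F q0 (H w).
  have EA := normrCE A.
  rewrite -lecR -EA.
  apply: (le_trans ho); rewrite /H normrZ.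
  rewrite (normrCE (w - z)).
  have -> : (e / 2 * nc (w - z))%:C%C = (e / 2)%:C%C * (nc (w - z))%:C%C :> R[i].
    exact: rmorphM.
  set a := (e / 2)%:C%C in e2 *; set n := (nc (w - z))%:C%C; set v := `|V w| in hV *.
  have -> : a / m * (n * v) = a * n * (v / m) by ring.
  rewrite ler_piMr//; last by rewrite ler_pdivrMr// mul1r ltW.
  by rewrite mulr_ge0 ?(ltW e2)// ler0c normc_ge0.
have b2 : nc (('d F q0 (V w) - 'd F q0 (V z)) * (w - z)) <= e / 2 * nc (w - z).
  by rewrite Normc.normcM ler_wpM2r ?normc_ge0// ltW.
by apply: (le_trans (lerD b1 b2)); rewrite -mulrDl -splitr.
Qed.

End local_derivatives.

(** * Symmetric functions of the two values over a point of the plane *)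

Section double_cover.
Variable R : realType.
Notation nc := (@Normc.normc R).
Local Notation K := (C R).
Local Notation T2 := (C2 R).
Local Notation T3 := (C3 R).
Variables (p : {poly R[i]}) (f : T3 -> K).
Hypothesis hf : holomorphic_on_Dp p f.
Implicit Types (z v : T2) (w l : K) (q : T3).

Let two_neq0 : (2 : K) != 0.
Proof. by rewrite -normc_gt0 (@normc_nat R 2). Qed.

(** The point of the fibre over [z] for which [x - y = w]. *)
Definition pt w z : T3 := ((z.1 + w) / 2, (z.1 - w) / 2, z.2).

Lemma pt_Dp w z : w ^+ 2 = disc p z -> Dp p (pt w z).
Proof.
rewrite /Dp /pt /disc /cx /cy /cz /= => E.
have -> : (z.1 + w) / 2 * ((z.1 - w) / 2) = (z.1 ^+ 2 - w ^+ 2) / 4 :> K by field.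
by rewrite E opprB addrC subrK; field.
Qed.

Lemma fiberE w z q : w ^+ 2 = disc p z ->
  (Dp p q /\ piD q = z) <-> (q = pt w z \/ q = pt (- w) z).
Proof.
move=> E; split.
  case: q => [[x y] b]; rewrite /Dp /piD /cx /cy /cz /= => -[xy zE].
  rewrite -zE /disc /= -xy in E.
  have : (x - y) ^+ 2 == w ^+ 2 by rewrite E; apply/eqP; ring.
  rewrite eqf_sqr => /orP[] /eqP xyw; [left|right]; rewrite /pt -zE /= -xyw;
    by congr (_, _, _); field.
case=> ->; (split; [apply: pt_Dp; rewrite ?sqrrN//|]).
  by rewrite /piD /pt /cx /cy /cz /=; case: z {E} => a b /=; congr (_, _); field.
by rewrite /piD /pt /cx /cy /cz /=; case: z {E} => a b /=; congr (_, _); field.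
Qed.

Definition sq z : K := sqrtc (disc p z).

Lemma sqK z : sq z ^+ 2 = disc p z. Proof. exact: sqr_sqrtc. Qed.

Lemma sqr_disc_cases w z : w ^+ 2 = disc p z -> w = sq z \/ w = - sq z.
Proof.
by rewrite -sqK => /eqP; rewrite eqf_sqr => /orP[] /eqP; [left|right].
Qed.

(** The square root of the discriminant closest to [w0].  Unlike the principal root [sq], it is
continuous at every point where [w0] itself is a square root. *)
Definition near_sq w0 z : K :=
  if nc (sq z - w0) <= nc (sq z + w0) then sq z else - sq z.

Lemma near_sqK w0 z : near_sq w0 z ^+ 2 = disc p z.
Proof. by rewrite /near_sq; case: ifP => _; rewrite ?sqrrN sqK. Qed.

Lemma near_sq_closest w0 z : nc (near_sq w0 z - w0) <= nc (near_sq w0 z + w0).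
Proof.
rewrite /near_sq; case: (leP (nc (sq z - w0))) => // /ltW.
have -> : - sq z - w0 = - (sq z + w0) by ring.
have -> : - sq z + w0 = - (sq z - w0) by ring.
by rewrite !normcNE.
Qed.

Lemma near_sq_id w0 z : w0 ^+ 2 = disc p z -> near_sq w0 z = w0.
Proof.
move=> E; have := near_sq_closest w0 z.
have : near_sq w0 z ^+ 2 == w0 ^+ 2 by rewrite near_sqK E.
rewrite eqf_sqr => /orP[/eqP //|/eqP ->].
rewrite addNr Normc.normc0 -opprD normcNE => h.
have : nc (w0 + w0) == 0 by rewrite eq_le h normc_ge0.
rewrite normc_eq0 -mulr2n -mulr_natl mulf_eq0 (negPf two_neq0) /= => /eqP ->.
by rewrite oppr0.
Qed.

Lemma continuous_near_sq w0 z : w0 ^+ 2 = disc p z -> {for z, continuous (near_sq w0)}.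
Proof.
move=> E; apply/(@cvgCP R T2 (nbhs z) (nbhs_filter z)) => e e0.
have /(@cvgCP R T2 (nbhs z) (nbhs_filter z))/(_ (e ^+ 2)) := @continuous_disc R p z.
rewrite exprn_gt0// => /(_ isT); apply: filterS => z' h; rewrite (near_sq_id E).
have : nc (near_sq w0 z' - w0) ^+ 2 < e ^+ 2.
  apply: le_lt_trans h; rewrite -(near_sqK w0 z') -E subr_sqr Normc.normcM expr2.
  by rewrite ler_wpM2l ?normc_ge0// near_sq_closest.
by rewrite ltr_pXn2r ?nnegrE ?normc_ge0 ?(ltW e0).
Qed.

Lemma continuous_along (T : topologicalType) (x : T) (G : T -> T3) :
  {for x, continuous G} -> (forall t, Dp p (G t)) -> {for x, continuous (fun t => f (G t))}.
Proof.
move=> cG DG; have [F [dF eF]] := hf (DG x).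
have cF : {for G x, continuous F} by apply: differentiable_continuous; exact: nbhs_singleton dF.
have cFG : {for x, continuous (fun t => F (G t))} by exact: (continuous_comp cG cF).
have eFG : \forall t \near x, F (G t) = f (G t).
  have H : \forall t \near x, Dp p (G t) -> F (G t) = f (G t) by exact: cG _ eF.
  by apply: filterS H => t H; exact: H (DG t).
apply/(@cvgCP R T (nbhs x) (nbhs_filter x)) => e e0.
have /(@cvgCP R T (nbhs x) (nbhs_filter x))/(_ e e0) H := cFG.
apply: filterS (filterI eFG H) => t [<-].
by rewrite (nbhs_singleton eFG).
Qed.

Lemma cder_along (X Y Z : K -> K) l (x' y' z' : K) F :
  (forall w, Dp p (X w, Y w, Z w)) -> local_extension p f (X l, Y l, Z l) F ->
  cder X l x' -> cder Y l y' -> cder Z l z' ->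
  cder (fun w => f (X w, Y w, Z w)) l ('d F ((X l, Y l, Z l) : T3) ((x', y', z') : T3)).
Proof.
move=> DG [dF eF] dX dY dZ.
have dFl := nbhs_singleton dF.
have main := cder_frechet dX dY dZ dFl.
have cG : {for l, continuous (fun w : K => (X w, Y w, Z w) : T3)}.
  have cX := cder_continuous dX; have cY := cder_continuous dY; have cZ := cder_continuous dZ.
  exact: (cvg_pair (cvg_pair cX cY) cZ).
apply: (cder_of_near main); first by rewrite (nbhs_singleton eF).
have H : \forall t \near l, Dp p (X t, Y t, Z t) ->
    F ((X t, Y t, Z t) : T3) = f (X t, Y t, Z t) by exact: cG _ eF.
by apply: filterS H => t H; rewrite H.
Qed.

Definition tsum z : K := f (pt (sq z) z) + f (pt (- sq z) z).
Definition tprod z : K := f (pt (sq z) z) * f (pt (- sq z) z).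
(** Twisted by a square root of the discriminant, the difference of the two values becomes
single-valued. *)
Definition tdiff z : K := sq z * (f (pt (sq z) z) - f (pt (- sq z) z)).

Lemma tsumE w z : w ^+ 2 = disc p z -> tsum z = f (pt w z) + f (pt (- w) z).
Proof. by case/sqr_disc_cases => ->; rewrite /tsum ?opprK// addrC. Qed.

Lemma tprodE w z : w ^+ 2 = disc p z -> tprod z = f (pt w z) * f (pt (- w) z).
Proof. by case/sqr_disc_cases => ->; rewrite /tprod ?opprK// mulrC. Qed.

Lemma tdiffE w z : w ^+ 2 = disc p z -> tdiff z = w * (f (pt w z) - f (pt (- w) z)).
Proof. by case/sqr_disc_cases => ->; rewrite /tdiff ?opprK//; ring. Qed.

Let continuous_pt (c : T2 -> K) z : {for z, continuous c} ->
  {for z, continuous (fun z' => pt (c z') z')}.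
Proof.
move=> cc; have c1 := @continuous_fst2 R z; have c2 := @continuous_snd2 R z.
have ch := @ccont_cst R _ z (2^-1 : K).
have cx := ccontM (ccontD c1 cc) ch; have cy := ccontM (ccontB c1 cc) ch.
exact: (cvg_pair (cvg_pair cx cy) c2).
Qed.

Let continuous_sheets z : exists c : T2 -> K, [/\ forall z', c z' ^+ 2 = disc p z',
  {for z, continuous c}, {for z, continuous (fun z' => f (pt (c z') z'))} &
  {for z, continuous (fun z' => f (pt (- c z') z'))}].
Proof.
have cc := continuous_near_sq (sqK z); exists (near_sq (sq z)); split.
- by move=> z'; exact: near_sqK.
- exact: cc.
- have D t : Dp p (pt (near_sq (sq z) t) t) by apply: pt_Dp; exact: near_sqK.
  exact: (continuous_along (continuous_pt cc) D).
- have D t : Dp p (pt (- near_sq (sq z) t) t) by apply: pt_Dp; rewrite sqrrN near_sqK.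
  exact: (continuous_along (continuous_pt (ccontN cc)) D).
Qed.

Lemma continuous_tsum : continuous tsum.
Proof.
move=> z; have [c [cE cc c1 c2]] := continuous_sheets z.
rewrite (_ : tsum = fun z' => f (pt (c z') z') + f (pt (- c z') z')).
  exact: (ccontD c1 c2).
by apply/funext => z'; exact: tsumE.
Qed.

Lemma continuous_tprod : continuous tprod.
Proof.
move=> z; have [c [cE cc c1 c2]] := continuous_sheets z.
rewrite (_ : tprod = fun z' => f (pt (c z') z') * f (pt (- c z') z')).
  exact: (ccontM c1 c2).
by apply/funext => z'; exact: tprodE.
Qed.

Lemma continuous_tdiff : continuous tdiff.
Proof.
move=> z; have [c [cE cc c1 c2]] := continuous_sheets z.
rewrite (_ : tdiff = fun z' => c z' * (f (pt (c z') z') - f (pt (- c z') z'))).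
  exact: (ccontM cc (ccontB c1 c2)).
by apply/funext => z'; exact: tdiffE.
Qed.

Definition lin z v l : T2 := (z.1 + l * v.1, z.2 + l * v.2).

Lemma lin0 z v : lin z v 0 = z.
Proof. by rewrite /lin !mul0r !addr0; case: z. Qed.

Let cder_affine (a b : K) l : cder (fun w => a + w * b) l b.
Proof.
have := cderD (cder_cst a l) (cderM (cder_id l) (cder_cst b l)).
by rewrite mul1r mulr0 addr0 add0r.
Qed.

Lemma continuous_lin z v : continuous (lin z v : K -> T2).
Proof.
move=> l; have c1 := cder_continuous (cder_affine z.1 v.1 l).
have c2 := cder_continuous (cder_affine z.2 v.2 l).
exact: (continuous_pair2 c1 c2).
Qed.

Definition ddisc z v : K := 2 * z.1 * v.1 - 4 * (p^`().[z.2] * v.2).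

Lemma cder_disc z v l : cder (fun w => disc p (lin z v w)) l (ddisc (lin z v l) v).
Proof.
have h1 := @cderX R _ _ _ 2 (cder_affine z.1 v.1 l).
have h2 := cderZ (4 : K) (cder_horner p (cder_affine z.2 v.2 l)).
exact: (cderB h1 h2).
Qed.

Lemma cder_near_sq z v l w0 : w0 ^+ 2 = disc p (lin z v l) -> w0 != 0 ->
  cder (fun w => near_sq w0 (lin z v w)) l (ddisc (lin z v l) v / (2 * w0)).
Proof.
move=> E w00; have [psi [cpsi psil Epsi]] := cder_disc z v l.
have nl : near_sq w0 (lin z v l) = w0 by exact: near_sq_id.
have nz z' : near_sq w0 z' + w0 != 0.
  apply/eqP => h; have := near_sq_closest w0 z'; rewrite h Normc.normc0.
  have -> : near_sq w0 z' = - w0 by apply/eqP; rewrite -addr_eq0 h.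
  rewrite -opprD normcNE => h'.
  have : nc (w0 + w0) == 0 by rewrite eq_le h' normc_ge0.
  by rewrite normc_eq0 -mulr2n -mulr_natl mulf_eq0 (negPf two_neq0) (negPf w00).
have cn : {for l, continuous (fun w : K => near_sq w0 (lin z v w) : K)}.
  exact: (continuous_comp (@continuous_lin z v l) (continuous_near_sq E)).
exists (fun w => psi w / (near_sq w0 (lin z v w) + w0)); split.
- have c1 := ccontD cn (@ccont_cst R _ l w0).
  have c2 := @ccontV R _ l (fun w : K => near_sq w0 (lin z v w) + w0 : K) (nz _) c1.
  exact: (ccontM cpsi c2).
- by rewrite nl psil (_ : w0 + w0 = 2 * w0)//; ring.
- move=> w; apply: (mulIf (nz (lin z v w))).
  rewrite mulrDl [_ / _ * _ * _]mulrAC divfK// nl.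
  have := Epsi w; rewrite -(near_sqK w0) -[disc p _](near_sqK w0) nl => h.
  have -> : psi w * (w - l) = near_sq w0 (lin z v w) ^+ 2 - w0 ^+ 2.
    by rewrite h addrAC subrr add0r.
  by ring.
Qed.

(** The lift to the sheet through [pt w z] of the constant vector field [v]. *)
Definition lift_vec w z v : T3 :=
  ((v.1 + ddisc z v / (2 * w)) / 2, (v.1 - ddisc z v / (2 * w)) / 2, v.2).

Lemma cder_sheet (c : T2 -> K) z v l (c' : K) F : (forall z', c z' ^+ 2 = disc p z') ->
  cder (fun w => c (lin z v w)) l c' ->
  local_extension p f (pt (c (lin z v l)) (lin z v l)) F ->
  cder (fun w => f (pt (c (lin z v w)) (lin z v w))) l
    ('d F (pt (c (lin z v l)) (lin z v l)) (((v.1 + c') / 2, (v.1 - c') / 2, v.2) : T3)).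
Proof.
move=> cE dn ext.
have d1 := cder_affine z.1 v.1 l; have d2 := cder_affine z.2 v.2 l.
have dh (g : K -> K) m : cder g l m -> cder (fun w => g w / 2) l (m / 2).
  by move=> dg; have := cderM dg (cder_cst (2^-1 : K) l); rewrite mulr0 addr0.
have dX := dh _ _ (cderD d1 dn); have dY := dh _ _ (cderB d1 dn).
pose X w : K := (z.1 + w * v.1 + c (lin z v w)) / 2.
pose Y w : K := (z.1 + w * v.1 - c (lin z v w)) / 2.
pose Z w : K := z.2 + w * v.2.
have XYZ w : (X w, Y w, Z w) = pt (c (lin z v w)) (lin z v w) by [].
have ext' : local_extension p f (X l, Y l, Z l) F by rewrite XYZ.
have DXYZ w : Dp p (X w, Y w, Z w) by rewrite XYZ; exact: pt_Dp.
by have := cder_along DXYZ ext' dX dY d2; rewrite XYZ; exact.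
Qed.

(** Both values of [f] over a complex line are differentiable off the branch points. *)
Lemma cder_sheets z v l w0 F : w0 ^+ 2 = disc p (lin z v l) -> w0 != 0 ->
  local_extension p f (pt w0 (lin z v l)) F ->
  exists (c : T2 -> K) d2, [/\ forall z', c z' ^+ 2 = disc p z', c (lin z v l) = w0,
    cder (fun w => c (lin z v w)) l (ddisc (lin z v l) v / (2 * w0)),
    cder (fun w => f (pt (c (lin z v w)) (lin z v w))) l
      ('d F (pt w0 (lin z v l)) (lift_vec w0 (lin z v l) v)) &
    cder (fun w => f (pt (- c (lin z v w)) (lin z v w))) l d2].
Proof.
move=> E w00 ext; have nl : near_sq w0 (lin z v l) = w0 by exact: near_sq_id.
have dn := cder_near_sq E w00.
have cE := near_sqK w0.
have cE' z' : (- near_sq w0 z') ^+ 2 = disc p z' by rewrite sqrrN.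
have [F2 ext2] := hf (pt_Dp (cE' (lin z v l))).
have D2 := @cder_sheet (fun z' => - near_sq w0 z') z v l _ F2 cE' (cderN dn) ext2.
exists (near_sq w0); eexists; split; [exact: cE|exact: nl|exact: dn| |exact: D2].
have ext1 : local_extension p f (pt (near_sq w0 (lin z v l)) (lin z v l)) F by rewrite nl.
by have := @cder_sheet (near_sq w0) z v l _ F cE dn ext1; rewrite nl.
Qed.

End double_cover.

(** * Pointwise bound for derivatives on a sheet *)

Section derivative_estimate.
Variable R : realType.
Notation nc := (@Normc.normc R).
Local Notation K := (C R).
Local Notation T2 := (C2 R).
Local Notation T3 := (C3 R).
Variables (p : {poly R[i]}) (f : T3 -> K) (n : nat).
Hypothesis hf : holomorphic_on_Dp p f.
Hypotheses (sp : size p = n.+1) (n_gt1 : (1 < n)%N).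
Implicit Types (z v : T2) (w : K) (q : T3) (M s r t : R).

Notation lin := (@lin R).

(** Up to an additive constant this is the sum of [logp |f|] over the fibre, but it is built from
single-valued functions. *)
Definition height z : R :=
  Num.max (logp (nc (tsum p f z))) (logp (nc (tprod p f z))).

Lemma height_ge0 z : 0 <= height z.
Proof. by rewrite le_max logp_ge0. Qed.

Lemma continuous_height : continuous height.
Proof.
move=> z.
have c1 := @continuous_logp_normc R T2 (tsum p f) 1 (continuous_tsum hf) z.
have c2 := @continuous_logp_normc R T2 (tprod p f) 1 (continuous_tprod hf) z.
rewrite (_ : height = (fun z => logp (nc (tsum p f z) * 1)) \max
                      (fun z => logp (nc (tprod p f z) * 1))); last first.
  by apply/funext => t; rewrite /height /= !mulr1.
exact: (continuous_max c1 c2).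
Qed.

(** A number is bounded by twice the maximum of 1, the modulus of its sum with a second one and that
of their product: if it exceeded this bound, the second number would exceed that maximum, and so
would the product. *)
Lemma normc_sheet_le w z : w ^+ 2 = disc p z -> nc (f (pt w z)) <= 2 * expR (height z).
Proof.
move=> E; set m := expR (height z); set a := nc (f (pt w z)).
pose b := nc (f (pt (- w) z)).
have h0 := height_ge0 z.
have m1 : 1 <= m by rewrite -expR0 ler_expR.
have Sm : nc (tsum p f z) <= m.
  by apply: (le_trans (le_expR_logp _)); rewrite ler_expR /height le_max lexx.
have Pm : nc (tprod p f z) <= m.
  by apply: (le_trans (le_expR_logp _)); rewrite ler_expR /height le_max lexx orbT.
have Sab : a - b <= nc (tsum p f z).
  rewrite (tsumE f E) -[f (pt (- w) z)]opprK; apply: le_trans (normcB_ge _ _).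
  by rewrite normcNE.
have Pab : a * b = nc (tprod p f z) by rewrite (tprodE f E) Normc.normcM.
have a0 : 0 <= a by exact: normc_ge0.
have b0 : 0 <= b by exact: normc_ge0.
rewrite leNgt; apply/negP => am.
have : a * b <= m by rewrite Pab.
have : b < 1 / 2.
  rewrite ltNge; apply/negP => b12.
  have : 2 * m * (1 / 2) < a * b by nra.
  by rewrite Pab; lra.
lra.
Qed.

Lemma height_le w z : w ^+ 2 = disc p z ->
  height z <= logp (nc (f (pt w z))) + logp (nc (f (pt (- w) z))) + ln 2.
Proof.
move=> E; rewrite /height (tsumE f E) (tprodE f E) ge_max; apply/andP; split.
  apply: (le_trans (le_logp (normcD_le _ _))).
  by apply: logpD_le; exact: normc_ge0.
rewrite Normc.normcM; apply: (le_trans (logpM_le _ _)); try exact: normc_ge0.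
by rewrite lerDl ln2_ge0.
Qed.

Let near_neq0 (l : K) : l != 0 -> \forall w \near l, w != 0.
Proof.
move=> l0; apply/nearCP; exists (nc l); first by rewrite normc_gt0.
by move=> w; apply: contraTneq => ->; rewrite sub0r normcNE ltxx.
Qed.

Lemma cder_tsum_lin z v l : disc p (lin z v l) != 0 ->
  exists m, cder (fun w => tsum p f (lin z v w)) l m.
Proof.
move=> d0; have E := sqK p (lin z v l); have [F ext] := hf (pt_Dp E).
have w00 : sq p (lin z v l) != 0 by apply: contra d0 => /eqP w00; rewrite -E w00 expr0n.
have [c [d2 [cE _ _ D1 D2]]] := cder_sheets hf E w00 ext.
have := cderD D1 D2; set m := (X in cder _ _ X) => D; exists m.
rewrite (_ : (fun w => _) = fun w =>
  f (pt (c (lin z v w)) (lin z v w)) + f (pt (- c (lin z v w)) (lin z v w)))//.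
by apply/funext => w; exact: tsumE.
Qed.

Lemma cder_tprod_lin z v l : disc p (lin z v l) != 0 ->
  exists m, cder (fun w => tprod p f (lin z v w)) l m.
Proof.
move=> d0; have E := sqK p (lin z v l); have [F ext] := hf (pt_Dp E).
have w00 : sq p (lin z v l) != 0 by apply: contra d0 => /eqP w00; rewrite -E w00 expr0n.
have [c [d2 [cE _ _ D1 D2]]] := cder_sheets hf E w00 ext.
have := cderM D1 D2; set m := (X in cder _ _ X) => D; exists m.
rewrite (_ : (fun w => _) = fun w =>
  f (pt (c (lin z v w)) (lin z v w)) * f (pt (- c (lin z v w)) (lin z v w)))//.
by apply/funext => w; exact: tprodE.
Qed.

Lemma cder_tdiff_lin z v l : disc p (lin z v l) != 0 ->
  exists m, cder (fun w => tdiff p f (lin z v w)) l m.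
Proof.
move=> d0; have E := sqK p (lin z v l); have [F ext] := hf (pt_Dp E).
have w00 : sq p (lin z v l) != 0 by apply: contra d0 => /eqP w00; rewrite -E w00 expr0n.
have [c [d2 [cE _ Dc D1 D2]]] := cder_sheets hf E w00 ext.
have := cderM Dc (cderB D1 D2); set m := (X in cder _ _ X) => D; exists m.
rewrite (_ : (fun w => _) = fun w => c (lin z v w) *
  (f (pt (c (lin z v w)) (lin z v w)) - f (pt (- c (lin z v w)) (lin z v w))))//.
by apply/funext => w; exact: tdiffE.
Qed.

(** At 0 this takes the value of [f] on the sheet through [pt w z], and its derivative there is that of
[f] along the lift of [v] up to an explicit error.  A branch of [f] itself would not extend to the
whole line, whereas this function is single-valued. *)
Definition germ z v w (l : K) : K :=
  (tsum p f (lin z v l) + tdiff p f (lin z v l) / w) / 2.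

Lemma germ0 z v w : w ^+ 2 = disc p z -> w != 0 -> germ z v w 0 = f (pt w z).
Proof. by move=> E w0; rewrite /germ lin0 (tsumE f E) (tdiffE f E); field. Qed.

Lemma cder_germ0 z v w F : w ^+ 2 = disc p z -> w != 0 -> local_extension p f (pt w z) F ->
  cder (germ z v w) 0 ('d F (pt w z) (lift_vec p w z v)
     + ddisc p z v * (f (pt w z) - f (pt (- w) z)) / (4 * disc p z)).
Proof.
move=> E w0 ext.
have E' : w ^+ 2 = disc p (lin z v 0) by rewrite lin0.
have ext' : local_extension p f (pt w (lin z v 0)) F by rewrite lin0.
have [c [d2 [cE cl Dc D1 D2]]] := cder_sheets hf E' w0 ext'.
have := cderM (cderD (cderD D1 D2) (cderM (cderM Dc (cderB D1 D2)) (cder_cst (w^-1 : K) 0)))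
  (cder_cst (2^-1 : K) 0).
rewrite (_ : (fun w1 => _) = germ z v w); last first.
  by apply/funext => l; rewrite /germ (tsumE f (cE _)) (tdiffE f (cE _)).
congr (cder _ _ _); rewrite cl lin0 -E.
set D := 'd F _ _; field.
by rewrite w0.
Qed.

Lemma continuous_germ z v w : continuous (germ z v w).
Proof.
move=> l; have cL := @continuous_lin R z v l.
have c1 : {for l, continuous (fun l : K => tsum p f (lin z v l) : K)}.
  exact: (@continuous_comp _ _ _ (lin z v : K -> T2) (tsum p f) l cL (@continuous_tsum R p f hf _)).
have c2 : {for l, continuous (fun l : K => tdiff p f (lin z v l) : K)}.
  exact: (@continuous_comp _ _ _ (lin z v : K -> T2) (tdiff p f) l cL (@continuous_tdiff R p f hf _)).
have c3 := ccontM (ccontD c1 (ccontM c2 (@ccont_cst R _ l (w^-1 : K)))) (@ccont_cst R _ l (2^-1 : K)).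
exact: c3.
Qed.

Lemma cder_germ z v w l : disc p (lin z v l) != 0 -> exists m, cder (germ z v w) l m.
Proof.
move=> d0; have [m1 D1] := cder_tsum_lin d0; have [m2 D2] := cder_tdiff_lin d0.
exact: (ex_intro _ _ (cderM (cderD D1 (cderM D2 (cder_cst (w^-1 : K) l))) (cder_cst (2^-1 : K) l))).
Qed.

Lemma normc_germ_le z v w l B e : 1 <= B -> 1 <= e -> nc (disc p (lin z v l)) <= B ->
  (nc w)^-1 <= e -> nc (germ z v w l) <= 4 * B * e * expR (height (lin z v l)).
Proof.
move=> B1 e1 dB we; set z' := lin z v l; set m := expR (height z').
have E := sqK p z'; set w' := sq p z' in E.
have E' : (- w') ^+ 2 = disc p z' by rewrite sqrrN.
have m0 : 0 < m by exact: expR_gt0.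
have f1 := normc_sheet_le E; have f2 := normc_sheet_le E'; rewrite -/m in f1 f2.
have w'B : nc w' <= B.
  have : nc w' ^+ 2 <= B by rewrite -normcX E.
  by have := normc_ge0 w'; nra.
have S4 : nc (tsum p f z') <= 4 * m.
  by rewrite (tsumE f E); apply: (le_trans (normcD_le _ _)); lra.
have D4 : nc (tdiff p f z' / w) <= B * (4 * m) * e.
  rewrite (tdiffE f E) !Normc.normcM Normc.normcV ler_pM ?mulr_ge0 ?invr_ge0 ?normc_ge0//.
  rewrite ler_pM ?normc_ge0//; apply: (le_trans (normcB_le _ _)); lra.
rewrite /germ Normc.normcM Normc.normcV (@normc_nat R 2) ler_pdivrMr//.
apply: (le_trans (normcD_le _ _)); apply: (le_trans (lerD S4 D4)).
have : 1 <= B * e by rewrite -[1]mulr1 ler_pM.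
by nra.
Qed.

(** The quotient [(B w - B 0) / w], completed at 0 by the derivative, has no singularity. *)
Lemma cder_slope (B : K -> K) m : continuous B -> cder B 0 m ->
  exists phi : K -> K, [/\ continuous phi, phi 0 = m,
    forall w, w != 0 -> phi w = (B w - B 0) / w &
    forall w, w != 0 -> (exists l, cder B w l) -> exists l, cder phi w l].
Proof.
move=> cB [phi [cphi phi0 E]].
have phiE w : w != 0 -> phi w = (B w - B 0) / w.
  by move=> w0; rewrite (E w) subr0 addrAC subrr add0r mulfK.
exists phi; split; [|exact: phi0|exact: phiE|].
- move=> w; have [->|w0] := eqVneq w 0; first exact: cphi.
  have cq := ccontM (ccontB (cB w) (@ccont_cst R _ w (B 0))) (ccontV w0 (@ccont_id R w)).
  apply/(@cvgCP R K (nbhs w) (nbhs_filter w)) => e e0.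
  have /(@cvgCP R K (nbhs w) (nbhs_filter w))/(_ e e0) H := cq.
  by apply: filterS (filterI (near_neq0 w0) H) => t [t0]; rewrite !phiE.
- move=> w w0 [l dB]; have [k dV] := cderV (cder_id w) w0.
  have D := cderM (cderB dB (cder_cst (B 0) w)) dV.
  eexists; apply: (cder_of_near D); first exact: phiE.
  by apply: filterS (near_neq0 w0) => t t0; exact: phiE.
Qed.

Definition deriv_const : R :=
  6 * expR 1 * (1 + 4 * coef_sum p) * 2 ^+ n + (2 + 4 * coef_sum p^`()).

Let normc_ddisc_le z v M : 1 <= M -> nc z.1 <= M -> nc z.2 <= M -> nc v.1 <= M -> nc v.2 <= M ->
  nc (ddisc p z v) <= (2 + 4 * coef_sum p^`()) * M ^+ n.+1.
Proof.
move=> M1 z1 z2 v1 v2; have M0 : 0 <= M by lra.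
apply: (le_trans (normcB_le _ _)); rewrite !Normc.normcM (@normc_nat R 2) (@normc_nat R 4).
have sp' : (size p^`() <= n.+1)%N.
  have p0 : p != 0 by rewrite -size_poly_gt0 sp.
  by have := lt_size_deriv p0; rewrite sp => /ltnW.
have h1 := normc_horner_le M1 z2 sp'.
have h2 : nc p^`().[z.2] * nc v.2 <= coef_sum p^`() * M ^+ n * M.
  by rewrite ler_pM ?normc_ge0.
have h3 : nc z.1 * nc v.1 <= M ^+ n.+1.
  apply: (@le_trans _ _ (M ^+ 2)); first by rewrite expr2 ler_pM ?normc_ge0.
  by rewrite ler_weXn2l// ltnS ltnW.
have -> : (2 + 4 * coef_sum p^`()) * M ^+ n.+1 =
  2 * M ^+ n.+1 + 4 * (coef_sum p^`() * M ^+ n * M) by rewrite [M ^+ n.+1]exprSr; ring.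
by rewrite -mulrA lerD// ler_wpM2l.
Qed.

(** Cauchy's estimate for a derivative, with the maximum over the circle replaced by Jensen's inequality
for the difference quotient of [germ]: this keeps the factor in front of the average of [height]
equal to 1. *)
Lemma derivative_bound z v w F M s (l : R) : 1 <= M ->
  nc z.1 <= M -> nc z.2 <= M -> nc v.1 <= M -> nc v.2 <= M -> 0 < s <= 1 ->
  w ^+ 2 = disc p z -> disc p z != 0 -> local_extension p f (pt w z) F ->
  0 <= l -> (nc (disc p z))^-1 <= expR l ->
  exists N0, forall N, (N0 <= N)%N ->
    nc ('d F (pt w z) (lift_vec p w z v)) <= deriv_const * M ^+ n.+1 / s *
      expR (circle_avg N (fun t => height (lin z v (s%:C%C * cis t))) + height z + l).
Proof.
move=> M1 z1 z2 v1 v2 /andP[s0 s1] E d0 ext l0 dl.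
have w0 : w != 0 by apply: contra d0 => /eqP w0; rewrite -E w0 expr0n.
have el1 : 1 <= expR l by rewrite -expR0 ler_expR.
have nw0 : 0 < nc w by rewrite normc_gt0.
have wl : (nc w)^-1 <= expR l.
  move: dl; rewrite -E normcX; set x := nc w in nw0 *; rewrite -exprVn.
  have x0 : 0 < x^-1 by rewrite invr_gt0.
  move: x0 el1; set y := x^-1; set e := expR l; nra.
set P : R := (1 + 4 * coef_sum p) * (2 * M) ^+ n.
have pc0 := coef_sum_ge0 p; have pc0' := coef_sum_ge0 p^`().
have P1 : 1 <= P by rewrite -[1]mulr1 ler_pM ?exprn_ege1//; lra.
have linM t : nc (lin z v (s%:C%C * cis t)).1 <= 2 * M /\ nc (lin z v (s%:C%C * cis t)).2 <= 2 * M.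
  have H (a b : K) : nc a <= M -> nc b <= M -> nc (a + s%:C%C * cis t * b) <= 2 * M.
    move=> aM bM; apply: (le_trans (normcD_le _ _)).
    rewrite !Normc.normcM normc_cis mulr1 normc_real (gtr0_norm s0).
    have := normc_ge0 b; nra.
  by split; exact: H.
have dP t : nc (disc p (lin z v (s%:C%C * cis t))) <= P.
  have [h1 h2] := linM t; apply: normc_disc_le => //; [lra|by rewrite sp].
have [phi [cphi phi0 phiE dphi]] := cder_slope (@continuous_germ z v w) (cder_germ0 v E w0 ext).
have dQ (y : K) : exists m, cder (fun y => disc p (lin z v y)) y m.
  exact: (ex_intro _ _ (cder_disc p z v y)).
have Q0 : disc p (lin z v 0) != 0 by rewrite lin0.
have dS (y : K) : y != 0 -> disc p (lin z v y) != 0 -> exists m, cder phi y m.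
  by move=> y0 dy; apply: dphi => //; exact: cder_germ.
have [N0 HN] := circle_jensen s0 ltr01 cphi dQ Q0 dS dP.
exists N0 => N /HN; set A := circle_avg N _; set A' := circle_avg N _ => jens.
set h := height z; have h0 : 0 <= h by exact: height_ge0.
have eh0 := expR_gt0 h; have eh1 : 1 <= expR h by rewrite -expR0 ler_expR.
have f1 := normc_sheet_le E; have E' : (- w) ^+ 2 = disc p z by rewrite sqrrN.
have f2 := normc_sheet_le E'; rewrite -/h in f1 f2.
have q0 : 0 < 6 * P / s by rewrite divr_gt0//; lra.
have q1 : 1 <= 6 * P / s by rewrite ler_pdivlMr//; lra.
pose c := h + l + ln (6 * P / s).
have c0 : 0 <= c by rewrite /c !addr_ge0// ln_ge0.
have Ec : expR c = 6 * P / s * expR h * expR l.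
  by rewrite /c !expRD lnK ?posrE//; ring.
have AA' : A <= A' + c.
  rewrite -circle_avgDr; apply: le_circle_avg => t; set y := s%:C%C * cis t.
  have ny : nc y = s by rewrite Normc.normcM normc_cis mulr1 normc_real gtr0_norm.
  have y0 : y != 0 by rewrite -normc_gt0 ny.
  have hy0 := height_ge0 (lin z v y).
  apply: logp_le_of_expR; first by rewrite addr_ge0.
  rewrite (phiE _ y0) Normc.normcM Normc.normcV ny expRD Ec ler_pdivrMr//.
  apply: (le_trans (normcB_le _ _)); rewrite (germ0 v E w0).
  have g := normc_germ_le P1 el1 (dP t) wl; rewrite -/y in g.
  apply: (le_trans (lerD g f1)).
  have -> : expR (height (lin z v y)) * (6 * P / s * expR h * expR l) * s =
    6 * P * expR l * (expR h * expR (height (lin z v y))) by field; rewrite gt_eqF.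
  have ey1 : 1 <= expR (height (lin z v y)) by rewrite -expR0 ler_expR.
  move: ey1; set ey := expR (height _) => ey1.
  have Pl : 1 <= P * expR l by rewrite -[1]mulr1 ler_pM.
  have hy1 : ey <= expR h * ey by rewrite ler_peMl//; lra.
  have hy2 : expR h <= expR h * ey by rewrite ler_peMr//; lra.
  nra.
set D := 'd F _ _ in phi0 *.
set dd := ddisc p z v * (f (pt w z) - f (pt (- w) z)) / (4 * disc p z) in phi0.
have phi0b : nc (phi 0) <= 6 * P / s * expR 1 * expR (A' + h + l).
  apply: (le_trans (le_expR_logp _)).
  apply: (@le_trans _ _ (expR (A' + c + 1))); first by rewrite ler_expR; lra.
  rewrite 2!expRD Ec 2!expRD le_eqVlt; apply/orP; left; apply/eqP; ring.
have ddb : nc dd <= (2 + 4 * coef_sum p^`()) * M ^+ n.+1 * (expR h * expR l).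
  rewrite /dd Normc.normcM Normc.normcV !Normc.normcM (@normc_nat R 4).
  have b1 := normc_ddisc_le M1 z1 z2 v1 v2.
  have b2 : nc (f (pt w z) - f (pt (- w) z)) <= 4 * expR h.
    by apply: (le_trans (normcB_le _ _)); lra.
  have -> : (4 * nc (disc p z))^-1 = 4^-1 * (nc (disc p z))^-1 by rewrite invfM.
  set x := nc (ddisc p z v) in b1 *; set y := nc (_ - _) in b2 *.
  set g := (2 + _) * _ in b1 *.
  have b3 : x * y <= g * (4 * expR h) by rewrite ler_pM ?normc_ge0.
  have -> : g * (expR h * expR l) = (g * (4 * expR h)) * (4^-1 * expR l) by field.
  rewrite ler_pM ?mulr_ge0 ?invr_ge0 ?normc_ge0// ler_wpM2l//.
have A'0 : 0 <= A' by apply: circle_avg_ge0 => t; exact: height_ge0.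
have Dle : nc D <= nc (phi 0) + nc dd.
  have -> : D = phi 0 - dd by rewrite phi0 addrK.
  exact: normcB_le.
apply: (le_trans Dle); apply: (le_trans (lerD phi0b ddb)).
have eA : expR h * expR l <= expR (A' + h + l).
  by rewrite -expRD ler_expR; lra.
have PM : P <= (1 + 4 * coef_sum p) * 2 ^+ n * M ^+ n.+1.
  rewrite /P exprMn mulrA ler_wpM2l ?mulr_ge0 ?exprn_ge0//; try lra.
  by rewrite ler_weXn2l.
set X := expR (A' + h + l) in eA *; have X0 : 0 <= X by exact: expR_ge0.
have Mn0 : 0 <= M ^+ n.+1 by rewrite exprn_ge0//; lra.
have s1' : 1 <= s^-1 by rewrite invf_ge1.
have g0 : 0 <= (2 + 4 * coef_sum p^`()) * M ^+ n.+1 by rewrite mulr_ge0//; lra.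
have t1 : 6 * P / s * expR 1 * X <=
    6 * expR 1 * (1 + 4 * coef_sum p) * 2 ^+ n * M ^+ n.+1 / s * X.
  rewrite ler_wpM2r//.
  have -> : 6 * P / s * expR 1 = 6 * expR 1 / s * P by ring.
  have -> : 6 * expR 1 * (1 + 4 * coef_sum p) * 2 ^+ n * M ^+ n.+1 / s =
    6 * expR 1 / s * ((1 + 4 * coef_sum p) * 2 ^+ n * M ^+ n.+1) by ring.
  by rewrite ler_wpM2l// !mulr_ge0 ?invr_ge0 ?expR_ge0// ltW.
have t2 : (2 + 4 * coef_sum p^`()) * M ^+ n.+1 * (expR h * expR l) <=
    (2 + 4 * coef_sum p^`()) * M ^+ n.+1 / s * X.
  rewrite -[leRHS]mulrA ler_wpM2l//; apply: (le_trans eA).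
  by rewrite ler_peMl.
apply: (le_trans (lerD t1 t2)).
by rewrite /deriv_const le_eqVlt; apply/orP; left; apply/eqP; ring.
Qed.

End derivative_estimate.

(** * Borel's growth lemma *)

Section growth.
Variable R : realType.
Implicit Types (r s t : R).

Let dyadic_bracket t : 1 <= t -> exists m, 2 ^+ m <= t < 2 ^+ m.+1.
Proof.
move=> t1; pose P m := t < 2 ^+ m :> R.
have [m0 Pm0] : exists m, P m.
  exists (Num.truncn t).+1; apply: (lt_le_trans (truncnS_gt t)).
  by rewrite -natrX ler_nat; exact: ltnW (ltn_expl _ _).
have exP : exists m, P m by exists m0.
case: (ex_minnP exP) => -[|m] Pm minm.
  by move: Pm; rewrite /P expr0 ltNge t1.
rewrite /P in Pm; exists m; rewrite Pm andbT leNgt; apply/negP => tm.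
by have := minm m tm; rewrite ltnn.
Qed.

(** Borel's growth lemma.  Where [T] lies between [2 ^ m] and [2 ^ m.+1] the inequality can fail only
in the last stretch of length [2 ^- m] before [T] reaches [2 ^ m.+1]. *)
Lemma borel_growth (T : R -> \bar R) (r1 : R) : 0 < r1 ->
  (forall r s, r1 <= r -> r <= s -> (T r <= T s)%E) ->
  exists E : set R, [/\ measurable E, E `<=` `]0, +oo[, (lebesgue_measure E < +oo)%E &
    forall r t, r1 <= r -> ~ E r -> 1 <= t -> (T r <= t%:E)%E -> (T (r + t^-1)%R <= (2 * t)%:E)%E].
Proof.
move=> r10 mono; pose A m := [set r | r1 <= r /\ (T r < (2 ^+ m.+1)%:E)%E].
pose E m : set R := if `[< has_sup (A m) >] then `[sup (A m) - 2 ^- m, sup (A m)] `&` `]0, +oo[ else set0.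
have mE m : measurable (E m).
  by rewrite /E; case: asboolP => // _; apply: measurableI.
exists (\bigcup_m E m); split.
- exact: bigcup_measurable.
- by move=> r [m _]; rewrite /E; case: asboolP => // _ [].
- apply: (@le_lt_trans _ _ (\sum_(0 <= m <oo) lebesgue_measure (E m))%E).
    apply: measure_sigma_subadditive => //; apply: bigcup_measurable => k _; exact: mE.
  apply: (@le_lt_trans _ _ (2%:E)); last exact: ltry.
  have leE m : (lebesgue_measure (E m) <= (2 ^- m)%:E)%E.
    rewrite /E; case: asboolP => [_|_]; last by rewrite measure0 lee_fin invr_ge0 exprn_ge0.
    apply: (@le_trans _ _ (lebesgue_measure `[sup (A m) - 2 ^- m, sup (A m)]%classic)).
      by apply: le_measure; rewrite ?inE//; exact: measurableI.
    rewrite lebesgue_measure_itv /= lte_fin; case: ifP => _.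
      by rewrite -EFinB lee_fin opprB addrC subrK.
    by rewrite lee_fin invr_ge0 exprn_ge0.
  apply: lime_le; first by apply: is_cvg_nneseries => m _ _; exact: measure_ge0.
  apply: nearW => N.
  apply: (@le_trans _ _ (\sum_(0 <= m < N) (2 ^- m)%:E)%E); first exact: lee_sum.
  rewrite sumEFin lee_fin big_mkord.
  suff -> : \sum_(i < N) 2 ^- i = 2 - 2 * 2 ^- N :> R.
    by rewrite gerBl mulr_ge0// invr_ge0 exprn_ge0.
  elim: N => [|N IH]; first by rewrite big_ord0 expr0 invr1 mulr1 subrr.
  by rewrite big_ord_recr /= IH exprS invfM; field; rewrite expf_neq0.
- move=> r t rr nE t1 Tt; have [m /andP[m1 m2]] := dyadic_bracket t1.
  have Am : A m r by split => //; apply: (le_lt_trans Tt); rewrite lte_fin.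
  have tm : t^-1 <= 2 ^- m by rewrite lef_pV2// posrE ?exprn_gt0//; lra.
  have t0 : 0 < t^-1 by rewrite invr_gt0; lra.
  suff [s [[s1 s2] rs]] : exists s, A m s /\ r + t^-1 <= s.
    apply: (@le_trans _ _ (T s)); first by apply: mono => //; lra.
    by apply: (le_trans (ltW s2)); rewrite lee_fin exprS ler_wpM2l.
  apply: contrapT => H.
  have ub s : A m s -> s <= r + t^-1.
    by move=> As; rewrite leNgt; apply/negP => rs; apply: H; exists s; split => //; exact: ltW.
  have hs : has_sup (A m) by split; [exists r|exists (r + t^-1) => s; exact: ub].
  have rsup : r <= sup (A m) by apply: sup_upper_bound.
  have supr : sup (A m) <= r + t^-1 by apply: ge_sup; [exists r|move=> s; exact: ub].
  apply: nE; exists m => //; rewrite /E; case: asboolP => // _; split => /=.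
    by rewrite in_itv /= rsup andbT; lra.
  by rewrite in_itv /= andbT; lra.
Qed.

End growth.

(** * The lifted partial derivatives *)

Section lifted_fields.
Variable R : realType.
Notation nc := (@Normc.normc R).
Local Notation K := (C R).
Local Notation T2 := (C2 R).
Local Notation T3 := (C3 R).
Variables (p : {poly R[i]}) (f : T3 -> K) (n : nat).
Hypothesis hf : holomorphic_on_Dp p f.
Hypotheses (sp : size p = n.+1) (n_gt1 : (1 < n)%N).
Implicit Types (z v : T2) (w : K) (q : T3) (r s t : R).

Notation lin := (@lin R).
Notation height := (height p f).

Lemma vf_applyP theta q : Dp p q ->
  exists2 F, local_extension p f q F & vf_apply p theta f q = 'd F q (theta q).
Proof.
move=> Dq; have [F ext] := hf Dq.
by apply: (@getPex _ [set l | exists2 F, local_extension p f q F & l = 'd F q (theta q)]);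
  exists ('d F q (theta q)), F.
Qed.

Let two_neq0 : (2 : K) != 0.
Proof. by rewrite -normc_gt0 (@normc_nat R 2). Qed.

Definition perp z : T2 := (- (z.2)^*%C, (z.1)^*%C).

Lemma theta1_lift w z : w != 0 -> theta1 (pt w z) = lift_vec p w z ((1, 0) : T2).
Proof.
move=> w0; rewrite /theta1 /lift_vec /ddisc /pt /cx /cy /=.
have E : (z.1 + w) / 2 - (z.1 - w) / 2 = w :> K by field.
by rewrite E; congr (_, _, _); field.
Qed.

Lemma theta2_lift w z : w != 0 -> theta2 p (pt w z) = lift_vec p w z ((0, 1) : T2).
Proof.
move=> w0; rewrite /theta2 /lift_vec /ddisc /pt /cx /cy /cz /=.
have E : (z.1 - w) / 2 - (z.1 + w) / 2 = - w :> K by field.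
by rewrite E; congr (_, _, _); field.
Qed.

Lemma lift_vec_lin w z (a b : K) v v' :
  lift_vec p w z ((a * v.1 + b * v'.1, a * v.2 + b * v'.2) : T2) =
  a *: lift_vec p w z v + b *: lift_vec p w z v'.
Proof.
have S (x y : K) : x *: y = x * y by [].
rewrite /lift_vec /ddisc /=; congr (_, _, _); rewrite /= ?S; ring.
Qed.

(** The constant fields [(1, 0)] and [(0, 1)] are combinations of [z] and [perp z], the directions in
which lines through [z] are swept out by similarities of the plane, with coefficients at most 1 once
[z] has norm at least 1. *)
Lemma theta_frame theta r z : lift_of_partial p theta -> 1 <= r -> sqnorm2 z = r ^+ 2 ->
  exists a b : K, [/\ nc a <= 1, nc b <= 1 & forall w, w != 0 ->
    theta (pt w z) = a *: lift_vec p w z z + b *: lift_vec p w z (perp z)].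
Proof.
move=> lt r1 zr; have r0 : 0 < r by lra.
have z12 : nc z.1 <= r /\ nc z.2 <= r.
  move: zr; rewrite /sqnorm2; have := normc_ge0 z.1; have := normc_ge0 z.2.
  by set x := nc z.1; set y := nc z.2; split; nra.
pose rho : K := (r ^+ 2)%:C%C.
have rho0 : rho != 0 by rewrite -normc_gt0 normc_real normr_gt0 expf_eq0 /= gt_eqF.
have nrho (x : K) : nc x <= r -> nc (x / rho) <= 1.
  move=> xr; rewrite Normc.normcM Normc.normcV normc_real ger0_norm ?sqr_ge0//.
  by rewrite ler_pdivrMr ?exprn_gt0// mul1r; nra.
have conjE (x : R[i]) : x * x^*%C = (nc x ^+ 2)%:C%C.
  by case: x => a b; rewrite normc_sqr /=; simpc; congr (_ +i* _)%C; ring.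
have E : z.1 * (z.1)^*%C + z.2 * (z.2)^*%C = rho.
  by rewrite !conjE /rho -zr /sqnorm2 rmorphD.
clearbody rho; case: lt => ->.
  exists ((z.1)^*%C / rho), (- (z.2) / rho); split.
  - by apply: nrho; rewrite normcJE z12.1.
  - by apply: nrho; rewrite normcNE z12.2.
  move=> w w0; rewrite theta1_lift// -lift_vec_lin; congr (lift_vec _ _ _ _).
  rewrite /perp /=; congr (_, _).
    by apply: (mulIf rho0); rewrite mul1r -{1}E; field; exact: rho0.
  by field.
exists ((z.2)^*%C / rho), (z.1 / rho); split.
- by apply: nrho; rewrite normcJE z12.2.
- by apply: nrho; rewrite z12.1.
move=> w w0; rewrite theta2_lift// -lift_vec_lin; congr (lift_vec _ _ _ _).
rewrite /perp /=; congr (_, _).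
  by field.
by apply: (mulIf rho0); rewrite mul1r -{1}E; field; exact: rho0.
Qed.

Lemma lin_scl r (l : K) z : lin (scl r z) (scl r z) l = quat (r%:C%C * (1 + l)) 0 z.
Proof. by rewrite /lin !sclE /quat /=; congr (_, _); ring. Qed.

Lemma conjc_realM r (x : R[i]) : (r%:C%C * x)^*%C = r%:C%C * x^*%C.
Proof. by case: x => a b /=; congr (_ +i* _)%C; ring. Qed.

Lemma lin_perp r (l : K) z : lin (scl r z) (perp (scl r z)) l = quat r%:C%C (r%:C%C * l) z.
Proof.
rewrite /lin /perp !sclE /quat /= !conjc_realM; congr (_, _); ring.
Qed.

(** [derivative_bound] in the directions [z] and [perp z], with the points of the circles rewritten as
images of [z] under quaternions. *)
Lemma theta_bound theta r s (z : T2) w (l : R) : lift_of_partial p theta -> 1 <= r -> S3 z ->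
  0 < s <= 1 -> w ^+ 2 = disc p (scl r z) -> disc p (scl r z) != 0 ->
  0 <= l -> (nc (disc p (scl r z)))^-1 <= expR l ->
  exists N0, forall N, (N0 <= N)%N ->
    logp (nc (vf_apply p theta f (pt w (scl r z)))) <=
      circle_avg N (fun t => height (quat (r%:C%C * (1 + s%:C%C * cis t)) 0 z)) +
      circle_avg N (fun t => height (quat r%:C%C (r%:C%C * (s%:C%C * cis t)) z)) +
      height (scl r z) + l + ln 2 + logp (deriv_const p n * r ^+ n.+1 / s).
Proof.
move=> lt r1 zS s01 E d0 l0 dl; have r0 : 0 < r by lra.
have w0 : w != 0 by apply: contra d0 => /eqP w0; rewrite -E w0 expr0n.
have [z1 z2] := S3_scl zS (ltW r0).
have sq : sqnorm2 (scl r z) = r ^+ 2 by rewrite sqnorm2_scl (S3E z).1// mulr1.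
have [a [b [a1 b1 frame]]] := theta_frame lt r1 sq.
have [F ext ->] := vf_applyP theta (pt_Dp E).
have p1 : nc (perp (scl r z)).1 <= r by rewrite /perp /= normcNE normcJE.
have p2 : nc (perp (scl r z)).2 <= r by rewrite /perp /= normcJE.
have [N1 H1] := derivative_bound hf sp n_gt1 r1 z1 z2 z1 z2 s01 E d0 ext l0 dl.
have [N2 H2] := derivative_bound hf sp n_gt1 r1 z1 z2 p1 p2 s01 E d0 ext l0 dl.
exists (maxn N1 N2) => N; rewrite geq_max => /andP[/H1 {}H1 /H2 {}H2].
rewrite frame// linearD !linearZ /=.
set d1 := 'd F _ _ in H1 *; set d2 := 'd F _ _ in H2 *.
have S (x y : K) : x *: y = x * y by [].
rewrite !S.
move: H1 H2; rewrite (_ : (fun t => height (lin _ _ _)) =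
   (fun t => height (quat (r%:C%C * (1 + s%:C%C * cis t)) 0 z))); last first.
  by apply/funext => t; rewrite lin_scl.
rewrite [X in _ -> nc d2 <= _ * expR (circle_avg N X + _ + _) -> _](_ : _ =
   (fun t => height (quat r%:C%C (r%:C%C * (s%:C%C * cis t)) z))); last first.
  by apply/funext => t; rewrite lin_perp.
set A1 := circle_avg N _; set A2 := circle_avg N _; set Q := deriv_const p n * _ / s => H1 H2.
have A10 : 0 <= A1 by apply: circle_avg_ge0 => t; exact: height_ge0.
have A20 : 0 <= A2 by apply: circle_avg_ge0 => t; exact: height_ge0.
have h0 := height_ge0 p f (scl r z).
apply: logp_le_of_expR; first by rewrite !addr_ge0 ?ln2_ge0 ?logp_ge0.
apply: (le_trans (normcD_le _ _)); rewrite !Normc.normcM.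
have QE := le_expR_logp Q.
have g (A d : R) : 0 <= A -> A <= A1 + A2 -> 0 <= d -> d <= Q * expR (A + height (scl r z) + l) ->
    d <= expR (A1 + A2 + height (scl r z) + l + logp Q).
  move=> A0 AA d0' /le_trans; apply; rewrite [leRHS]expRD mulrC.
  apply: (@le_trans _ _ (expR (A + height (scl r z) + l) * expR (logp Q))).
    by rewrite ler_wpM2l ?expR_ge0.
  by rewrite ler_wpM2r ?expR_ge0// ler_expR; lra.
have g1 := g A1 (nc d1) A10 ltac:(lra) (normc_ge0 _) H1.
have g2 := g A2 (nc d2) A20 ltac:(lra) (normc_ge0 _) H2.
have k1 : nc a * nc d1 <= nc d1 by rewrite ler_piMl ?normc_ge0.
have k2 : nc b * nc d2 <= nc d2 by rewrite ler_piMl ?normc_ge0.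
apply: (le_trans (lerD (le_trans k1 g1) (le_trans k2 g2))).
rewrite (_ : A1 + A2 + height (scl r z) + l + ln 2 + logp Q =
  ln 2 + (A1 + A2 + height (scl r z) + l + logp Q)); last by ring.
by rewrite [in leRHS]expRD expR_ln2 mulr_natl mulr2n.
Qed.

End lifted_fields.

(** * Proximity functions and spherical means *)

Section proximity_estimates.
Variable R : realType.
Notation nc := (@Normc.normc R).
Local Notation K := (C R).
Local Notation T2 := (C2 R).
Local Notation T3 := (C3 R).
Variables (sigma : probability (borelC2 R) R) (hsigma : rotation_invariant_on_S3 sigma).
Variables (p : {poly R[i]}) (f : T3 -> K) (n : nat).
Hypothesis hf : holomorphic_on_Dp p f.
Hypotheses (sp : size p = n.+1) (n_gt1 : (1 < n)%N).
Implicit Types (z v : T2) (w : K) (q : T3) (r s t : R).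

Notation lin := (@lin R).
Notation height := (height p f).
Notation smean := (smean sigma).

Definition hmean r : \bar R := radial_mean sigma height r.

Let cH : continuous height. Proof. exact: continuous_height hf. Qed.
Let H0 z : 0 <= height z. Proof. exact: height_ge0. Qed.

Let cHq al mu : continuous (fun z => height (quat al mu z)).
Proof. exact: (@continuous_comp2 R height (quat al mu) cH (@continuous_quat R al mu)). Qed.

Let cEll k r : continuous (fun z => ell p k (scl r z)).
Proof. exact: (@continuous_comp2 R (ell p k) (scl r) (@continuous_ell R p k) (@continuous_scl R r)). Qed.

Let measC (v : T2 -> R) : continuous v -> measurable_fun (@S3 R : set (borelC2 R)) v.
Proof.
move=> cv; apply: (@measurable_funS _ _ (borelC2 R) _ setT) => //.
exact: continuous_borel_measurable.
Qed.

Lemma disc_neq0_sq z : disc p z != 0 -> sq p z != 0.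
Proof. by apply: contra => /eqP s0; rewrite -sqK s0 expr0n. Qed.

(** Jensen's inequality on the lines through [z] in the direction [perp z].  For each [t] the point of
angle [t] on the circle of radius [s] is the image of [z] under a rotation followed by the dilation
of ratio [sqrt (1 + s ^+ 2)], so that the average over the circle has the same spherical mean as
[height] at radius [r * sqrt (1 + s ^+ 2)], which [s] is chosen to make equal to [r']. *)
Lemma hmean_mono r1 B : 1 <= r1 -> 0 <= B ->
  (forall r k, r1 <= r -> 0 <= k ->
    (smean (fun z => ell p k (scl r z)) <= (n%:R * ln r + B)%:E)%E) ->
  forall r r', r1 <= r -> r <= r' -> (hmean r <= hmean r')%E.
Proof.
move=> r11 B0 HB r r' rr; rewrite le_eqVlt => /predU1P[->//|rr'].
have r0 : 0 < r by lra.
have r'0 : 0 < r' by lra.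
pose s := Num.sqrt ((r' / r) ^+ 2 - 1).
have x1 : 1 < r' / r by rewrite ltr_pdivlMr// mul1r.
have s2 : s ^+ 2 = (r' / r) ^+ 2 - 1 by rewrite sqr_sqrtr// subr_ge0; nra.
have s0 : 0 < s by rewrite sqrtr_gt0 subr_gt0; nra.
have lnr : 0 <= ln r by rewrite ln_ge0//; lra.
pose Bd := n%:R * ln r + B.
have Bd0 : 0 <= Bd by rewrite addr_ge0// mulr_ge0.
suff step e : 0 < e -> (hmean r <= hmean r' + (e * (1 + Bd))%:E)%E.
  apply/lee_addgt0Pr => e e0.
  have q0 : 0 < 1 + Bd by lra.
  have := step _ (divr_gt0 e0 q0); rewrite divfK ?gt_eqF//; exact.
move=> e0; pose V t z := height (quat r%:C%C (r%:C%C * (s%:C%C * cis t)) z).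
have cV t : continuous (V t) by exact: cHq.
have V0 t z : 0 <= V t z by exact: H0.
have cA N := @continuous_circle_avg R T2 N V cV.
have A0 N z : 0 <= circle_avg N (V^~ z) by apply: circle_avg_ge0 => t; exact: V0.
have ce : continuous (fun _ : T2 => e) by move=> z; exact: cvg_cst.
have ceE N : continuous (fun z => e * ell p N%:R (scl r z)).
  by move=> z; exact: (cvgM (ce z) (@cEll N%:R r z)).
have E0 (N : nat) z : 0 <= ell p N%:R (scl r z) by exact: ell_ge0.
have eE0 (N : nat) z : 0 <= e * ell p N%:R (scl r z) by rewrite mulr_ge0// ltW.
have cAe N : continuous (fun z => circle_avg N (V^~ z) + e).
  by move=> z; exact: (cvgD (cA N z) (ce z)).
have Ae0 N z : 0 <= circle_avg N (V^~ z) + e by rewrite addr_ge0// ltW.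
pose h N z := circle_avg N (V^~ z) + e + e * ell p N%:R (scl r z).
have ch N : continuous (h N) by move=> z; exact: (cvgD (cAe N z) (ceE N z)).
apply: (@integral_le_of_eventually_le _ (borelC2 R) R sigma (@S3 R) _ h).
- exact: measurable_S3.
- by move=> N; exact: measC.
- by move=> N z _; rewrite /h addr_ge0.
- by move=> z _; rewrite lee_fin.
- move=> z zS; have [d0|d0] := eqVneq (disc p (scl r z)) 0.
    (* At a branch point [ell] equals [N], which outgrows the height. *)
    exists (Num.truncn (height (scl r z) / e)).+1 => N NN.
    rewrite lee_fin /h ell_disc0//.
    have : height (scl r z) < e * N%:R.
      rewrite mulrC -ltr_pdivrMr//; apply: (lt_le_trans (truncnS_gt _)).
      by rewrite ler_nat.
    by have := A0 N z; lra.
  have [z1 z2] := S3_scl zS (ltW r0).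
  set z' := scl r z in d0 z1 z2 *.
  have dQ (y : K) : exists m, cder (fun y => disc p (lin z' (perp z') y)) y m.
    exact: (ex_intro _ _ (cder_disc p z' (perp z') y)).
  have Q0 : disc p (lin z' (perp z') 0) != 0 by rewrite lin0.
  pose M := (1 + s) * r.
  have M1 : 1 <= M by rewrite /M; nra.
  have dB t : nc (disc p (lin z' (perp z') (s%:C%C * cis t))) <=
      (1 + 4 * coef_sum p) * M ^+ n.
    have H (a b : K) : nc a <= r -> nc b <= r -> nc (a + s%:C%C * cis t * b) <= M.
      move=> aM bM; apply: (le_trans (normcD_le _ _)).
      by rewrite !Normc.normcM normc_cis mulr1 normc_real (gtr0_norm s0) /M; nra.
    apply: normc_disc_le => //; last by rewrite sp.
      by apply: H => //; rewrite /perp /= normcNE normcJE.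
    by apply: H => //; rewrite /perp /= normcJE.
  have jens (S : T2 -> K) : continuous S ->
      (forall y : K, disc p (lin z' (perp z') y) != 0 ->
         exists m, cder (fun w => S (lin z' (perp z') w)) y m) ->
      (forall z, logp (nc (S z)) <= height z) ->
      exists N0, forall N, (N0 <= N)%N ->
        logp (nc (S z')) <= circle_avg N (V^~ z) + e.
    move=> cS dS SH.
    have cSl : continuous (fun w : K => S (lin z' (perp z') w)).
      by move=> y; exact: (continuous_comp (@continuous_lin R z' (perp z') y) (cS _)).
    have [N0 HN] := circle_jensen s0 e0 cSl dQ Q0 (fun y _ => @dS y) dB.
    exists N0 => N /HN; rewrite lin0 => /le_trans; apply.
    rewrite lerD2r; apply: le_circle_avg => t; apply: (le_trans (SH _)).
    by rewrite lin_perp.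
  have [N1 HN1] := jens (tsum p f) (continuous_tsum hf)
    (fun y => @cder_tsum_lin R p f hf z' (perp z') y)
    (fun z => ltac:(by rewrite /height le_max lexx)).
  have [N2 HN2] := jens (tprod p f) (continuous_tprod hf)
    (fun y => @cder_tprod_lin R p f hf z' (perp z') y)
    (fun z => ltac:(by rewrite /height le_max lexx orbT)).
  exists (maxn N1 N2) => N; rewrite geq_max => /andP[/HN1 {}HN1 /HN2 {}HN2].
  rewrite lee_fin /h; have := eE0 N z.
  have : height z' <= circle_avg N (V^~ z) + e by rewrite /height ge_max HN1 HN2.
  by lra.
- move=> N; rewrite -/(smean (h N)) /h smeanD// smeanD//; last by move=> z; exact: ltW.
  rewrite (smean_cst hsigma) smeanZ//; last exact: ltW.
  have h1 : (smean (fun z => circle_avg N (V^~ z)) <= hmean r')%E.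
    apply: smean_circle_avg => [t|t z|t]; [exact: cV|exact: V0|].
    rewrite /V (smean_quat hsigma r'0)//.
    rewrite !Normc.normcM normc_cis !normc_real !gtr0_norm//.
    have -> : r ^+ 2 + (r * (s * 1)) ^+ 2 = r ^+ 2 * (1 + s ^+ 2) by ring.
    by rewrite s2; field; rewrite gt_eqF.
  have h2 := HB r N%:R rr (ler0n _ _).
  have h3 : (e%:E * smean (fun z => ell p N%:R (scl r z)) <= (e * Bd)%:E)%E.
    by rewrite EFinM lee_pmul2l// lte_fin.
  apply: (le_trans (leeD (leeD h1 (lexx _)) h3)).
  by rewrite -addeA -EFinD (_ : e + e * Bd = e * (1 + Bd))//; ring.
Qed.

Let fibre_set (g : T3 -> R) z w : w ^+ 2 = disc p z -> w != 0 ->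
  (\sum_(q \in Dp p `&` (@piD R @^-1` [set z])) (g q)%:E)%E = (g (pt w z) + g (pt (- w) z))%:E.
Proof.
move=> E w0.
have -> : Dp p `&` (@piD R @^-1` [set z]) = [set pt w z] `|` [set pt (- w) z].
  by apply/seteqP; split => q /=; [move=> /(fiberE q E)|move=> /(fiberE q E)].
rewrite fsbigU0//=; last first.
  move=> q [/= -> /(congr1 (fun q : T3 => q.1.1 - q.1.2))]; rewrite /pt /=.
  have two0 : (2 : K) != 0 by rewrite -normc_gt0 (@normc_nat R 2).
  have e1 (x : K) : (z.1 + x) / 2 - (z.1 - x) / 2 = x :> K by field.
  rewrite !e1 => /eqP; rewrite -addr_eq0 -mulr2n -mulr_natl mulf_eq0 (negPf two0) /=.
  by rewrite (negPf w0).
by rewrite !fsbig_set1 EFinD.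
Qed.

Let fibre_ge0 (g : T3 -> R) z : (forall q, 0 <= g q) ->
  (0 <= \sum_(q \in Dp p `&` (@piD R @^-1` [set z])) (g q)%:E)%E.
Proof. by move=> g0; apply: fsume_ge0 => q _; rewrite lee_fin. Qed.

Let fibre_fin (g : T3 -> R) z : exists c : R,
  (\sum_(q \in Dp p `&` (@piD R @^-1` [set z])) (g q)%:E)%E = c%:E.
Proof.
have [w0|w0] := eqVneq (sq p z) 0; last first.
  by rewrite (fibre_set g (sqK p z) w0); eexists.
have E : (0 : K) ^+ 2 = disc p z by rewrite -w0 sqK.
have -> : Dp p `&` (@piD R @^-1` [set z]) = [set pt 0 z].
  apply/seteqP; split => q /=; first by move=> /(fiberE q E); rewrite oppr0; case.
  by move=> qE; apply/(fiberE q E); left.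
by rewrite fsbig_set1; eexists.
Qed.

(** Once the null set of branch points is discarded from the integral of a continuous minorant, the
comparison with the sums over the fibres is pointwise. *)
Lemma hmean_le_mtilde r : sigma (@S3 R `&` [set z | disc p (scl r z) = 0]) = 0%E ->
  (hmean r <= mtilde sigma p f r + (ln 2)%:E)%E.
Proof.
set Z := [set z | _] => Z0.
pose G z := Num.max (height (scl r z) - ln 2) 0.
have G0 z : 0 <= G z by rewrite le_max lexx orbT.
have cHs : continuous (fun z => height (scl r z)) by exact: cHq.
have cG : continuous G.
  move=> z; have cl : {for z, continuous (fun _ : T2 => ln 2 : R)} by exact: cvg_cst.
  have c0 : {for z, continuous (fun _ : T2 => 0 : R)} by exact: cvg_cst.
  exact: (continuous_max (cvgB (cHs z) cl) c0).
have cl2 : continuous (fun _ : T2 => ln 2 : R) by move=> z; exact: cvg_cst.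
apply: (@le_trans _ _ (smean G + (ln 2)%:E)%E).
  rewrite -(smean_cst hsigma) -smeanD//; last by move=> _; exact: ln2_ge0.
  apply: le_smean; first by move=> z; exact: H0.
  by move=> z _; rewrite -lerBlDr /G le_max lexx.
rewrite leeD2r// /smean /mtilde.
have mZ := measurable_branch p r; rewrite -/Z in mZ.
rewrite (@ge0_negligible_integral _ (borelC2 R) R sigma (@S3 R) (@S3 R `&` Z))//; first last.
- by move=> z _; rewrite lee_fin.
- by apply: measurable_EFin_continuous => //; exact: measurable_S3.
- exact: measurable_S3.
rewrite integral_mkcond [leRHS]integral_mkcond.
apply: ge0_le_integral_nonmeas => z _.
  by rewrite /patch; case: ifP => // _; rewrite lee_fin.
rewrite /patch; case: ifPn => [|_]; last first.
  by case: ifPn => // _; apply: fibre_ge0 => q; exact: logp_ge0.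
rewrite inE => -[zS zZ]; rewrite ifT; last by rewrite inE.
have d0 : disc p (scl r z) != 0 by apply/eqP => d0; apply: zZ; split.
rewrite scl_scaler (fibre_set (fun q => logp (nc (f q))) (sqK p (scl r z)) (disc_neq0_sq d0)).
rewrite lee_fin /G ge_max addr_ge0 ?logp_ge0// andbT lerBlDr.
exact: height_le (sqK _ _).
Qed.

(** [theta_bound] on both sheets, integrated by means of Fatou's lemma.  The truncation level of [ell]
is the index of the averages over circles, so that a single limit is taken. *)
Lemma mtilde_vf_le theta r s B : lift_of_partial p theta -> 1 <= r -> 0 < s <= 1 ->
  (forall k, 0 <= k -> (smean (fun z => ell p k (scl r z)) <= (n%:R * ln r + B)%:E)%E) ->
  forall c : \bar R, (forall t, (hmean (r * nc (1 + s%:C%C * cis t))%R <= c)%E) ->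
    (forall t, 0 < nc (1 + s%:C%C * cis t)) ->
    (hmean (r * Num.sqrt (1 + s ^+ 2))%R <= c)%E -> (hmean r <= c)%E ->
  (mtilde sigma p (vf_apply p theta f) r <= 2%:E * (c + c + c +
     (n%:R * ln r + B + ln 2 + logp (deriv_const p n * r ^+ n.+1 / s))%R%:E))%E.
Proof.
move=> lt r1 s01 HB c c1 cpos c2 c3; have r0 : 0 < r by lra.
pose V1 t z := height (quat (r%:C%C * (1 + s%:C%C * cis t)) 0 z).
pose V2 t z := height (quat r%:C%C (r%:C%C * (s%:C%C * cis t)) z).
have cV1 t : continuous (V1 t) by exact: cHq.
have cV2 t : continuous (V2 t) by exact: cHq.
have V10 t z : 0 <= V1 t z by exact: H0.
have V20 t z : 0 <= V2 t z by exact: H0.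
have cA1 N := @continuous_circle_avg R T2 N V1 cV1.
have cA2 N := @continuous_circle_avg R T2 N V2 cV2.
have A10 N z : 0 <= circle_avg N (V1^~ z) by apply: circle_avg_ge0 => t; exact: V10.
have A20 N z : 0 <= circle_avg N (V2^~ z) by apply: circle_avg_ge0 => t; exact: V20.
pose Q := ln 2 + logp (deriv_const p n * r ^+ n.+1 / s).
have Q0 : 0 <= Q by rewrite addr_ge0 ?ln2_ge0 ?logp_ge0.
have cQ : continuous (fun _ : T2 => Q) by move=> z; exact: cvg_cst.
have cHr : continuous (fun z => height (scl r z)) by exact: cHq.
have Hr0 z : 0 <= height (scl r z) by exact: H0.
have E0 (N : nat) z : 0 <= ell p N%:R (scl r z) by exact: ell_ge0.
pose h1 N z := circle_avg N (V1^~ z) + circle_avg N (V2^~ z).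
pose h2 N z := h1 N z + height (scl r z).
pose h3 N z := h2 N z + ell p N%:R (scl r z).
pose h4 N z := h3 N z + Q.
have ch1 N : continuous (h1 N) by move=> z; exact: (cvgD (cA1 N z) (cA2 N z)).
have ch2 N : continuous (h2 N) by move=> z; exact: (cvgD (ch1 N z) (cHr z)).
have ch3 N : continuous (h3 N) by move=> z; exact: (cvgD (ch2 N z) (@cEll N%:R r z)).
have ch4 N : continuous (h4 N) by move=> z; exact: (cvgD (ch3 N z) (cQ z)).
have h10 N z : 0 <= h1 N z by exact: addr_ge0.
have h20 N z : 0 <= h2 N z by exact: addr_ge0.
have h30 N z : 0 <= h3 N z by exact: addr_ge0.
have h40 N z : 0 <= h4 N z by exact: addr_ge0.
have c2h N : continuous (fun z => 2 * h4 N z).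
  by move=> z; apply: cvgM; [exact: cvg_cst|exact: ch4].
apply: (@integral_le_of_eventually_le _ (borelC2 R) R sigma (@S3 R) _ (fun N z => 2 * h4 N z)).
- exact: measurable_S3.
- by move=> N; exact: measC.
- by move=> N z _; rewrite mulr_ge0.
- by move=> z _; apply: fibre_ge0 => q; exact: logp_ge0.
- move=> z zS; rewrite scl_scaler.
  have [d0|d0] := eqVneq (disc p (scl r z)) 0.
    have [x ->] := fibre_fin (fun q => logp (nc (vf_apply p theta f q))) (scl r z).
    (* At a branch point [ell] equals [N], which outgrows the finite fibre sum. *)
    exists (Num.truncn x).+1 => N NN; rewrite lee_fin /h4 /h3 ell_disc0//.
    have : x < N%:R by apply: (lt_le_trans (truncnS_gt _)); rewrite ler_nat.
    by have := h20 N z; have := ler0n R N; lra.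
  have E := sqK p (scl r z); have w0 := disc_neq0_sq d0.
  have E' : (- sq p (scl r z)) ^+ 2 = disc p (scl r z) by rewrite sqrrN.
  have [l [l0 dl [k0 Hk]]] := ell_stable d0.
  have [N1 HN1] := theta_bound hf sp n_gt1 lt r1 zS s01 E d0 l0 dl.
  have [N2 HN2] := theta_bound hf sp n_gt1 lt r1 zS s01 E' d0 l0 dl.
  exists (maxn (Num.truncn k0).+1 (maxn N1 N2)) => N.
  rewrite !geq_max => /andP[Nk /andP[/HN1 {}HN1 /HN2 {}HN2]].
  rewrite (fibre_set (fun q => logp (nc (vf_apply p theta f q))) E w0) lee_fin.
  have kN : k0 <= N%:R by apply/ltW/(lt_le_trans (truncnS_gt _)); rewrite ler_nat.
  rewrite /h4 /h3 /h2 /h1 /Q (Hk _ kN) mulr_natl mulr2n.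
  by apply: lerD; [move: HN1|move: HN2]; rewrite !addrA.
- move=> N; rewrite -/(smean (fun z => 2 * h4 N z)) smeanZ//.
  rewrite lee_pmul2l// /h4 smeanD// /h3 smeanD// /h2 smeanD// /h1 smeanD//.
  rewrite (smean_cst hsigma) -addeA.
  have b1 : (smean (fun z => circle_avg N (V1^~ z)) <= c)%E.
    apply: smean_circle_avg => [t|t z|t]; [exact: cV1|exact: V10|].
    have rp : 0 < r * nc (1 + s%:C%C * cis t) by rewrite mulr_gt0.
    have al : nc (r%:C%C * (1 + s%:C%C * cis t)) ^+ 2 + nc 0 ^+ 2 =
        (r * nc (1 + s%:C%C * cis t)) ^+ 2.
      by rewrite Normc.normcM normc_real (gtr0_norm r0) Normc.normc0 [0 ^+ 2]expr0n addr0.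
    by rewrite /V1 (smean_quat hsigma rp al cH H0); exact: c1.
  have b2 : (smean (fun z => circle_avg N (V2^~ z)) <= c)%E.
    apply: smean_circle_avg => [t|t z|t]; [exact: cV2|exact: V20|].
    have q1 : 0 < 1 + s ^+ 2 by rewrite ltr_wpDr// sqr_ge0.
    have rp : 0 < r * Num.sqrt (1 + s ^+ 2) by rewrite mulr_gt0// sqrtr_gt0.
    have /andP[s0 _] := s01.
    have al : nc r%:C%C ^+ 2 + nc (r%:C%C * (s%:C%C * cis t)) ^+ 2 =
        (r * Num.sqrt (1 + s ^+ 2)) ^+ 2.
      rewrite !Normc.normcM normc_cis !normc_real (gtr0_norm r0) (gtr0_norm s0).
      by rewrite [RHS]exprMn sqr_sqrtr ?(ltW q1)//; ring.
    by rewrite /V2 (smean_quat hsigma rp al cH H0); exact: c2.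
  apply: leeD; first exact: (leeD (leeD b1 b2) c3).
  rewrite (_ : n%:R * ln r + B + ln 2 + logp _ = (n%:R * ln r + B) + Q); last by rewrite /Q !addrA.
  by rewrite (EFinD (n%:R * ln r + B)); exact: (leeD (HB N%:R (ler0n _ _)) (lexx _)).
Qed.

End proximity_estimates.

(** * The inequality *)

Theorem theorem4p2 (R : realType) (sigma : probability (borelC2 R) R)
    (hsigma : rotation_invariant_on_S3 sigma) :
  exists K : {poly R}, (size K <= 2)%N /\
  forall (n : nat) (p : {poly R[i]}) (f : C3 R -> C R) (theta : C3 R -> C3 R),
    (3 <= n)%N -> size p = n.+1 -> simple_zeros p ->
    holomorphic_on_Dp p f -> lift_of_partial p theta ->
  exists (L r0 : R) (E : set R),
    [/\ measurable E, E `<=` `]0, +oo[, (lebesgue_measure E < +oo)%E &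
    forall r : R, r0 < r -> ~ E r ->
      (mtilde sigma p (vf_apply p theta f) r
         <= 14%:E * mtilde sigma p f r + (K.[n%:R] * ln r + L)%:E)%E].
Proof.
(* Twice the sum of [n], from the branch curve, and [n + 2], from [r ^+ n.+1 / s]. *)
exists (4%:P * 'X + 4%:P); split.
  by rewrite size_MXaddC; case: ifP => // _; rewrite ltnS size_polyC_leq1.
move=> n p f theta n3 sp _ hf lt.
have -> : (4%:P * 'X + 4%:P : {poly R}).[n%:R] = 4 * n%:R + 4.
  by rewrite hornerD hornerM hornerX !hornerC.
have n1 : (1 < n)%N by exact: ltnW.
have [r1 [B [r11 [B0 HB]]]] := smean_ell_le hsigma sp n1.
have [r2 r21 Hnull] := branch_null hsigma sp n1.
pose T := hmean sigma p f.
have Tmono := hmean_mono hsigma hf sp n1 r11 B0 HB.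
have [E [mE E0 Efin growth]] := borel_growth (lt_le_trans ltr01 r11) Tmono.
pose D := logp (deriv_const p n).
exists (14 * (1 + ln 2) + 2 * (B + ln 2 + D)), (2 * r1 + r2), E; split=> // r rr rE.
have r0 : 0 < r by lra.
have lr : 0 <= ln r by apply: ln_ge0; lra.
have D0 : 0 <= D by exact: logp_ge0.
have l20 : 0 <= ln 2 :> R := ln2_ge0 R.
have M0 : (0 <= mtilde sigma p f r)%E.
  apply: integral_ge0 => z _; apply: fsume_ge0 => q _.
  by rewrite lee_fin; exact: logp_ge0.
have TM : (T r <= mtilde sigma p f r + (ln 2)%:E)%E.
  by apply: (hmean_le_mtilde hsigma hf); apply: Hnull; lra.
case: (mtilde sigma p f r) M0 TM => [m|_ _|//].
  2: by rewrite gt0_muley// addye// leey.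
rewrite lee_fin => m0 TM.
have t1 : 1 <= 1 + m + ln 2 by lra.
(* The bound [ln 2] of [hmean] against [mtilde], and 1 for Borel's lemma. *)
set t := 1 + m + ln 2 in t1 *.
have Tt : (T r <= t%:E)%E.
  by apply: (le_trans TM); rewrite -EFinD lee_fin /t; lra.
have Tg : (T (r + t^-1)%R <= (2 * t)%:E)%E by apply: growth => //; lra.
have t0 : 0 < t by lra.
(* Then [r * (1 + s)] is the radius [r + t^-1] in Borel's lemma. *)
pose s := (r * t)^-1.
have rt : 2 <= r * t by nra.
have s0 : 0 < s by rewrite invr_gt0; lra.
have s2 : s <= 2^-1 by rewrite lef_pV2 ?posrE; lra.
have rs : r * (1 + s) = r + t^-1.
  by rewrite /s; field; rewrite !gt_eqF.
have Tle x : r1 <= x -> x <= r * (1 + s) -> (T x <= (2 * t)%:E)%E.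
  by move=> x1 xr; apply: le_trans Tg; rewrite -rs; exact: Tmono.
have nc1 u : 1 - s <= Normc.normc (1 + s%:C%C * cis u) <= 1 + s.
  have ns : Normc.normc (s%:C%C * cis u) = s.
    by rewrite Normc.normcM normc_cis normc_real gtr0_norm ?mulr1.
  have n11 : Normc.normc (1 : R[i]) = 1 by exact: Normc.normc1.
  have := normcD_le 1 (s%:C%C * cis u); rewrite ns n11 => ->; rewrite andbT.
  have := normcD_le (1 + s%:C%C * cis u) (- (s%:C%C * cis u)).
  by rewrite addrK normcNE ns n11 lerBlDr.
have bound := @mtilde_vf_le R sigma hsigma p f n hf sp n1 theta r s B lt.
have sq1 : Num.sqrt (1 + s ^+ 2) <= 1 + s.
  rewrite -[leRHS]ger0_norm; last lra.
  by rewrite -sqrtr_sqr ler_sqrt; nra.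
have sq2 : 1 <= Num.sqrt (1 + s ^+ 2).
  by rewrite -[leLHS]sqrtr1 ler_sqrt; nra.
apply: (le_trans (bound _ _ _ (2 * t)%:E _ _ _ _)).
- lra.
- by rewrite s0; lra.
- by move=> k; apply: HB; lra.
- by move=> u; have /andP[a b] := nc1 u; apply: Tle; nra.
- by move=> u; have /andP[a _] := nc1 u; lra.
- by apply: Tle; nra.
- by apply: Tle; nra.
rewrite -!EFinD -!EFinM lee_fin.
have lnt : ln t <= t by apply: ltW; exact: ln_sublinear.
have : logp (deriv_const p n * r ^+ n.+1 / s) <= D + n.+2%:R * ln r + ln t.
  have -> : deriv_const p n * r ^+ n.+1 / s = deriv_const p n * (r ^+ n.+2 * t).
    by rewrite /s invrK !exprS; ring.
  have r1n : 1 <= r ^+ n.+2 by apply: exprn_ege1; lra.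
  have rt1 : 1 <= r ^+ n.+2 * t by nra.
  apply: (le_trans (logpM_le _ _)); [|by lra|].
    rewrite /deriv_const; have := coef_sum_ge0 p; have := coef_sum_ge0 p^`().
    have : 0 <= (2 : R) ^+ n by rewrite exprn_ge0.
    by have := expR_gt0 (1 : R) => *; rewrite addr_ge0 ?mulr_ge0//; lra.
  rewrite -addrA lerD2l (logp_ge1 rt1) lnM ?posrE; [|lra|lra].
  by rewrite lnXn// mulr_natl.
have -> : n.+2%:R = n%:R + 2 :> R by rewrite -addn2 natrD.
rewrite /t in lnt *; nra.
Qed.
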